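(* Let $(M,J,[\nabla])$ be a complex projective surface with Cartan geometry $(\pi:B\to M,\theta)$. If $U\subset B$ is a connected open set on which there exist functions $h_{i\bar\jmath}=\overline{h_{j\bar\imath}}$, $h_i$ and $h$ that satisfy the rank $9$ linear system $$\begin{aligned} \mathrm{d}h_{i\bar\jmath}&=2h_{i\bar\jmath}\,\mathrm{Re}(\theta^0_0)+h_{i\bar s}\,\overline{\theta^s_j}+h_{s\bar\jmath}\,\theta^s_i+h_i\,\overline{\varepsilon_{sj}\theta^s_0}+\overline{h_j}\,\varepsilon_{si}\theta^s_0,\\ \mathrm{d}h_k&=2\mathrm{i}\,h_k\,\mathrm{Im}(\theta^0_0)+h_l\,\theta^l_k+h_{k\bar\imath}\,\overline{\varepsilon^{ij}\theta^0_j}+\left(\varepsilon_{kl}h-\tfrac12\overline{\varepsilon^{ij}}\,h_{s\bar\imath}W^s_{kl\bar\jmath}\right)\theta^l_0,\\ \mathrm{d}h&=-2h\,\mathrm{Re}(\theta^0_0)-2\varepsilon^{lk}\,\mathrm{Re}(h_l\theta^0_k)+\tfrac12\overline{\varepsilon^{ij}}\varepsilon^{kl}\,\mathrm{Re}\!\left(h_{k\bar\imath}K_{ls\bar\jmath}\theta^s_0\right), \end{aligned}$$ and $h_{1\bar1}h_{2\bar2}-|h_{1\bar2}|^2\neq0$, then the quadratic form $$g=\frac{h_{i\bar\jmath}\,\theta^i_0\circ\overline{\theta^j_0}}{\left(h_{1\bar1}h_{2\bar2}-|h_{1\bar2}|^2\right)^2}$$ is the $\pi$-pullback to $U$ of a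 (pseudo-)Kähler metric on $\pi(U)\subset M$ that is compatible with $[\nabla]$.
   Context: Complex projective surfaces. $M$ is a complex $2$-manifold with integrable almost complex structure $J$. A complex-linear connection is an affine torsion-free connection $\nabla$ on $TM$ with $\nabla J=0$. A generalised geodesic of $\nabla$ is a smoothly immersed curve $\gamma\subset M$ such that the $2$-plane spanned by $\dot\gamma$ and $J\dot\gamma$ is parallel along $\gamma$, i.e. $\nabla_{\dot\gamma}\dot\gamma\wedge\dot\gamma\wedge J\dot\gamma=0$. Two complex-linear torsion-free connections are complex projectively equivalent if they have the same generalised geodesics; an equivalence class $[\nabla]$ is a complex projective structure, and $(M,J,[\nabla])$ is a complex projective surface. A (pseudo-)Kähler metric is compatible with $[\nabla]$ if its Levi-Civita connection belongs to $[\nabla]$ (restricted to the domain of the metric). Indices $i,j,k,l,s,\dots$ run over $\{1,2\}$ and repeated indices are summed; $\varepsilon_{ij}$ is the antisymmetric $2\times2$ matrix with $\varepsilon_{12}=1$ and $\varepsilon^{ij}$ is the inverse matrix; $\circ$ is the symmetric product of $1$-forms. The functions $h_{i\bar\jmath}$ and $h_i$ are complex-valued and $h$ is real-valued. In local holomorphic coordinates $z=(z^1,z^2):V\to\mathbb{C}^2$ on $M$ the complex Christoffel symbols are defined by $\nabla_{\partial_{z^j}}\partial_{z^k}=\Gamma^i_{jk}\partial_{z^i}$, and $$\Pi^i_{jk}=\Gamma^i_{jk}-\tfrac13\left(\Gamma^l_{lj}\delta^i_k+\Gamma^l_{lk}\delta^i_j\right)$$ depends only on $[\nabla]$ and the coordinates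 $z$. Cartan geometry (known fact). Let $P\subset \mathrm{PSL}(3,\mathbb{C})$ be the stabiliser of $[1,0,0]^t\in\mathbb{CP}^2$. There is, up to isomorphism, a unique real Cartan geometry $(\pi:B\to M,\theta)$ of type $(\mathrm{PSL}(3,\mathbb{C}),P)$, with $\theta=(\theta^a_b)_{a,b=0,1,2}$ (row index $a$, column index $b$, $\theta$ trace-free), such that for every local holomorphic coordinate system $z$ on $V\subset M$ there is a unique section $\sigma_z:V\to B$ with $\sigma_z^*\theta^0_0=0$, $\sigma_z^*\theta^i_0=\mathrm{d}z^i$, $\sigma_z^*\theta^i_j=\Pi^i_{jk}\mathrm{d}z^k$, $\sigma_z^*\theta^0_i=\Pi_{ik}\mathrm{d}z^k$, where $\Pi_{ij}=\Pi^k_{il}\Pi^l_{jk}-\partial\Pi^k_{ij}/\partial z^k$. This is ''the Cartan geometry'' of $(M,J,[\nabla])$. Curvature. $\Theta=\mathrm{d}\theta+\theta\wedge\theta$ satisfies $\Theta^0_0=\Theta^i_0=0$ and $$\Theta^0_i=L_i\,\theta^1_0\wedge\theta^2_0+K_{il\bar\jmath}\,\theta^l_0\wedge\overline{\theta^j_0},\qquad \Theta^i_k=W^i_{kl\bar\jmath}\,\theta^l_0\wedge\overline{\theta^j_0}$$ for unique complex-valued functions $L_i,K_{il\bar\jmath},W^i_{kl\bar\jmath}$ on $B$ with $W^l_{li\bar\jmath}=0$; these $W^i_{kl\bar\jmath}$ and $K_{il\bar\jmath}$ are the functions appearing in the system.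
   Formalization: The fibres of π restricted to U are assumed connected: otherwise a solution can have monodromy and g can take different values over one point of M (e.g. on a flat Hopf surface), so g is not a pullback. The functions h are taken smooth. *)

(* Defs.v *)
From HB Require Import structures.
From mathcomp Require Import all_boot all_order all_algebra.
From mathcomp Require Import all_classical all_reals all_analysis.
From mathcomp Require Import complex.

Set Implicit Arguments.
Unset Strict Implicit.
Unset Printing Implicit Defensive.

Import Order.TTheory GRing.Theory Num.Theory.
Import numFieldNormedType.Exports.

Local Open Scope classical_set_scope.
Local Open Scope ring_scope.

(* * Smooth functions between normed spaces *)

Section Smooth.
Context {R : realType}.
Local Notation C := R[i].

(* Meant for open D and finite-dimensional E: class C^k on D. *)
Fixpoint Ck {E F : normedModType R} (k : nat) (f : E -> F) (D : set E) : Prop :=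
  match k with
  | 0 => forall x, D x -> {for x, continuous f}
  | k'.+1 => (forall x, D x -> differentiable f x) /\
             (forall v, Ck k' (fun x => 'd f x v) D)
  end.

Definition smooth_on {E F : normedModType R} (f : E -> F) (D : set E) : Prop :=
  forall k, Ck k f D.

Definition smoothC_on {E : normedModType R} (f : E -> C) (D : set E) : Prop :=
  smooth_on (fun x => complex.Re (f x) : R^o) D /\
  smooth_on (fun x => complex.Im (f x) : R^o) D.

Definition dR {E : normedModType R} (f : E -> R) (x v : E) : R :=
  'd (f : E -> R^o) x v.

Definition dC {E : normedModType R} (f : E -> C) (x v : E) : C :=
  Complex (dR (fun y => complex.Re (f y)) x v)
          (dR (fun y => complex.Im (f y)) x v).

End Smooth.

(* * Manifolds, given by a maximal atlas *)

Record chart (M : topologicalType) (E : Type) := Chart {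
  cdom : set M;
  cmap : M -> E;
  cinv : E -> M
}.

Section Manifold.
Context {R : realType}.

Definition crange {M : topologicalType} {E : normedModType R} (c : chart M E) :
  set E := cmap c @` cdom c.

Definition is_chart {M : topologicalType} {E : normedModType R}
    (c : chart M E) : Prop :=
  [/\ open (cdom c) /\ open (crange c),
      forall x, cdom c x -> {for x, continuous (cmap c)},
      forall y, crange c y -> {for y, continuous (cinv c)} &
      forall x, cdom c x -> cinv c (cmap c x) = x].

Definition transition {M : topologicalType} {E : normedModType R}
  (c c' : chart M E) : E -> E := fun y => cmap c' (cinv c y).

Definition overlap {M : topologicalType} {E : normedModType R}
  (c c' : chart M E) : set E := cmap c @` (cdom c `&` cdom c').

(* G f D says that f, on the open set D, is an admissible change of
   coordinates. *)
Record manifold (E : normedModType R) (G : (E -> E) -> set E -> Prop) :=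
  Manifold {
  mcar :> topologicalType;
  atlas : set (chart mcar E);
  mfd_hausdorff : hausdorff_space mcar;
  mfd_second_countable : @second_countable mcar;
  atlas_chart : forall c, atlas c -> is_chart c;
  atlas_cover : forall x, exists2 c, atlas c & cdom c x;
  atlas_compat : forall c c', atlas c -> atlas c' ->
    G (transition c c') (overlap c c');
  atlas_maximal : forall c, is_chart c ->
    (forall c', atlas c' -> G (transition c c') (overlap c c') /\
                            G (transition c' c) (overlap c' c)) ->
    atlas c
}.

End Manifold.
Arguments atlas {R E G} _.

Section SmoothMaps.
Context {R : realType} {E : normedModType R} {G : (E -> E) -> set E -> Prop}.
Local Notation C := R[i].

Definition smooth_to {F : normedModType R} {M : manifold G} (f : F -> M)
    (D : set F) : Prop :=
  (forall y, D y -> {for y, continuous f}) /\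
  (forall c, atlas M c ->
     smooth_on (fun y => cmap c (f y)) (D `&` f @^-1` cdom c)).

Definition smooth_fun {M : manifold G} (f : M -> C) (D : set M) : Prop :=
  forall c, atlas M c ->
    smoothC_on (fun y => f (cinv c y)) (cmap c @` (cdom c `&` D)).

(* The differential of f at x, on tangent vectors given by their components
   in the chart c. *)
Definition dfun {M : manifold G} (f : M -> C) (c : chart M E) (x : M) (v : E) :
  C := dC (fun y => f (cinv c y)) (cmap c x) v.

(* Tensor fields are families indexed by the charts and evaluated on components;
   [form1] is the type of the families which may be complex 1-forms. *)
Definition form1 (M : manifold G) := chart M E -> M -> E -> C.

Definition is_form1 {M : manifold G} (a : form1 M) : Prop :=
  [/\ forall c x, atlas M c -> cdom c x ->
        forall (r : R) u v, a c x (r *: u + v) = r%:C%C * a c x u + a c x v,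
      forall c c' x, atlas M c -> atlas M c' -> cdom c x -> cdom c' x ->
        forall v, a c' x ('d (transition c c') (cmap c x) v) = a c x v &
      forall c v, atlas M c ->
        smoothC_on (fun y => a c (cinv c y) v) (crange c)].

Definition dform1 {M : manifold G} (a : form1 M) (c : chart M E) (x : M)
    (u v : E) : C :=
  dC (fun y => a c (cinv c y) v) (cmap c x) u -
  dC (fun y => a c (cinv c y) u) (cmap c x) v.

End SmoothMaps.

Section Maps.
Context {R : realType}.
Context {E E' : normedModType R}.
Context {G : (E -> E) -> set E -> Prop} {G' : (E' -> E') -> set E' -> Prop}.

Definition smooth_map {M : manifold G} {N : manifold G'} (f : M -> N)
    (D : set M) : Prop :=
  forall c, atlas M c ->
    smooth_to (fun y => f (cinv c y)) (cmap c @` (cdom c `&` D)).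

(* The components in c' of the image under the differential of f at x of the
   vector with components v in c. *)
Definition dmap {M : manifold G} {N : manifold G'} (f : M -> N)
    (c : chart M E) (c' : chart N E') (x : M) (v : E) : E' :=
  'd (fun y => cmap c' (f (cinv c y))) (cmap c x) v.

End Maps.

(* * Complex surfaces and complex projective structures *)

Section ComplexSurface.
Context {R : realType}.
Local Notation C := R[i].

(* C^2 as a real normed space: z^k = x^k + i y^k is (x, y). *)
Definition C2 : normedModType R := ('rV[R]_2 * 'rV[R]_2)%type.

Definition J0 (v : C2) : C2 := (- v.2, v.1).

Definition dz (k : 'I_2) (v : C2) : C := Complex (v.1 0 k) (v.2 0 k).
Definition ex (k : 'I_2) : C2 := (delta_mx 0 k, 0).
Definition ey (k : 'I_2) : C2 := (0, delta_mx 0 k).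

Definition holomorphic_on (f : C2 -> C2) (D : set C2) : Prop :=
  smooth_on f D /\ (forall y v, D y -> 'd f y (J0 v) = J0 ('d f y v)).

(* The atlas consists of all local holomorphic coordinate systems; the almost
   complex structure J acts as J0 on components in any of them. *)
Definition complex_surface := manifold holomorphic_on.

(* An affine connection as its family of (real) Christoffel symbols:
   in the chart c, nabla_u v = d v (u) + nabla c x u v. *)
Definition connection (M : complex_surface) :=
  chart M C2 -> M -> C2 -> C2 -> C2.

Section Connections.
Variable M : complex_surface.
Implicit Types (nabla : connection M) (V : set M) (c : chart M C2).

Definition affine_connection V nabla : Prop :=
  [/\ forall c x, atlas M c -> (cdom c `&` V) x ->
        forall (r : R) u u' v,
          nabla c x (r *: u + u') v = r *: nabla c x u v + nabla c x u' v /\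
          nabla c x v (r *: u + u') = r *: nabla c x v u + nabla c x v u',
      forall c u v, atlas M c ->
        smooth_on (fun y => nabla c (cinv c y) u v) (cmap c @` (cdom c `&` V)) &
      forall c c' x, atlas M c -> atlas M c' -> (cdom c `&` cdom c' `&` V) x ->
        forall u v, let t := transition c c' in let y := cmap c x in
          nabla c' x ('d t y u) ('d t y v) =
          'd t y (nabla c x u v) - 'd (fun y' => 'd t y' v) y u].

Definition torsion_free V nabla : Prop :=
  forall c x, atlas M c -> (cdom c `&` V) x ->
    forall u v, nabla c x u v = nabla c x v u.

(* nabla J = 0 *)
Definition J_parallel V nabla : Prop :=
  forall c x, atlas M c -> (cdom c `&` V) x ->
    forall u v, nabla c x u (J0 v) = J0 (nabla c x u v).

Definition complex_linear_connection V nabla : Prop :=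
  [/\ affine_connection V nabla, torsion_free V nabla & J_parallel V nabla].

Definition immersed_curve V (a b : R) (gamma : R^o -> M) : Prop :=
  [/\ smooth_to gamma [set t | a < t < b],
      forall t, a < t < b -> V (gamma t) &
      forall t c, a < t < b -> atlas M c -> cdom c (gamma t) ->
        derive1 (fun s : R^o => cmap c (gamma s)) t != 0].

(* u /\ v /\ w = 0 *)
Definition wedge3_eq0 (u v w : C2) : Prop :=
  exists a b d : R, (a, b, d) <> (0, 0, 0) /\ a *: u + b *: v + d *: w = 0.

Definition generalised_geodesic nabla (a b : R) (gamma : R^o -> M) : Prop :=
  forall t c, a < t < b -> atlas M c -> cdom c (gamma t) ->
    let g1 := derive1 (fun s : R^o => cmap c (gamma s)) in
    wedge3_eq0 (derive1 g1 t + nabla c (gamma t) (g1 t) (g1 t)) (g1 t) (J0 (g1 t)).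

Definition complex_projectively_equivalent V nabla nabla' : Prop :=
  forall (a b : R) (gamma : R^o -> M), immersed_curve V a b gamma ->
    (generalised_geodesic nabla a b gamma <->
     generalised_geodesic nabla' a b gamma).

(* Gamma^i_jk = dz^i (nabla_{d/dz^j} d/dz^k), with dz^i and nabla extended
   complex-linearly and d/dz^k = (d/dx^k - i d/dy^k) / 2. *)
Definition Gamma nabla c (x : M) (i j k : 'I_2) : C :=
  4^-1 * (dz i (nabla c x (ex j) (ex k))
          - 'i * dz i (nabla c x (ex j) (ey k))
          - 'i * dz i (nabla c x (ey j) (ex k))
          - dz i (nabla c x (ey j) (ey k))).

Definition Pi nabla c (x : M) (i j k : 'I_2) : C :=
  Gamma nabla c x i j k -
  3^-1 * ((\sum_(l < 2) Gamma nabla c x l l j) * (i == k)%:R +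
          (\sum_(l < 2) Gamma nabla c x l l k) * (i == j)%:R).

(* the derivative of f with respect to z^k *)
Definition ddz c (f : M -> C) (x : M) (k : 'I_2) : C :=
  2^-1 * (dfun f c x (ex k) - 'i * dfun f c x (ey k)).

Definition Pi2 nabla c (x : M) (i j : 'I_2) : C :=
  \sum_(k < 2) \sum_(l < 2) Pi nabla c x k i l * Pi nabla c x l j k -
  \sum_(k < 2) ddz c (fun x' => Pi nabla c x' k i j) x k.

(* * (Pseudo-)Kaehler metrics *)

Definition bilinear_field := chart M C2 -> M -> C2 -> C2 -> R.

Definition pseudo_riemannian V (g : bilinear_field) : Prop :=
  [/\ forall c x, atlas M c -> (cdom c `&` V) x ->
        forall (r : R) u u' v,
          g c x (r *: u + u') v = r * g c x u v + g c x u' v /\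
          g c x u v = g c x v u,
      forall c c' x, atlas M c -> atlas M c' -> (cdom c `&` cdom c' `&` V) x ->
        forall u v, let t := transition c c' in let y := cmap c x in
          g c' x ('d t y u) ('d t y v) = g c x u v,
      forall c u v, atlas M c ->
        smooth_on (fun y => g c (cinv c y) u v : R^o)
          (cmap c @` (cdom c `&` V)) &
      forall c x u, atlas M c -> (cdom c `&` V) x ->
        (forall v, g c x u v = 0) -> u = 0].

Definition hermitian V (g : bilinear_field) : Prop :=
  forall c x, atlas M c -> (cdom c `&` V) x ->
    forall u v, g c x (J0 u) (J0 v) = g c x u v.

(* The 2-form g (J u, v) is closed. *)
Definition closed_fundamental_form V (g : bilinear_field) : Prop :=
  forall c x, atlas M c -> (cdom c `&` V) x ->
    forall u v w,
      let om u v := fun y => g c (cinv c y) (J0 u) v in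
      let y := cmap c x in
      dR (om v w) y u - dR (om u w) y v + dR (om u v) y w = 0.

Definition pseudo_kaehler V (g : bilinear_field) : Prop :=
  [/\ pseudo_riemannian V g, hermitian V g & closed_fundamental_form V g].

Definition levi_civita V (g : bilinear_field) nabla : Prop :=
  [/\ affine_connection V nabla, torsion_free V nabla &
      forall c x, atlas M c -> (cdom c `&` V) x ->
        forall u v w,
          dR (fun y => g c (cinv c y) v w) (cmap c x) u =
          g c x (nabla c x u v) w + g c x v (nabla c x u w)].

(* The metric g with domain V is compatible with the class of nabla. *)
Definition compatible V nabla (g : bilinear_field) : Prop :=
  exists nabla' : connection M,
    [/\ levi_civita V g nabla', complex_linear_connection V nabla' &
        complex_projectively_equivalent V nabla nabla'].

End Connections.

(* * The Cartan geometry *)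

(* Lie algebra and group elements are indexed by a, b in {0, 1, 2}; the
   indices i, j, ... in {1, 2} are shifted from 'I_2. *)
Definition sh (i : 'I_2) : 'I_3 := lift ord0 i.

(* The preimage in SL(3, C) of the stabiliser P of [1, 0, 0]^t in
   PSL(3, C) = SL(3, C) / (scalars). *)
Definition stab : set 'M[C]_3 :=
  [set p | \det p = 1 /\
           exists a : C, p *m delta_mx 0 0 = a *: (delta_mx 0 0 : 'cV_3)].

(* Global coordinates on [stab]: the matrix with blocks (det A)^-1, b, 0, A is
   given by the real and imaginary parts of A and b. *)
Definition stab_model : normedModType R :=
  (('M[R]_2 * 'M[R]_2) * ('rV[R]_2 * 'rV[R]_2))%type.

Definition cplx_mx {m n} (X Y : 'M[R]_(m, n)) : 'M[C]_(m, n) :=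
  \matrix_(i, j) Complex (X i j) (Y i j).

Definition stab_mx (q : stab_model) : 'M[C]_3 :=
  let A := cplx_mx q.1.1 q.1.2 in
  block_mx ((\det A)^-1)%:M (cplx_mx q.2.1 q.2.2) 0 A
    : 'M[C]_(1 + 2, 1 + 2).

Definition stab_dom : set stab_model :=
  [set q | \det (cplx_mx q.1.1 q.1.2) != 0].

Definition stab1 : stab_model := ((1%:M, 0), (0, 0)).

Definition dstab_mx (w : stab_model) : 'M[C]_3 :=
  \matrix_(a, b) dC (fun q => stab_mx q a b) stab1 w.

Definition R16 : normedModType R := 'rV[R]_16.

(* An element of PSL(3, C) acts through any of its lifts to SL(3, C). *)
Record principal_bundle (M : complex_surface) := PrincipalBundle {
  btotal :> manifold (@smooth_on R R16 R16);
  bproj : btotal -> M;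
  bact : btotal -> 'M[C]_3 -> btotal;
  proj_smooth : smooth_map bproj setT;
  proj_surjective : forall x, exists b, bproj b = x;
  proj_submersion : forall b e c, atlas btotal e -> atlas M c ->
    cdom e b -> cdom c (bproj b) ->
    forall u, exists v, dmap bproj e c b v = u;
  act_smooth : forall e, atlas btotal e ->
    smooth_to
      (fun yq : (R16 * stab_model)%type => bact (cinv e yq.1) (stab_mx yq.2))
      (crange e `*` stab_dom);
  act1 : forall b, bact b 1%:M = b;
  actM : forall b p q, stab p -> stab q -> bact (bact b p) q = bact b (p *m q);
  act_free : forall b p, stab p -> (bact b p = b <-> exists a : C, p = a%:M);
  act_fibre : forall b b',
    bproj b = bproj b' <-> exists2 p, stab p & b' = bact b p
}.
Arguments bproj {M} B b : rename.

Section CartanConnection.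
Variables (M : complex_surface) (B : principal_bundle M).

Definition mform1 := chart B R16 -> B -> R16 -> 'M[C]_3.

Definition entry (theta : mform1) (a b : 'I_3) : form1 B :=
  fun e x v => theta e x v a b.

(* A Cartan connection with values in sl(3, C) *)
Record cartan_connection (theta : mform1) : Prop := {
  theta_form : forall a b, is_form1 (entry theta a b);
  theta_tr : forall e b v, atlas B e -> cdom e b -> \tr (theta e b v) = 0;
  theta_inj : forall e b v, atlas B e -> cdom e b -> theta e b v = 0 -> v = 0;
  theta_surj : forall e b A, atlas B e -> cdom e b -> \tr A = 0 ->
    exists v, theta e b v = A;
  theta_equivariant : forall e e' b p v, atlas B e -> atlas B e' ->
    stab p -> cdom e b -> cdom e' (bact b p) ->
    theta e' (bact b p) (dmap (fun b' => bact b' p) e e' b v) =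
    invmx p *m theta e b v *m p;
  theta_fundamental : forall e b w, atlas B e -> cdom e b ->
    theta e b ('d (fun q => cmap e (bact b (stab_mx q))) stab1 w) = dstab_mx w
}.

Definition wedge2 (a b : form1 B) (e : chart B R16) (x : B)
    (u v : R16) : C :=
  a e x u * b e x v - a e x v * b e x u.

Definition form1_conj (a : form1 B) : form1 B := fun e x v => (a e x v)^*.

Definition curvature (theta : mform1) (a b : 'I_3) (e : chart B R16)
    (x : B) (u v : R16) : C :=
  dform1 (entry theta a b) e x u v +
  \sum_(c < 3) wedge2 (entry theta a c) (entry theta c b) e x u v.

(* L i, K i l j and W i k l j are L_i, K_{i l \bar j} and W^i_{k l \bar j}. *)
Definition curvature_functions (theta : mform1) (L : 'I_2 -> B -> C)
    (K : 'I_2 -> 'I_2 -> 'I_2 -> B -> C)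
    (W : 'I_2 -> 'I_2 -> 'I_2 -> 'I_2 -> B -> C) : Prop :=
  [/\ forall i e b u v, atlas B e -> cdom e b ->
        curvature theta 0 (sh i) e b u v =
        L i b * wedge2 (entry theta (sh 0) 0) (entry theta (sh 1) 0) e b u v +
        \sum_(l < 2) \sum_(j < 2) K i l j b *
          wedge2 (entry theta (sh l) 0) (form1_conj (entry theta (sh j) 0))
            e b u v,
      forall i k e b u v, atlas B e -> cdom e b ->
        curvature theta (sh i) (sh k) e b u v =
        \sum_(l < 2) \sum_(j < 2) W i k l j b *
          wedge2 (entry theta (sh l) 0) (form1_conj (entry theta (sh j) 0))
            e b u v &
      forall i j b, \sum_(l < 2) W l l i j b = 0].

(* s is the section sigma_z for the coordinate system z = c. *)
Definition adapted_section (nabla : connection M) (theta : mform1)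
    (c : chart M C2) (s : M -> B) : Prop :=
  [/\ smooth_map s (cdom c),
      forall x, cdom c x -> bproj B (s x) = x &
      forall x e u, cdom c x -> atlas B e -> cdom e (s x) ->
        let t := theta e (s x) (dmap s c e x u) in
        [/\ t 0 0 = 0,
            forall i, t (sh i) 0 = dz i u,
            forall i j,
              t (sh i) (sh j) = \sum_(k < 2) Pi nabla c x i j k * dz k u &
            forall i, t 0 (sh i) = \sum_(k < 2) Pi2 nabla c x i k * dz k u]].

(* (B, theta) is the Cartan geometry of the class of nabla. *)
Definition cartan_geometry (nabla : connection M) (theta : mform1) : Prop :=
  cartan_connection theta /\
  forall c, atlas M c ->
    exists2 s, adapted_section nabla theta c s &
      forall s', adapted_section nabla theta c s' ->
        forall x, cdom c x -> s' x = s x.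

(* * The linear system *)

Definition eps : 'M[C]_2 := \matrix_(i, j) ((i < j)%N%:R - (j < i)%N%:R).
Definition epsV : 'M[C]_2 := invmx eps.

(* h2 i j, h1 i and h0 are h_{i \bar j}, h_i and h. *)
Definition linear_system (theta : mform1)
    (K : 'I_2 -> 'I_2 -> 'I_2 -> B -> C)
    (W : 'I_2 -> 'I_2 -> 'I_2 -> 'I_2 -> B -> C) (U : set B)
    (h2 : 'I_2 -> 'I_2 -> B -> C) (h1 : 'I_2 -> B -> C) (h0 : B -> R) : Prop :=
  forall e b v, atlas B e -> cdom e b -> U b ->
  let t := theta e b v in
  [/\ forall i j, dfun (h2 i j) e b v =
        2 * h2 i j b * 'Re (t 0 0)
        + \sum_(s < 2) h2 i s b * (t (sh s) (sh j))^*
        + \sum_(s < 2) h2 s j b * t (sh s) (sh i)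
        + h1 i b * (\sum_(s < 2) eps s j * t (sh s) 0)^*
        + (h1 j b)^* * (\sum_(s < 2) eps s i * t (sh s) 0),
      forall k, dfun (h1 k) e b v =
        2 * 'i * h1 k b * 'Im (t 0 0)
        + \sum_(l < 2) h1 l b * t (sh l) (sh k)
        + \sum_(i < 2) h2 k i b * (\sum_(j < 2) epsV i j * t 0 (sh j))^*
        + \sum_(l < 2)
            (eps k l * (h0 b)%:C%C
             - 2^-1 * \sum_(i < 2) \sum_(j < 2) \sum_(s < 2)
                        (epsV i j)^* * h2 s i b * W s k l j b)
            * t (sh l) 0 &
      dfun (fun b' => (h0 b')%:C%C) e b v =
        - 2 * (h0 b)%:C%C * 'Re (t 0 0)
        - 2 * \sum_(l < 2) \sum_(k < 2) epsV l k * 'Re (h1 l b * t 0 (sh k))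
        + 2^-1 * \sum_(i < 2) \sum_(j < 2) \sum_(k < 2) \sum_(l < 2)
                   (epsV i j)^* * epsV k l *
                   'Re (\sum_(s < 2) h2 k i b * K l s j b * t (sh s) 0)].

Definition hdet (h2 : 'I_2 -> 'I_2 -> B -> C) (b : B) : C :=
  h2 0 0 b * h2 1 1 b - `|h2 0 1 b| ^+ 2.

(* The quadratic form h_{i \bar j} theta^i_0 o conj(theta^j_0) / det^2; the
   symmetric product a o b takes the value a(v) b(v) on v. *)
Definition quadratic_form (theta : mform1) (h2 : 'I_2 -> 'I_2 -> B -> C)
    (e : chart B R16) (b : B) (v : R16) : C :=
  (\sum_(i < 2) \sum_(j < 2)
     h2 i j b * (theta e b v (sh i) 0 * (theta e b v (sh j) 0)^*))
  / hdet h2 b ^+ 2.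

(* The quadratic form Q on U is the pullback by the projection of v |-> g(v, v). *)
Definition is_pullback (U : set B) (g : bilinear_field M)
    (Q : chart B R16 -> B -> R16 -> C) : Prop :=
  forall e c b v, atlas B e -> atlas M c -> cdom e b -> U b ->
    cdom c (bproj B b) ->
    Q e b v =
    (let u := dmap (bproj B) e c b v in g c (bproj B b) u u)%:C%C.

End CartanConnection.
End ComplexSurface.
Arguments complex_surface : clear implicits.
Arguments bproj {R M} B b : rename.

(* Main.v *)
From HB Require Import structures.
Require Import Defs.
From mathcomp Require Import all_boot all_order all_algebra.
From mathcomp Require Import all_classical all_reals all_analysis.
From mathcomp Require Import complex.
From mathcomp Require Import ring lra.
Import Order.TTheory GRing.Theory Num.Theory.
Local Open Scope classical_set_scope.
Local Open Scope ring_scope.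

Set Implicit Arguments.
Unset Strict Implicit.
Unset Printing Implicit Defensive.
Import numFieldNormedType.Exports.

(* In a holomorphic chart [c] with adapted section [s], the map
   [F (y, q) = s (c^-1 y) . q] parametrises B over the chart, and the value of
   [theta] on [dF (u, w)] is [p^-1 tau(u) p] plus a Maurer-Cartan term, [p] being
   [stab_mx q].  Writing [A] for the 2x2 block of [p], the first equation of the
   system says that [(adj A)^T h conj(adj A)], evaluated at [F (y, q)], does not
   depend on [q]; it descends to a Hermitian matrix [H] of functions on the chart
   with [dH = Y + Y^*] and [Y_kl = Pi^s_k H_sl + eps_sk dz^s kappa_l].  Since [Pi]
   is trace-free, this means that [g = H / (det H)^2] is parallel for
   [nabla'_u v = nabla_u v + omega(u) v + omega(v) u], where [omega] is minus the
   sum of the (1,0)-part of [d log det H] and a third of the trace of [Gamma].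
   As [nabla'] is torsion-free and commutes with [J], it is the Levi-Civita
   connection of [g] and [g] is Kaehler; [nabla'] has the generalised geodesics of
   [nabla].  The transformation law of [nabla'] under changes of charts follows
   from the uniqueness of the Levi-Civita connection. *)

(** Two points carry the argument. Descent: a vanishing derivative along the fibre makes the matrix
    constant only along segments of [q], while the claim concerns points of B. The map [F] is open,
    because [theta] is injective and all its values are reached by [dF], so the matrix is locally
    constant on the part of [U] over each point of M; the connectedness of that part, assumed in
    [hUfibre], makes it constant. A point of B determines [q] only up to a cube root of unity, the
    kernel of SL(3, C) -> PSL(3, C), and this factor cancels against its conjugate. Dimension two:
    an expression antisymmetric in two indices is a multiple of epsilon. This moves the terms in
    [b], the unipotent part of the stabiliser, and those in h_i into the single covector kappa; read
    backwards, the same fact expresses kappa through the derivative of det H, so that the connection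
    can absorb it. The adapted sections of two charts differ, and so do their matrices H; only the
    metrics are compared, through the quadratic form on B to which both pull back. *)

Lemma open_on_preimage (S T : topologicalType) (f : S -> T) (D : set S) (O : set T) :
  open D -> (forall x, D x -> {for x, continuous f}) -> open O ->
  open (D `&` f @^-1` O).
Proof.
rewrite !openE => oD cf oO x [Dx Ofx].
apply: filterI; first exact: oD.
exact: (cf x Dx _ (oO _ Ofx)).
Qed.

(** * Calculus of differentials between normed spaces *)

Section Differentials.
Context {R : realType}.
Implicit Types E F G : normedModType R.

(** The differential is picked by choice among first-order expansions, so its locality goes through
    the uniqueness of the linear part. *)
Lemma near_eq_diff E F (f g : E -> F) x :
  (\forall y \near x, f y = g y) -> differentiable f x ->
  differentiable g x /\ 'd g x = 'd f x :> (E -> F).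
Proof.
move=> fg df.
have gE : g \o shift x = cst (g x) + 'd f x +o_ 0 id.
  have fE : f \o shift x = cst (f x) + 'd f x +o_ 0 id by apply/diff_locally.
  apply/eqaddoP => e e0; move/eqaddoP : fE => /(_ e e0).
  apply: filter_app.
  have : \forall y \near (0 : E), f (y + x) = g (y + x).
    by move: fg; rewrite (near_shift 0 x); apply: filterS => y; rewrite /= subr0.
  apply: filter_app; near=> y => fgy.
  by rewrite /= !fctE /= fgy (nbhs_singleton fg).
have dgE : 'd g x = 'd f x :> (E -> F) by apply: diff_unique gE; exact: diff_continuous.
split => //; apply/diff_locallyP; rewrite dgE; split => //; exact: diff_continuous.
Unshelve. all: by end_near. Qed.

(** The derivative is prescribed pointwise, as a plain function: unlike with [is_diff], no equality
    of functions has to be produced, and formulas for [df] can be rewritten freely. *)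
Definition has_diff E F (f : E -> F) x (df : E -> F) :=
  differentiable f x /\ forall v, 'd f x v = df v.

Lemma has_diffE E F (f : E -> F) x df v : has_diff f x df -> 'd f x v = df v.
Proof. by case. Qed.

Lemma differentiable_has_diff E F (f : E -> F) x :
  differentiable f x -> has_diff f x ('d f x).
Proof. by []. Qed.

Lemma has_diff_is_diff E F (f : E -> F) x df : is_diff x f df <-> has_diff f x df.
Proof.
split=> [[? <-]//|[d h]].
have e : ('d f x : E -> F) = df by rewrite funeqE.
exact: DiffDef d e.
Qed.

Lemma has_diff_eq E F (f : E -> F) x df df' :
  has_diff f x df -> (forall v, df v = df' v) -> has_diff f x df'.
Proof. by move=> [? h] e; split => // v; rewrite h. Qed.

Lemma near_has_diff E F (f g : E -> F) x df :
  (\forall y \near x, f y = g y) -> has_diff f x df -> has_diff g x df.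
Proof.
move=> fg [d h]; have [d' e] := near_eq_diff fg d; split => // v.
by rewrite e.
Qed.

Lemma has_diff_cst E F (a : F) (x : E) : has_diff (fun=> a) x (fun=> 0).
Proof. apply/has_diff_is_diff; exact: is_diff_cst. Qed.

Lemma has_diffD E F (f g : E -> F) x df dg :
  has_diff f x df -> has_diff g x dg ->
  has_diff (fun y => f y + g y) x (fun v => df v + dg v).
Proof.
by move=> /has_diff_is_diff hf /has_diff_is_diff hg; apply/has_diff_is_diff; exact: is_diffD.
Qed.

Lemma has_diffN E F (f : E -> F) x df :
  has_diff f x df -> has_diff (fun y => - f y) x (fun v => - df v).
Proof. by move=> /has_diff_is_diff hf; apply/has_diff_is_diff; exact: is_diffN. Qed.

Lemma has_diff_lin E F (f : {linear E -> F}) x :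
  continuous f -> has_diff f x f.
Proof.
by move=> cf; split; [exact: linear_differentiable|move=> v; rewrite diff_lin].
Qed.

Lemma has_diff_comp E F G (f : E -> F) (g : F -> G) x df dg :
  has_diff f x df -> has_diff g (f x) dg ->
  has_diff (fun y => g (f y)) x (fun v => dg (df v)).
Proof.
move=> /has_diff_is_diff hf /has_diff_is_diff hg.
apply/has_diff_is_diff; exact: is_diff_comp.
Qed.

Lemma has_diff_pair E F G (f : E -> F) (g : E -> G) x df dg :
  has_diff f x df -> has_diff g x dg ->
  has_diff (fun y => (f y, g y)) x (fun v => (df v, dg v)).
Proof.
move=> /has_diff_is_diff hf /has_diff_is_diff hg.
apply/has_diff_is_diff; exact: is_diff_pair.
Qed.

Lemma has_diffM E (f g : E -> R^o) x df dg :
  has_diff f x df -> has_diff g x dg ->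
  has_diff (fun y => f y * g y : R^o) x (fun v => f x * dg v + g x * df v).
Proof.
move=> /has_diff_is_diff hf /has_diff_is_diff hg.
apply/has_diff_is_diff; exact: is_diffM.
Qed.

Lemma has_diffV E (f : E -> R^o) x df : f x != 0 ->
  has_diff f x df -> has_diff (fun y => (f y)^-1 : R^o) x (fun v => - (f x) ^- 2 * df v).
Proof.
move=> fx [d h]; split; first exact: differentiableV.
move=> v; rewrite -h; have := @diffV _ _ f x d fx.
by move=> e; rewrite e.
Qed.

Lemma has_diff_id E (x : E) : has_diff id x id.
Proof. apply/has_diff_is_diff; exact: is_diff_id. Qed.

Lemma has_diff_fst E F (x : E * F) : has_diff fst x fst.
Proof. by have := @has_diff_lin _ _ (@fst E F) x; apply => z; exact: cvg_fst. Qed.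

Lemma has_diff_snd E F (x : E * F) : has_diff snd x snd.
Proof. by have := @has_diff_lin _ _ (@snd E F) x; apply => z; exact: cvg_snd. Qed.

Lemma has_diff_scale E F (a : E -> R^o) (f : E -> F) x da df :
  has_diff a x da -> has_diff f x df ->
  has_diff (fun y => a y *: f y) x (fun v => da v *: f x + a x *: df v).
Proof.
move=> ha hf.
(* Scaling is regarded as a continuous bilinear map; composing its differential with that of the
   pair gives the product rule. *)
have bil : bilinear_for (GRing.Scale.Law.clone _ _ *:%R _)
    (GRing.Scale.Law.clone _ _ *:%R _) (fun (k : R^o) (v : F) => k *: v).
  split => [v|k] t y z /=; first by rewrite scalerDl scalerA.
  by rewrite scalerDr !scalerA mulrC.
pose bM := @bilinear_isBilinear.Build R R^o F F _ _ _ bil.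
pose b : {bilinear R^o -> F -> F} := HB.pack (fun (k : R^o) (v : F) => k *: v) bM.
have cb : continuous (fun p : R^o * F => b p.1 p.2).
  by move=> p; apply: (@cvgZ _ _ _ _ _ _ _ p.1 p.2); [exact: cvg_fst|exact: cvg_snd].
have hb : has_diff (fun p : R^o * F => b p.1 p.2) (a x, f x)
   (fun q => a x *: q.2 + q.1 *: f x).
  by split; [exact: differentiable_bilin|move=> v; rewrite diff_bilin].
have := has_diff_comp (has_diff_pair ha hf) hb.
by move/has_diff_eq; apply => v /=; rewrite addrC.
Qed.

End Differentials.

(** * Maps of class C^k *)

Section CkTheory.
Context {R : realType}.
Implicit Types E F G : normedModType R.

Lemma Ck_sub E F k (f : E -> F) (D D' : set E) :
  D' `<=` D -> Ck k f D -> Ck k f D'.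
Proof.
move=> DD; elim: k f => [|k IH] f /=; first by move=> h x /DD /h.
by move=> [h1 h2]; split=> [x /DD /h1 //|v]; exact: IH.
Qed.

(** Each clause of [Ck] concerns the map on a full neighbourhood of a point of the set, so any set
    [N] through the point carries the information. *)
Lemma Ck_local E F k (f : E -> F) (D : set E) :
  (forall x, D x -> exists2 N : set E, N x & Ck k f N) -> Ck k f D.
Proof.
elim: k f => [|k IH] f /= h; first by move=> x /h[N Nx]; exact.
split=> [x /h[N Nx [d _]]|v]; first exact: d.
by apply: IH => x /h[N Nx [_ d]]; exists N.
Qed.

Lemma Ck_ext E F k (f g : E -> F) (D : set E) :
  open D -> (forall x, D x -> f x = g x) -> Ck k f D -> Ck k g D.
Proof.
move=> oD; elim: k f g => [|k IH] f g fg /=.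
  move=> h x Dx; have hx := h x Dx.
  rewrite /prop_for /continuous_at -(fg x Dx).
  by apply: cvg_trans hx; apply: near_eq_cvg; near=> y; apply: fg; near: y;
    exact: open_nbhs_nbhs.
have near_fg x : D x -> \forall y \near x, f y = g y.
  by move=> Dx; near=> y; apply: fg; near: y; exact: open_nbhs_nbhs.
move=> [h1 h2]; split=> [x Dx|v].
  by have [] := near_eq_diff (near_fg x Dx) (h1 x Dx).
apply: (IH (fun x => 'd f x v)) => // x Dx.
by have [_ ->] := near_eq_diff (near_fg x Dx) (h1 x Dx).
Unshelve. all: by end_near. Qed.

Lemma Ck_has_diff E F k (f : E -> F) (df : E -> E -> F) (D : set E) :
  open D -> (forall x, D x -> has_diff f x (df x)) ->
  (forall v, Ck k (df ^~ v) D) -> Ck k.+1 f D.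
Proof.
move=> oD h hk; split=> [x /h[]//|v].
by apply: Ck_ext (hk v) => // x /h[_ ->].
Qed.

Lemma Ck_S E F k (f : E -> F) (D : set E) : Ck k.+1 f D -> Ck k f D.
Proof.
elim: k f => [|k IH] f /= [h1 h2].
  by move=> x /h1; exact: differentiable_continuous.
by split => // v; exact: IH.
Qed.

Lemma Ck_diff E F k (f : E -> F) (D : set E) x :
  Ck k.+1 f D -> D x -> has_diff f x ('d f x).
Proof. by case=> + _ => /[apply]. Qed.

Lemma Ck_cst E F k (a : F) (D : set E) : open D -> Ck k (fun _ : E => a) D.
Proof.
move=> oD; elim: k a => [|k IH] a; first by move=> x _; exact: cst_continuous.
by apply: (@Ck_has_diff _ _ _ _ (fun _ _ => 0)) => // x _; exact: has_diff_cst.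
Qed.

Lemma CkD E F k (f g : E -> F) (D : set E) : open D ->
  Ck k f D -> Ck k g D -> Ck k (fun x => f x + g x) D.
Proof.
move=> oD; elim: k f g => [|k IH] f g hf hg.
  by move=> x Dx; apply: cvgD; [exact: hf|exact: hg].
apply: (@Ck_has_diff _ _ _ _ (fun x v => 'd f x v + 'd g x v)) => //.
  by move=> x Dx; apply: has_diffD; apply: Ck_diff; eassumption.
by move=> v; apply: IH; [exact: hf.2|exact: hg.2].
Qed.

Lemma Ck_sum E F k (I : Type) (r : seq I) (f : I -> E -> F) (D : set E) :
  open D -> (forall i, Ck k (f i) D) -> Ck k (fun x => \sum_(i <- r) f i x) D.
Proof.
move=> oD h; elim: r => [|i r IH].
  by apply: (@Ck_ext _ _ _ (fun=> 0)) => //[x _|]; [rewrite big_nil|exact: Ck_cst].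
by apply: Ck_ext (CkD oD (h i) IH) => // x _; rewrite big_cons.
Qed.

Lemma Ck_scale E F k (a : E -> R^o) (f : E -> F) (D : set E) : open D ->
  Ck k a D -> Ck k f D -> Ck k (fun x => a x *: f x) D.
Proof.
move=> oD; elim: k a f => [|k IH] a f ha hf.
  by move=> x Dx; apply: cvgZ; [exact: ha|exact: hf].
apply: (@Ck_has_diff _ _ _ _ (fun x v => 'd a x v *: f x + a x *: 'd f x v)) => //.
  by move=> x Dx; apply: has_diff_scale; apply: Ck_diff; eassumption.
move=> v; apply: CkD => //; apply: IH => //.
- exact: ha.2.
- exact: Ck_S.
- exact: Ck_S.
- exact: hf.2.
Qed.

Lemma CkV E k (a : E -> R^o) (D : set E) : open D ->
  (forall x, D x -> a x != 0) -> Ck k a D -> Ck k (fun x => (a x)^-1 : R^o) D.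
Proof.
move=> oD a0; elim: k => [|k IH] ha.
  by move=> x Dx; apply: cvgV; [exact: a0|exact: ha].
apply: (@Ck_has_diff _ _ _ _ (fun x v => - (a x) ^- 2 * 'd a x v)) => //.
  by move=> x Dx; apply: has_diffV; [exact: a0|apply: Ck_diff; eassumption].
move=> v; have hV := IH (Ck_S ha).
(* The factor [a^-2] is split into two factors [a^-1], to which the induction hypothesis applies. *)
have h2 : Ck k (fun x => (a x)^-1 *: ((a x)^-1 *: 'd a x v)) D.
  by do 2 apply: Ck_scale => //; exact: ha.2.
apply: Ck_ext (Ck_scale oD (@Ck_cst _ R^o _ (-1) _ oD) h2) => // x _.
by rewrite /GRing.scale /= !mulrA mulN1r expr2 invfM mulNr.
Qed.

Lemma Ck_lin_comp E F G k (L : {linear F -> G}) (f : E -> F) (D : set E) :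
  continuous L -> open D -> Ck k f D -> Ck k (fun x => L (f x)) D.
Proof.
move=> cL oD; elim: k f => [|k IH] f hf.
  by move=> x Dx; apply: continuous_comp; [exact: hf|exact: cL].
apply: (@Ck_has_diff _ _ _ _ (fun x v => L ('d f x v))) => //.
  move=> x Dx; apply: has_diff_comp; first by apply: Ck_diff; eassumption.
  exact: has_diff_lin.
by move=> v; apply: IH; exact: hf.2.
Qed.

Lemma Ck_lin E F k (L : {linear E -> F}) (D : set E) :
  continuous L -> open D -> Ck k L D.
Proof.
move=> cL oD; case: k => [|k]; first by move=> x _; exact: cL.
apply: (@Ck_has_diff _ _ _ _ (fun x v => L v)) => //.
  by move=> x Dx; exact: has_diff_lin.
by move=> v; exact: Ck_cst.
Qed.

Lemma Ck_pair E F G k (f : E -> F) (g : E -> G) (D : set E) : open D ->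
  Ck k f D -> Ck k g D -> Ck k (fun x => (f x, g x)) D.
Proof.
move=> oD; elim: k f g => [|k IH] f g hf hg.
  by move=> x Dx; apply: cvg_pair; [exact: hf|exact: hg].
apply: (@Ck_has_diff _ _ _ _ (fun x v => ('d f x v, 'd g x v))) => //.
  by move=> x Dx; apply: has_diff_pair; apply: Ck_diff; eassumption.
by move=> v; apply: IH; [exact: hf.2|exact: hg.2].
Qed.

Definition findim E := exists (I : finType) (e : I -> E) (phi : I -> {linear E -> R^o}),
  (forall i, continuous (phi i)) /\ forall v, v = \sum_i phi i v *: e i.

(** [Ck] is phrased with fixed directions, but the direction ['d f x v] of the outer derivative
    moves with [x]; expanding it along the fixed vectors given by [findim] brings the induction
    hypothesis back. *)
Lemma Ck_comp E F G k (f : E -> F) (g : F -> G) (D : set E) (D' : set F) :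
  findim F -> open D -> (forall x, D x -> D' (f x)) ->
  Ck k f D -> Ck k g D' -> Ck k (fun x => g (f x)) D.
Proof.
move=> [n [e [phi [cphi phiE]]]] oD DD'; elim: k g => [|k IH] g hf hg.
  by move=> x Dx; apply: continuous_comp; [exact: hf|exact/hg/DD'].
apply: (@Ck_has_diff _ _ _ _
    (fun x v => \sum_i phi i ('d f x v) *: 'd g (f x) (e i))) => //.
  move=> x Dx; have hfx := Ck_diff hf Dx; have hgx := Ck_diff hg (DD' _ Dx).
  apply: has_diff_eq (has_diff_comp hfx hgx) _ => v.
  by rewrite {1}(phiE ('d f x v)) linear_sum; apply: eq_bigr => i _; rewrite linearZ.
move=> v; apply: Ck_sum => // i; apply: Ck_scale => //.
  by apply: Ck_lin_comp => //; exact: hf.2.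
by apply: (IH (fun y => 'd g y (e i))); [exact: Ck_S|exact: hg.2].
Qed.

Lemma findim_matrix m n : findim 'M[R]_(m, n).
Proof.
pose pL (ij : 'I_m * 'I_n) := fun N : 'M[R]_(m, n) => N ij.1 ij.2 : R^o.
have pl ij : linear (pL ij) by move=> a u v; rewrite /pL !mxE.
pose phi ij : {linear 'M[R]_(m, n) -> R^o} :=
  HB.pack (pL ij) (GRing.isLinear.Build _ _ _ _ _ (pl ij)).
exists ('I_m * 'I_n)%type, (fun k => delta_mx k.1 k.2), phi.
split=> [k|v]; first exact: coord_continuous.
by rewrite {1}(matrix_sum_delta v) pair_big.
Qed.

Lemma findim_prod E F : findim E -> findim F -> findim (E * F)%type.
Proof.
move=> [n [e [phi [cphi phiE]]]] [m [e' [phi' [cphi' phiE']]]].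
pose p1f i := fun z : E * F => phi i z.1.
have p1l i : linear (p1f i) by move=> a u v; rewrite /p1f linearP.
pose p1 i : {linear (E * F)%type -> R^o} :=
  HB.pack (p1f i) (GRing.isLinear.Build _ _ _ _ _ (p1l i)).
pose p2f i := fun z : E * F => phi' i z.2.
have p2l i : linear (p2f i) by move=> a u v; rewrite /p2f linearP.
pose p2 i : {linear (E * F)%type -> R^o} :=
  HB.pack (p2f i) (GRing.isLinear.Build _ _ _ _ _ (p2l i)).
exists (n + m)%type,
  (fun k => match k with inl i => (e i, 0 : F) | inr j => (0 : E, e' j) end),
  (fun k => match k with inl i => p1 i | inr j => p2 j end); split.
  case=> i z /=.
  - by apply: (@continuous_comp _ _ _ fst (phi i)); [exact: cvg_fst|exact: cphi].
  - by apply: (@continuous_comp _ _ _ snd (phi' i)); [exact: cvg_snd|exact: cphi'].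
move=> [u v]; rewrite big_sumType /=.
apply/pair_equal_spec; split; rewrite /=.
  rewrite !(raddf_sum fst) /= [X in _ + X]big1 ?addr0 => [|i _]; first exact: phiE.
  by rewrite scaler0.
rewrite !(raddf_sum snd) /= [X in X + _]big1 ?add0r => [|i _]; first exact: phiE'.
by rewrite scaler0.
Qed.

End CkTheory.

(** * Openness of submersions *)

Section Submersion.
Context {R : realType}.

Lemma mx_norm_le n (x : 'rV[R]_n) (r : R) : 0 <= r ->
  (forall i, `|x 0 i| <= r) -> `|x| <= r.
Proof.
move=> r0 h; rewrite [`|x|]mx_normrE; apply/bigmax_leP; split => // -[i j] _ /=.
by rewrite ord1.
Qed.

Lemma mx_entry_le_norm n (x : 'rV[R]_n) i : `|x 0 i| <= `|x|.
Proof.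
rewrite [leRHS]mx_normrE.
exact: (le_bigmax _ (fun ij : 'I_1 * 'I_n => `|x ij.1 ij.2|) (0, i)).
Qed.

Lemma has_diff_line (E : normedModType R) (a v : E) (t : R^o) :
  has_diff (fun s : R^o => a + s *: v) t (fun s => s *: v).
Proof.
have hs : has_diff (fun s : R^o => s *: v) t (fun s => s *: v).
  apply: has_diff_eq (has_diff_scale (has_diff_id t) (has_diff_cst v t)) _ => s.
  by rewrite scaler0 addr0.
by apply: has_diff_eq (has_diffD (has_diff_cst a t) hs) _ => s; rewrite add0r.
Qed.

Lemma mean_value (f : R^o -> R^o) (df : R^o -> R) :
  (forall t, 0 <= t <= 1 -> has_diff f t (fun s => s * df t)) ->
  exists2 t, 0 <= t <= 1 & f 1 - f 0 = df t.
Proof.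
move=> h.
have hd t : t \in `]0, 1[%R -> is_derive (t : R^o) 1 f (df t).
  move=> /itvP t01; have [d e] := h t ltac:(by rewrite !t01).
  apply: DeriveDef; first exact/derivable1_diffP.
  by rewrite deriveE// e mul1r.
have cf : {within `[0, 1], continuous f}.
  apply: derivable_within_continuous => t /itvP t01; apply/derivable1_diffP.
  by have [] := h t ltac:(by rewrite !t01).
have [t /itvP t01 ->] := MVT_segment ler01 hd cf.
by exists t; [rewrite !t01|rewrite subr0 mulr1].
Qed.

(** The norm on row vectors is the supremum norm, so the scalar mean value theorem is applied to
    each coordinate along the segment; the intermediate point may depend on the coordinate. *)
Lemma mean_value_le (E : normedModType R) n (k : E -> 'rV[R]_n) (a b : E) (q : R) :
  0 <= q ->
  (forall t : R, 0 <= t <= 1 -> differentiable k (b + t *: (a - b))) ->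
  (forall (t : R) v, 0 <= t <= 1 -> `|'d k (b + t *: (a - b)) v| <= q * `|v|) ->
  `|k a - k b| <= q * `|a - b|.
Proof.
move=> q0 dk hk; apply: mx_norm_le => [|j]; first by rewrite mulr_ge0.
pose c := fun N : 'rV[R]_n => N 0 j : R^o.
have cl : linear c by move=> r u v; rewrite /c !mxE.
pose cL : {linear 'rV[R]_n -> R^o} := HB.pack c (GRing.isLinear.Build _ _ _ _ _ cl).
have [] := @mean_value (fun t => cL (k (b + t *: (a - b))))
  (fun t => cL ('d k (b + t *: (a - b)) (a - b))).
  move=> t t01.
  have h1 := has_diff_comp (@has_diff_line E b (a - b) t)
    (differentiable_has_diff (dk t t01)).
  have h2 : has_diff cL (k (b + t *: (a - b))) cL.
    by apply: has_diff_lin; exact: coord_continuous.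
  apply: has_diff_eq (has_diff_comp h1 h2) _ => s.
  by rewrite linearZ /= /c mxE.
move=> t t01; rewrite scale1r scale0r addr0 (addrC b) subrK /= /c => e.
by rewrite !mxE e (le_trans (mx_entry_le_norm _ _)) // hk.
Qed.

(** Joins the complete and the normed structures of row vectors, as the fixed point theorem
    requires. *)
HB.instance Definition _ n := Complete.copy 'rV[R]_n 'rV[R]_n.

(** With [L] a right inverse of the differential at [x0], the map [z - F (x0 + L z)] has small
    derivative near 0; for [y] near [F x0], a fixed point of that map plus [y] solves
    [F (x0 + L z) = y]. *)
Theorem submersion_open (E : normedModType R) n (F : E -> 'rV[R]_n) (D W : set E) x0 :
  open D -> D x0 -> Ck 1 F D -> (forall v, exists u, 'd F x0 u = v) ->
  nbhs x0 W -> nbhs (F x0) (F @` W).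
Proof.
move=> oD Dx0 F1 surj Wx0.
have [u ue] := @choice 'I_n E (fun i ui => 'd F x0 ui = delta_mx 0 i) (fun i => surj _).
pose Lf := fun z : 'rV[R]_n => \sum_i z 0 i *: u i.
have Ll : linear Lf.
  move=> a z z'; rewrite /Lf scaler_sumr -big_split; apply: eq_bigr => i _ /=.
  by rewrite !mxE scalerDl scalerA.
pose L : {linear 'rV[R]_n -> E} := HB.pack Lf (GRing.isLinear.Build _ _ _ _ _ Ll).
have cL : continuous L.
  move=> z; apply: (@Ck_sum _ _ _ 0 _ _ (fun i (z : 'rV[R]_n) => z 0 i *: u i) setT) => //.
    exact: openT.
  move=> i z' _; have hc := @coord_continuous R 1 n 0 i z'.
  exact: (@cvgZr_tmp _ _ _ (nbhs z') _ _ _ (u i) hc).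
have dL z : has_diff (fun z => x0 + L z) z L.
  by apply: has_diff_eq (has_diffD (has_diff_cst x0 z) (has_diff_lin z cL)) _ => v;
    rewrite add0r.
(* Each of the [n] basis directions contributes an error of at most [d], so that the total is at
   most one half; [n.+1] avoids dividing by zero when [n = 0]. *)
pose d : R := (2 * n.+1%:R)^-1.
have d0 : 0 < d by rewrite invr_gt0 mulr_gt0.
have near_x0 : \forall y \near x0, [/\ W y, D y &
    forall i, `|delta_mx 0 i - 'd F y (u i)| <= d].
  have hi : \forall y \near x0, forall i, `|delta_mx 0 i - 'd F y (u i)| <= d.
    apply: filter_forall => i.
    have := F1.2 (u i) x0 Dx0; rewrite /prop_for /continuous_at ue => /cvgrPdist_le.
    exact.
  have hD : \forall y \near x0, D y by exact: open_nbhs_nbhs.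
  by near=> y; split; near: y.
have : \forall z \near (0 : 'rV[R]_n), [/\ W (x0 + L z), D (x0 + L z) &
    forall i, `|delta_mx 0 i - 'd F (x0 + L z) (u i)| <= d].
  have : (fun z => x0 + L z) @ (0 : 'rV[R]_n) --> x0 + L 0.
    exact: differentiable_continuous (dL 0).1.
  by rewrite linear0 addr0 => h; exact: h near_x0.
move=> /nbhs_closedballP[rho h].
pose r := rho%:num.
have r0 : 0 < r by rewrite /r.
have hr z : `|z| <= r -> [/\ W (x0 + L z), D (x0 + L z) &
    forall i, `|delta_mx 0 i - 'd F (x0 + L z) (u i)| <= d].
  by move=> zr; apply: h; rewrite closed_ballE// /closed_ball_ /= sub0r normrN.
pose k := fun z : 'rV[R]_n => z + - F (x0 + L z).
have hk z : `|z| <= r -> has_diff k z (fun v => v + - 'd F (x0 + L z) (L v)).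
  move=> /hr[_ Dz _]; apply: has_diffD; first exact: has_diff_id.
  apply: has_diffN; apply: has_diff_comp; first exact: dL.
  exact: Ck_diff F1 Dz.
have k_le z v : `|z| <= r -> `|'d k z v| <= 2^-1 * `|v|.
  move=> zr; have [_ _ hz] := hr z zr; rewrite (has_diffE _ (hk z zr)).
  have -> : v + - 'd F (x0 + L z) (L v) =
      \sum_i v 0 i *: (delta_mx 0 i - 'd F (x0 + L z) (u i)).
    rewrite {1}(row_sum_delta v) /= /Lf linear_sum -sumrN -big_split /=.
    by apply: eq_bigr => i _; rewrite linearZ scalerBr.
  apply: le_trans (ler_norm_sum _ _ _) _.
  apply: (@le_trans _ _ (\sum_(i < n) `|v| * d)).
    apply: ler_sum => i _; rewrite normrZ.
    by apply: ler_pM => //; exact: mx_entry_le_norm.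
  rewrite sumr_const card_ord -[_ *+ n]mulr_natr -mulrA mulrC ler_wpM2r//.
  by rewrite /d invfM -mulrA ler_piMr// mulrC ler_pdivrMr// mul1r ler_nat.
have in_seg a b (t : R) : `|a| <= r -> `|b| <= r -> 0 <= t <= 1 ->
    `|b + t *: (a - b) : 'rV[R]_n| <= r.
  move=> ar br /andP[t0 t1].
  have -> : b + t *: (a - b) = (1 - t) *: b + t *: a.
    by rewrite scalerBr scalerBl scale1r addrCA [RHS]addrC addrA.
  apply: le_trans (ler_normD _ _) _; rewrite !normrZ ger0_norm ?subr_ge0//.
  rewrite (ger0_norm t0); apply: (@le_trans _ _ ((1 - t) * r + t * r)).
    by apply: lerD; rewrite ler_wpM2l ?subr_ge0.
  by rewrite mulrBl mul1r subrK.
have k_lip a b : `|a| <= r -> `|b| <= r -> `|k a - k b| <= 2^-1 * `|a - b|.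
  move=> ar br; apply: mean_value_le; first by rewrite invr_ge0.
  - by move=> t t01; have [] := hk _ (in_seg a b t ar br t01).
  - by move=> t v t01; exact/k_le/in_seg.
(* The half-contraction [k] moves a point of the ball at most [r / 2] away from [k 0], which leaves
   [r / 2] for [y]: the closed ball of radius [r] is preserved. *)
apply/nbhs_ballP; exists (r / 2) => /=; first by apply: divr_gt0; rewrite /r.
move=> y; rewrite -ball_normE /= => yr.
pose phi := fun z => k z + y.
have phiU : {homo phi : z / closed_ball (0 : 'rV[R]_n) r z >-> closed_ball (0 : 'rV[R]_n) r z}.
  move=> z; rewrite !(closed_ballE _ r0) /closed_ball_ /= !sub0r !normrN => zr.
  have -> : phi z = (k z - k 0) + (y - F x0).
    by rewrite /phi {3}/k linear0 addr0 add0r opprK addrACA subrr addr0.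
  apply: le_trans (ler_normD _ _) _; rewrite [leRHS]splitr; apply: lerD.
    apply: le_trans (k_lip _ _ zr _) _; first by rewrite normr0 ltW.
    by rewrite subr0 mulrC ler_wpM2r.
  by rewrite distrC ltW.
have cbE (z : 'rV[R]_n) : closed_ball (0 : 'rV[R]_n) r z -> `|z| <= r.
  by rewrite (closed_ballE _ r0) /closed_ball_ /= sub0r normrN.
have ctr : is_contraction (mkfun_fun phiU).
  exists (2^-1)%:nng; split => /=; first by rewrite invf_lt1 ?ltr1n.
  move=> [a b] /= [/cbE ar /cbE br].
  suff : `|phi a - phi b| <= 2^-1 * `|a - b| by [].
  by rewrite /phi opprD addrACA subrr addr0; exact: k_lip.
have ne : closed_ball (0 : 'rV[R]_n) r !=set0.
  by exists 0; rewrite (closed_ballE _ r0) /closed_ball_ /= subrr normr0 ltW.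
have [z Uz zE] := banach_fixed_point ctr (@closed_ball_closed _ _ _ _) ne.
have zr := cbE _ Uz; have {}zE : z = z + - F (x0 + L z) + y by exact: zE.
have -> : y = F (x0 + L z).
  apply/eqP; rewrite -subr_eq0 addrC; apply/eqP/(addrI z).
  by rewrite addr0 addrA -zE.
by exists (x0 + L z) => //; have [] := hr z zr.
Unshelve. all: by end_near. Qed.

End Submersion.

(** * Complex-valued functions of real variables *)

Section ComplexDifferentials.
Context {R : realType}.
Implicit Types E F : normedModType R.
Local Notation C := R[i].

Lemma Re_conj (x : C) : complex.Re (x^*) = complex.Re x. Proof. by case: x. Qed.
Lemma Im_conj (x : C) : complex.Im (x^*) = - complex.Im x. Proof. by case: x. Qed.
Lemma ReD (x y : C) : complex.Re (x + y) = complex.Re x + complex.Re y.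
Proof. by case: x => a b; case: y. Qed.
Lemma ImD (x y : C) : complex.Im (x + y) = complex.Im x + complex.Im y.
Proof. by case: x => a b; case: y. Qed.
Lemma ReM (x y : C) :
  complex.Re (x * y) = complex.Re x * complex.Re y - complex.Im x * complex.Im y.
Proof. by case: x => a b; case: y. Qed.
Lemma ImM (x y : C) :
  complex.Im (x * y) = complex.Re x * complex.Im y + complex.Im x * complex.Re y.
Proof. by case: x => a b; case: y. Qed.

(** Differentiability is over the reals and [df] is only real-linear, so that conjugates can be
    differentiated. *)
Definition has_diffC E (f : E -> C) x (df : E -> C) :=
  has_diff (fun y => complex.Re (f y) : R^o) x (fun v => complex.Re (df v)) /\
  has_diff (fun y => complex.Im (f y) : R^o) x (fun v => complex.Im (df v)).

Lemma has_diffCE E (f : E -> C) x df v : has_diffC f x df -> dC f x v = df v.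
Proof. by move=> [[_ h1] [_ h2]]; rewrite /dC /dR h1 h2; case: (df v). Qed.

Lemma has_diffC_dC E (f : E -> C) x :
  differentiable (fun y => complex.Re (f y) : R^o) x ->
  differentiable (fun y => complex.Im (f y) : R^o) x -> has_diffC f x (dC f x).
Proof. by move=> h1 h2; split; split. Qed.

Lemma has_diffC_eq E (f : E -> C) x df df' :
  has_diffC f x df -> (forall v, df v = df' v) -> has_diffC f x df'.
Proof.
by move=> [h1 h2] e; split; [apply: has_diff_eq h1 _|apply: has_diff_eq h2 _] => v;
  rewrite e.
Qed.

Lemma near_has_diffC E (f g : E -> C) x df :
  (\forall y \near x, f y = g y) -> has_diffC f x df -> has_diffC g x df.
Proof.
move=> fg [h1 h2]; split; [apply: near_has_diff h1|apply: near_has_diff h2];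
  by apply: filterS fg => y ->.
Qed.

Lemma has_diffC_cst E (a : C) (x : E) : has_diffC (fun=> a) x (fun=> 0).
Proof. by split; exact: has_diff_cst. Qed.

Lemma has_diffCD E (f g : E -> C) x df dg :
  has_diffC f x df -> has_diffC g x dg ->
  has_diffC (fun y => f y + g y) x (fun v => df v + dg v).
Proof.
move=> [f1 f2] [g1 g2]; split.
- under eq_fun do rewrite raddfD.
  by apply: has_diff_eq (has_diffD f1 g1) _ => v; rewrite raddfD.
- under eq_fun do rewrite raddfD.
  by apply: has_diff_eq (has_diffD f2 g2) _ => v; rewrite raddfD.
Qed.

Lemma has_diffCN E (f : E -> C) x df :
  has_diffC f x df -> has_diffC (fun y => - f y) x (fun v => - df v).
Proof.
move=> [f1 f2]; split.
- under eq_fun do rewrite raddfN.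
  by apply: has_diff_eq (has_diffN f1) _ => v; rewrite raddfN.
- under eq_fun do rewrite raddfN.
  by apply: has_diff_eq (has_diffN f2) _ => v; rewrite raddfN.
Qed.

Lemma has_diffC_sum E (I : Type) (r : seq I) (f : I -> E -> C) x df :
  (forall i, has_diffC (f i) x (df i)) ->
  has_diffC (fun y => \sum_(i <- r) f i y) x (fun v => \sum_(i <- r) df i v).
Proof.
move=> h; elim: r => [|i r IH].
  under eq_fun do rewrite big_nil.
  by apply: has_diffC_eq (has_diffC_cst _ _) _ => v; rewrite big_nil.
under eq_fun do rewrite big_cons.
by apply: has_diffC_eq (has_diffCD (h i) IH) _ => v; rewrite big_cons.
Qed.

Lemma has_diffCM E (f g : E -> C) x df dg :
  has_diffC f x df -> has_diffC g x dg ->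
  has_diffC (fun y => f y * g y) x (fun v => f x * dg v + df v * g x).
Proof.
move=> [f1 f2] [g1 g2]; split.
- under eq_fun do rewrite ReM.
  apply: has_diff_eq (has_diffD (has_diffM f1 g1) (has_diffN (has_diffM f2 g2))) _ => v.
  by rewrite ReD !ReM; ring.
- under eq_fun do rewrite ImM.
  apply: has_diff_eq (has_diffD (has_diffM f1 g2) (has_diffM f2 g1)) _ => v.
  by rewrite ImD !ImM; ring.
Qed.

Lemma has_diffC_conj E (f : E -> C) x df :
  has_diffC f x df -> has_diffC (fun y => (f y)^*) x (fun v => (df v)^*).
Proof.
move=> [f1 f2]; split.
- under eq_fun do rewrite Re_conj.
  by apply: has_diff_eq f1 _ => v; rewrite Re_conj.
- under eq_fun do rewrite Im_conj.
  by apply: has_diff_eq (has_diffN f2) _ => v; rewrite Im_conj.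
Qed.

Lemma has_diffC_comp E F (f : E -> F) (g : F -> C) x df dg :
  has_diff f x df -> has_diffC g (f x) dg ->
  has_diffC (fun y => g (f y)) x (fun v => dg (df v)).
Proof.
by move=> hf [g1 g2]; split; [exact: has_diff_comp hf g1|exact: has_diff_comp hf g2].
Qed.

Definition CkC E k (f : E -> C) D :=
  Ck k (fun x => complex.Re (f x) : R^o) D /\ Ck k (fun x => complex.Im (f x) : R^o) D.

Lemma CkC_has_diff E k (f : E -> C) D x : CkC k.+1 f D -> D x -> has_diffC f x (dC f x).
Proof. by move=> [h1 h2] Dx; apply: has_diffC_dC; [apply h1.1|apply h2.1]. Qed.

Lemma CkC_ext E k (f g : E -> C) D : open D -> (forall x, D x -> f x = g x) ->
  CkC k f D -> CkC k g D.
Proof.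
move=> oD fg [h1 h2].
by split; [apply: Ck_ext h1|apply: Ck_ext h2] => // x Dx; rewrite fg.
Qed.

Lemma CkC_cst E k (a : C) (D : set E) : open D -> CkC k (fun=> a) D.
Proof. by move=> oD; split; exact: Ck_cst. Qed.

Lemma CkCD E k (f g : E -> C) D : open D -> CkC k f D -> CkC k g D ->
  CkC k (fun x => f x + g x) D.
Proof.
move=> oD [f1 f2] [g1 g2]; split; under eq_fun do rewrite raddfD; exact: CkD.
Qed.

Lemma CkC_sum E k (I : Type) (r : seq I) (f : I -> E -> C) D : open D ->
  (forall i, CkC k (f i) D) -> CkC k (fun x => \sum_(i <- r) f i x) D.
Proof.
move=> oD h; elim: r => [|i r IH].
  by under eq_fun do rewrite big_nil; exact: CkC_cst.
by under eq_fun do rewrite big_cons; exact: CkCD.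
Qed.

Lemma CkM E k (f g : E -> R^o) D : open D -> Ck k f D -> Ck k g D ->
  Ck k (fun x => f x * g x : R^o) D.
Proof. by move=> oD hf hg; exact: (Ck_scale oD hf hg). Qed.

Lemma CkN E F k (f : E -> F) D : open D -> Ck k f D -> Ck k (fun x => - f x) D.
Proof.
move=> oD hf; have h := Ck_scale oD (@Ck_cst _ _ R^o k (-1) _ oD) hf.
by apply: Ck_ext h => // x _; rewrite scaleN1r.
Qed.

Lemma CkCM E k (f g : E -> C) D : open D -> CkC k f D -> CkC k g D ->
  CkC k (fun x => f x * g x) D.
Proof.
move=> oD [f1 f2] [g1 g2]; split.
- by under eq_fun do rewrite ReM; apply: CkD => //; [|apply: CkN => //]; exact: CkM.
- by under eq_fun do rewrite ImM; apply: CkD => //; exact: CkM.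
Qed.

Lemma CkC_comp E F k (f : E -> F) (g : F -> C) (D : set E) (D' : set F) :
  findim F -> open D -> (forall x, D x -> D' (f x)) ->
  Ck k f D -> CkC k g D' -> CkC k (fun x => g (f x)) D.
Proof. by move=> fF oD DD hf [g1 g2]; split; [apply: Ck_comp g1|apply: Ck_comp g2]. Qed.

Lemma has_diffC_real (E : normedModType R) (f : E -> R^o) x df :
  has_diff f x df -> has_diffC (fun y => (f y)%:C%C) x (fun v => (df v)%:C%C).
Proof. by move=> h; split => //=; exact: has_diff_cst. Qed.

Lemma CkC_real (E : normedModType R) n (f : E -> R^o) (D : set E) : open D ->
  Ck n f D -> CkC n (fun y => (f y)%:C%C) D.
Proof. by move=> oD h; split => //=; exact: Ck_cst. Qed.

Lemma findim_linear_continuous (E F : normedModType R) (f : {linear E -> F}) :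
  findim E -> continuous f.
Proof.
move=> [I [e [phi [cphi phiE]]]] x.
have -> : f = (fun v => \sum_i phi i v *: f (e i)) :> (E -> F).
  by apply/funext => v; rewrite {1}(phiE v) linear_sum; apply: eq_bigr => i _; rewrite linearZ.
apply: (@Ck_sum _ _ _ 0 _ _ (fun i v => phi i v *: f (e i)) setT) => //.
  exact: openT.
by move=> i; apply: Ck_scale; [exact: openT|move=> z _; exact: cphi|exact/Ck_cst/openT].
Qed.

Lemma has_diff_linear (E F : normedModType R) (f : E -> F) x :
  findim E -> linear f -> has_diff f x f.
Proof.
move=> fE fl; pose L : {linear E -> F} := HB.pack f (GRing.isLinear.Build _ _ _ _ _ fl).
exact: (has_diff_lin x (@findim_linear_continuous _ _ L fE)).
Qed.

Lemma has_diffC_linear (E : normedModType R) (f : E -> C) x : findim E ->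
  (forall (r : R) u v, f (r *: u + v) = r%:C%C * f u + f v) -> has_diffC f x f.
Proof.
move=> fE fl; split; apply: has_diff_linear => // r u v;
  by rewrite fl; case: (f u) => a b; case: (f v) => a' b' /=; rewrite mul0r ?subr0 ?addr0.
Qed.

End ComplexDifferentials.

(** * Algebra of 2 x 2 complex matrices and Hermitian forms *)

Section Algebra.
Context {R : realType}.
Local Notation C := R[i].

Lemma sum2 (V : nmodType) (F : 'I_2 -> V) : \sum_(i < 2) F i = F 0 + F 1.
Proof. by rewrite big_ord_recl big_ord1; congr (F _ + F _); exact: val_inj. Qed.

Lemma forall2 (P : 'I_2 -> Prop) : P 0 -> P 1 -> forall i, P i.
Proof.
move=> P0 P1 i; have [-> //|-> //] : i = 0 \/ i = 1.
by case: i => [[|[|//]] h]; [left|right]; exact: val_inj.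
Qed.

Lemma det2 (A : 'M[C]_2) : \det A = A 0 0 * A 1 1 - A 0 1 * A 1 0.
Proof.
rewrite (expand_det_row _ 0) sum2 /cofactor !det_mx11 !mxE /=.
have e1 : lift 0 0 = 1 :> 'I_2 by exact: val_inj.
have e2 : lift 1 0 = 0 :> 'I_2 by exact: val_inj.
by rewrite e1 e2 /bump /=; ring.
Qed.

Fact adj2_key : unit. Proof. by []. Qed.
(** By Cayley-Hamilton the adjugate in size two is the trace minus the matrix, hence linear in [A]
    and equal to its own differential. The lock keeps it from being unfolded. *)
Definition adj2 (A : 'M[C]_2) : 'M[C]_2 := locked_with adj2_key ((\tr A)%:M - A).

Lemma adj2E (A : 'M[C]_2) :
  (adj2 A 0 0 = A 1 1) * (adj2 A 0 1 = - A 0 1) *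
  (adj2 A 1 0 = - A 1 0) * (adj2 A 1 1 = A 0 0).
Proof. by rewrite /adj2 unlock /mxtrace !mxE !sum2 /=; do !split; ring. Qed.

Lemma mx2P (A B : 'M[C]_2) : A 0 0 = B 0 0 -> A 0 1 = B 0 1 ->
  A 1 0 = B 1 0 -> A 1 1 = B 1 1 -> A = B.
Proof. by move=> ? ? ? ?; apply/matrixP; apply: forall2; apply: forall2. Qed.

Lemma mul_adj2_mx (A : 'M[C]_2) : adj2 A *m A = (\det A)%:M.
Proof.
by apply: mx2P; rewrite det2 !mxE sum2 !adj2E /= ?mulr1n ?mulr0n; ring.
Qed.

Lemma det_adj2 (A : 'M[C]_2) : \det (adj2 A) = \det A.
Proof. by rewrite !det2 !adj2E; ring. Qed.

Lemma adj2M (A B : 'M[C]_2) : adj2 (A *m B) = adj2 B *m adj2 A.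
Proof. by apply: mx2P; rewrite !mxE sum2 !adj2E !mxE !sum2; ring. Qed.

Definition conjmx {m n} (A : 'M[C]_(m, n)) := map_mx Num.conj A.

(* [A^-1] acting on Hermitian forms, rescaled by [|det A|^2] so that the entries
   are polynomials in [A] and its conjugate. *)
Definition congr2 (A h : 'M[C]_2) : 'M[C]_2 :=
  (adj2 A)^T *m h *m conjmx (adj2 A).

Lemma det_conjmx n (A : 'M[C]_n) : \det (conjmx A) = (\det A)^*.
Proof. by rewrite det_map_mx. Qed.

Lemma det_congr2 (A h : 'M[C]_2) : \det (congr2 A h) = `|\det A| ^+ 2 * \det h.
Proof.
by rewrite /congr2 !det_mulmx det_conjmx det_tr !det_adj2 normCK; ring.
Qed.

Definition herm2 (h : 'M[C]_2) := forall i j, h i j = (h j i)^*.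

Lemma herm2_congr2 (A h : 'M[C]_2) : herm2 h -> herm2 (congr2 A h).
Proof.
move=> hh i j; rewrite !mxE rmorph_sum /= !sum2 !mxE !sum2 !mxE.
rewrite (hh 1 0) !(rmorphM, rmorphD) /= !conjCK -(hh 0 0) -(hh 1 1); ring.
Qed.

Lemma eps_col (k : 'I_2) (z : 'I_2 -> C) :
  \sum_(s < 2) eps s k * z s = if k == 0 then - z 1 else z 0.
Proof. by move: k; apply: forall2; rewrite sum2 !mxE /=; ring. Qed.

(* The part of type (1,0) of the derivative of [congr2 A h] along a lift of a
   tangent vector [z] of the base. *)
Lemma horizontal_algebra (A h : 'M[C]_2) (b r : 'I_2 -> C) : \det A != 0 ->
  exists kappa : 'I_2 -> C, forall (P T : 'M[C]_2) (z t0 : 'I_2 -> C) (t00 : C),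
  (forall i j, \sum_(s < 2) A i s * T s j = z i * b j + \sum_(s < 2) P i s * A s j) ->
  (forall i, \sum_(s < 2) A i s * t0 s = (\det A)^-1 * z i) ->
  (\det A)^-1 * t00 + \sum_(s < 2) b s * t0 s = 0 ->
  forall k l,
    ((adj2 A)^T *m (\matrix_(i, j) (t00 * h i j + (\sum_(s < 2) T s i * h s j)
        + (\sum_(s < 2) eps s i * t0 s) * r j)) *m conjmx (adj2 A)) k l =
    \sum_(s < 2) P s k * congr2 A h s l + (\sum_(s < 2) eps s k * z s) * kappa l.
Proof.
move=> d0.
pose d := \det A; pose B := adj2 A.
have BA i j : \sum_(s < 2) B i s * A s j = d *+ (i == j).
  by have := congr1 (fun X : 'M[C]_2 => X i j) (mul_adj2_mx A); rewrite !mxE.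
have solve (x y : 'I_2 -> C) : (forall i, \sum_(s < 2) A i s * x s = y i) ->
    forall i, x i = d^-1 * \sum_(s < 2) B i s * y s.
  move=> e i; apply: (mulfI d0); rewrite mulrA divff// mul1r.
  under eq_bigr do rewrite -e mulr_sumr.
  rewrite exchange_big /=; under eq_bigr do under eq_bigr do rewrite mulrA.
  under eq_bigr do rewrite -mulr_suml BA.
  by move: i; apply: forall2; rewrite sum2 /= ?mulr1n ?mulr0n mul0r ?addr0 ?add0r.
pose m k l := congr2 A h k l.
pose be k := d^-1 * \sum_(s < 2) b s * B s k.
pose G := h *m conjmx B.
(* Here [be] is the row [b A^-1]. The [b]-terms of [t00 h + T^T h] give the sum over [s] of
   [z s (be k m s l - be s m k l)], antisymmetric in [s] and [k], hence a multiple of [eps s k]. The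
   term in [r] uses [B^T eps B = (det B) eps] and [t0 = d^-2 B z]. *)
exists (fun l => d^-1 * (\sum_(s < 2) r s * conjmx B s l) +
  (be 1 * m 0 l - be 0 * m 1 l)) => P T z t0 t00 hT ht0 ht00 k l.
have Te i j := solve (fun s => T s j) _ (fun i => hT i j) i.
have t0e := solve _ _ ht0.
have t00e : t00 = - d * \sum_(s < 2) b s * t0 s.
  have := congr1 (fun x => \det A * x) ht00.
  rewrite mulr0 mulrDr mulrA divff// mul1r => e.
  by apply/eqP; rewrite /d mulNr -addr_eq0 e.
have mE k' : m k' l = \sum_(s < 2) B s k' * G s l.
  by rewrite /m /congr2 -mulmxA mxE; apply: eq_bigr => s _; rewrite mxE.
have cE k' : congr2 A h k' l = \sum_(s < 2) B s k' * G s l := mE k'.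
rewrite [X in _ = X + _](eq_bigr _ (fun s _ => congr1 ( *%R (P s k)) (cE s))).
rewrite !mE -mulmxA mxE.
set Q := (X in X *m conjmx _).
have QE s : (Q *m conjmx B) s l = t00 * G s l + \sum_(s' < 2) T s' s * G s' l +
    (\sum_(s' < 2) eps s' s * t0 s') * \sum_(s' < 2) r s' * conjmx B s' l.
  rewrite /G /Q !(mxE, sum2); ring.
rewrite (eq_bigr _ (fun s _ => congr1 ( *%R (B^T k s)) (QE s))).
under eq_bigr do rewrite mxE.
set rr := \sum_(s' < 2) r s' * conjmx B s' l.
rewrite t00e !eps_col !sum2 !Te !t0e !sum2 /be !sum2.
have dE : d = B 0 0 * B 1 1 - B 0 1 * B 1 0 by rewrite -det2 det_adj2.
have AE : (A 0 0 = B 1 1) * (A 0 1 = - B 0 1) * (A 1 0 = - B 1 0) * (A 1 1 = B 0 0).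
  by rewrite /B !adj2E !opprK.
rewrite !AE.
have D0 : B 0 0 * B 1 1 - B 0 1 * B 1 0 != 0 by rewrite -dE.
rewrite -/d dE; move: D0.
move: k; apply: forall2 => /=;
move: (G 0 l) (G 1 l) rr (B 0 0) (B 0 1) (B 1 0) (B 1 1) => g0 g1 q B00 B01 B10 B11;
move: (z 0) (z 1) (b 0) (b 1) (P 0 0) (P 0 1) (P 1 0) (P 1 1);
move=> z0 z1 b0 b1 P00 P01 P10 P11 D0.
all: rewrite !mxE /=.
all: field; exact: D0.
Qed.

(* The part of type (1,0) of the derivative along the fibre, where [T] is
   [A^-1 dA] and the trace of the Maurer-Cartan form vanishes. *)
Lemma vertical_algebra (A dA T h : 'M[C]_2) :
  A *m T = dA ->
  (adj2 dA)^T *m h *m conjmx (adj2 A) +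
  (adj2 A)^T *m (- \tr T *: h + T^T *m h) *m conjmx (adj2 A) = 0.
Proof.
move=> <-; rewrite adj2M trmx_mul -!mulmxA -mulmxDr [X in X + _]mulmxA -mulmxDl.
(* Up to transposition, the variation of the adjugate contributes [adj2 T] and that of [h]
   contributes [T - tr T]; the two cancel because [adj2 T + T = tr T]. *)
suff -> : (adj2 T)^T *m h + (- \tr T *: h + T^T *m h) = 0.
  by rewrite mul0mx mulmx0.
rewrite addrCA -mulmxDl -linearD /=.
have -> : adj2 T + T = (\tr T)%:M by rewrite /adj2 unlock subrK.
by rewrite tr_scalar_mx mul_scalar_mx scaleNr addNr.
Qed.

(* With [D] the determinant of [m]: if [Y] is the (1,0) part of [dm], then the
   (1,0) part of [d (m / D^2)] is given by the connection with symbols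
   [P s k - (X z / D) delta s k - z s * (X_k / D)], [X] being the (1,0) part of [dD]. *)
Lemma metric_algebra (m P : 'M[C]_2) (z kappa : 'I_2 -> C) (D := \det m) :
  D != 0 -> \tr P = 0 ->
  let Y k l := \sum_(s < 2) P s k * m s l + (\sum_(s < 2) eps s k * z s) * kappa l in
  let X (w : 'I_2 -> C) :=
    w 0 * (kappa 1 * m 0 0 - kappa 0 * m 0 1) -
    w 1 * (kappa 0 * m 1 1 - kappa 1 * m 1 0) in
  (Y 0 0 * m 1 1 + m 0 0 * Y 1 1 - (Y 0 1 * m 1 0 + m 0 1 * Y 1 0) = X z) *
  (forall k l, Y k l / D ^+ 2 - 2 * m k l * X z / D ^+ 3 =
    \sum_(s < 2) m s l / D ^+ 2 *
      (P s k - (X z / D * (s == k)%:R + z s * (X (fun j => (j == k)%:R) / D)))).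
Proof.
move=> D0 trP Y X.
have P11 : P 1 1 = - P 0 0.
  by apply/eqP; rewrite -addr_eq0 addrC -trP /mxtrace sum2.
(* [P] enters the derivative of the determinant only through its trace. *)
split; first by rewrite /X /Y !eps_col !sum2 /= P11; ring.
move: D0; rewrite /D /X /Y det2 => D0.
(* With [X_k] the value of [X] on the [k]-th basis vector, the identity amounts to [m k l X_s - m s
   l X_k = eps s k D kappa l], which is Cramer's rule for [kappa]. *)
by apply: forall2; apply: forall2; rewrite !eps_col !sum2 /= ?P11; field; exact: D0.
Qed.

(* The product rule for [congr2], where [h] has derivative [X + X^*]. *)
Lemma congr2_deriv (B dB h X : 'M[C]_2) k l : herm2 h ->
  let Z := dB^T *m h *m conjmx B + B^T *m X *m conjmx B in
  \sum_(j < 2) ((\sum_(i < 2) B i k * h i j) * (dB j l)^* +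
    (\sum_(i < 2) (B i k * (X i j + (X j i)^*) + dB i k * h i j)) * (B j l)^*) =
  Z k l + (Z l k)^*.
Proof.
move=> hh; rewrite /= !(mxE, sum2) !(rmorphD, rmorphM) /= !conjCK -!hh; ring.
Qed.

Lemma congr2E (A h : 'M[C]_2) k l : congr2 A h k l =
    \sum_(j < 2) (\sum_(i < 2) adj2 A i k * h i j) * (adj2 A j l)^*.
Proof.
rewrite !mxE; apply: eq_bigr => j _; rewrite !mxE; congr (_ * _).
by apply: eq_bigr => i _; rewrite mxE.
Qed.

(** Meant for the centre of SL(3, C): lifts of one element of PSL(3, C) differ by a cube root of
    unity [a], and the Hermitian form sees only the product of [a] with its conjugate. *)
Lemma congr2_scale (A h : 'M[C]_2) (a : C) : `|a| = 1 -> congr2 (a *: A) h = congr2 A h.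
Proof.
move=> a1; have aa : a * a^* = 1 by rewrite -normCK a1 expr1n.
have aE : adj2 (a *: A) = a *: adj2 A.
  by apply: mx2P; rewrite !mxE !adj2E !mxE ?mulrN.
rewrite /congr2 aE linearZ /= -!scalemxAl.
have -> : conjmx (a *: adj2 A) = a^* *: conjmx (adj2 A).
  by apply/matrixP => i j; rewrite !mxE rmorphM.
by rewrite -scalemxAr scalerA aa scale1r.
Qed.

(** Here [t] is [(det A)^-1 A^-1 z]. The numerator is [|det A|^-4] times the one built from
    [congr2 A h], and by [det_congr2] the squared determinants are in the same ratio: the exponent
    two is what makes the weights cancel. *)
Lemma pullback_algebra (A h : 'M[C]_2) (z t : 'I_2 -> C) :
  \det A != 0 -> herm2 h -> \det h != 0 ->
  (forall i, \sum_(k < 2) A i k * t k = (\det A)^-1 * z i) ->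
  (\sum_(i < 2) \sum_(j < 2) h i j * (t i * (t j)^*)) / \det h ^+ 2 =
  \sum_(k < 2) \sum_(l < 2)
    congr2 A h k l / \det (congr2 A h) ^+ 2 * (z k * (z l)^*).
Proof.
move=> d0 hh dh0 ht.
have zE i : z i = \det A * \sum_(k < 2) A i k * t k by rewrite ht mulrA divff ?mul1r.
have dc0 : (\det A)^* != 0 by rewrite conjC_eq0.
rewrite det_congr2 normCK.
rewrite !sum2 !congr2E !sum2 !adj2E !zE !sum2 !(rmorphM, rmorphD, rmorphN) /=.
have dE := det2 A; have dcE := congr1 Num.conj dE.
rewrite !(rmorphB, rmorphM) /= in dcE.
move: d0 dc0 dh0 dE dcE; move: (\det A) (\det h) => d dh.
move: (d^*) => d' d0 d'0 dh0 dE dcE.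
subst d d'; field.
by rewrite d'0 d0 dh0.
Qed.

End Algebra.

Lemma scale_shear (R : pzRingType) (E : lmodType R) (s u v : E) (p q x y z : R) :
  x *: (s + p *: u + q *: v) + y *: u + z *: v =
  x *: s + (y + x * p) *: u + (z + x * q) *: v.
Proof.
rewrite !scalerDr !scalerDl !scalerA -!addrA; congr (_ + _).
rewrite [RHS]addrCA; congr (_ + _).
by rewrite addrCA; congr (_ + _); rewrite addrC.
Qed.

(* With [S] the difference of two torsion-free metric connections, [g (S u v) w] is
   symmetric in [u, v] and antisymmetric in [v, w]. *)
Lemma metric_connection_unique (R : realDomainType) (E : Type) (F : zmodType)
    (g : F -> F -> R) (D : E -> F) (N' d2 N : E -> E -> F) :
  (forall a b c, g (a + b) c = g a c + g b c) -> (forall a b, g a b = g b a) ->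
  (forall u v, N' u v = N' v u) -> (forall u v, d2 u v = d2 v u) ->
  (forall u v, N u v = N v u) ->
  (forall u v w, g (N' u v) (D w) + g (D v) (N' u w) +
     (g (d2 u v) (D w) + g (D v) (d2 u w)) = g (N u v) (D w) + g (D v) (N u w)) ->
  forall u v w, g (N' u v + d2 u v - N u v) (D w) = 0.
Proof.
move=> gD gsym N'sym d2sym Nsym law.
pose S u v := N' u v + d2 u v - N u v.
have Ssym u v : S u v = S v u by rewrite /S N'sym d2sym Nsym.
have SE u v c : g (S u v) c + g (N u v) c = g (N' u v) c + g (d2 u v) c.
  by rewrite -!gD subrK.
have anti u v w : g (S u v) (D w) = - g (S u w) (D v).
  have := law u v w; have := SE u v (D w); have := SE u w (D v).
  rewrite !(gsym (D v)); lra.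
move=> u v w; rewrite -/(S u v).
have e : g (S u v) (D w) = - g (S u v) (D w).
  by rewrite [LHS]anti (Ssym u w) anti opprK (Ssym w v) anti (Ssym v u).
lra.
Qed.

(** * The complex structure of the coordinate plane *)

Section ComplexPlane.
Context {R : realType}.
Local Notation C := R[i].
Local Notation C2 := (@C2 R).

Lemma dz_linear k (r : R) (u v : C2) : dz k (r *: u + v) = r%:C%C * dz k u + dz k v.
Proof.
rewrite /dz /= !mxE; apply/eqP; rewrite eq_complex /=.
by rewrite !mul0r !subr0 !addr0 !eqxx.
Qed.

Lemma dzD k (u v : C2) : dz k (u + v) = dz k u + dz k v.
Proof. by rewrite -[u]scale1r dz_linear scale1r mul1r. Qed.

Lemma dz0 k : dz k (0 : C2) = 0.
Proof. by rewrite /dz /= !mxE. Qed.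

Lemma dzZ k (r : R) (u : C2) : dz k (r *: u) = r%:C%C * dz k u.
Proof. by rewrite -[r *: u]addr0 dz_linear dz0 addr0. Qed.

Lemma dz_sum k I (r : seq I) (F : I -> C2) :
  dz k (\sum_(i <- r) F i) = \sum_(i <- r) dz k (F i).
Proof.
by elim: r => [|i r IH]; rewrite ?big_nil ?dz0// !big_cons dzD IH.
Qed.

Lemma dz_J0 k (u : C2) : dz k (J0 u) = 'i * dz k u.
Proof.
rewrite /dz /J0 /= mxE; apply/eqP; rewrite eq_complex /=.
by rewrite !mul0r !mul1r sub0r add0r !eqxx.
Qed.

Lemma dz_inj (u v : C2) : (forall k, dz k u = dz k v) -> u = v.
Proof.
move=> h; rewrite [u]surjective_pairing [v]surjective_pairing; congr pair;
  by apply/rowP => k; have [] := h k.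
Qed.

Definition cscale (a : C) (v : C2) : C2 := complex.Re a *: v + complex.Im a *: J0 v.

Lemma complexri (a : C) : (complex.Re a)%:C%C + 'i * (complex.Im a)%:C%C = a.
Proof. by rewrite [RHS]complexE. Qed.

Lemma dz_cscale k a (v : C2) : dz k (cscale a v) = a * dz k v.
Proof.
rewrite /cscale dz_linear dzZ dz_J0 -[in RHS](complexri a); ring.
Qed.

Lemma ey_J0 k : @ey R k = J0 (ex k).
Proof. by rewrite /ey /J0 /ex /= oppr0. Qed.

Lemma dz_ex k l : dz k (@ex R l) = (k == l)%:R.
Proof. by rewrite /dz /ex /= !mxE /=; case: (k == l). Qed.

Lemma C2_expand (v : C2) : v = \sum_(k < 2) cscale (dz k v) (ex k).
Proof.
apply: dz_inj => k; rewrite dz_sum; under eq_bigr do rewrite dz_cscale dz_ex.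
by rewrite (bigD1 k)//= eqxx mulr1 big1 ?addr0// => i /negPf ik; rewrite eq_sym ik mulr0.
Qed.

Definition dzRe k (v : C2) : R^o := complex.Re (dz k v).
Definition dzIm k (v : C2) : R^o := complex.Im (dz k v).
Lemma dzRe_linear k : linear (dzRe k).
Proof. by move=> r u v; rewrite /dzRe /dz /= !mxE. Qed.
Lemma dzIm_linear k : linear (dzIm k).
Proof. by move=> r u v; rewrite /dzIm /dz /= !mxE. Qed.
HB.instance Definition _ k := GRing.isLinear.Build _ _ _ _ _ (dzRe_linear k).
HB.instance Definition _ k := GRing.isLinear.Build _ _ _ _ _ (dzIm_linear k).

Lemma dzRe_continuous k : continuous (dzRe k).
Proof.
move=> u; apply: (@continuous_comp _ _ _ fst (fun w : 'rV[R]_2 => w 0 k : R^o)).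
  exact: cvg_fst.
exact: coord_continuous.
Qed.
Lemma dzIm_continuous k : continuous (dzIm k).
Proof.
move=> u; apply: (@continuous_comp _ _ _ snd (fun w : 'rV[R]_2 => w 0 k : R^o)).
  exact: cvg_snd.
exact: coord_continuous.
Qed.

Lemma has_diffC_dz (E : normedModType R) (f : E -> C2) x df k :
  has_diff f x df -> has_diffC (fun y => dz k (f y)) x (fun v => dz k (df v)).
Proof.
move=> hf; split.
  exact: (has_diff_comp hf (has_diff_lin (f x) (@dzRe_continuous k))).
exact: (has_diff_comp hf (has_diff_lin (f x) (@dzIm_continuous k))).
Qed.

Lemma CkC_dz (E : normedModType R) n (f : E -> C2) D k : open D ->
  Ck n f D -> CkC n (fun y => dz k (f y)) D.
Proof.
move=> oD hf; split.
  exact: (Ck_lin_comp (@dzRe_continuous k) oD hf).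
exact: (Ck_lin_comp (@dzIm_continuous k) oD hf).
Qed.

Lemma findim_C2 : findim C2.
Proof. by apply: findim_prod; exact: findim_matrix. Qed.

Section ComplexBilinear.
Variable b : C2 -> C2 -> C2.
Hypothesis blin : forall (r : R) u u' v, b (r *: u + u') v = r *: b u v + b u' v /\
  b v (r *: u + u') = r *: b v u + b v u'.
Hypothesis bsym : forall u v, b u v = b v u.
Hypothesis bJ : forall u v, b u (J0 v) = J0 (b u v).

Lemma bilin_cscaler a u v : b u (cscale a v) = cscale a (b u v).
Proof.
rewrite /cscale (blin _ _ _ u).2.
have -> : b u (complex.Im a *: J0 v) = complex.Im a *: b u (J0 v).
  have b0 : b u 0 = 0.
    have := (blin 1 0 0 u).2; rewrite scaler0 addr0 scale1r => /esym/eqP.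
    by rewrite -[X in _ == X]addr0 (inj_eq (addrI _)) => /eqP.
  by have := (blin (complex.Im a) (J0 v) 0 u).2; rewrite !addr0 b0 addr0.
by rewrite bJ.
Qed.

Lemma bilin_suml I (r : seq I) (F : I -> C2) u :
  b u (\sum_(i <- r) F i) = \sum_(i <- r) b u (F i).
Proof.
have b0 : b u 0 = 0.
  have := (blin 1 0 0 u).2; rewrite scaler0 addr0 scale1r => /esym/eqP.
  by rewrite -[X in _ == X]addr0 (inj_eq (addrI _)) => /eqP.
elim: r => [|i r IH]; first by rewrite !big_nil.
by rewrite !big_cons -[F i]scale1r (blin 1 _ _ u).2 IH !scale1r.
Qed.

(** Symmetry transfers the J-linearity [bJ] from the second argument to the first, so [b] is complex
    bilinear and determined by its values on the vectors [ex]. *)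
Lemma complex_bilinearE i u v :
  dz i (b u v) = \sum_(j < 2) \sum_(k < 2) dz i (b (ex j) (ex k)) * dz j u * dz k v.
Proof.
rewrite {1}(C2_expand v) bilin_suml dz_sum.
under eq_bigr do rewrite bilin_cscaler dz_cscale bsym {1}(C2_expand u) bilin_suml dz_sum.
under eq_bigr do rewrite mulr_sumr.
rewrite exchange_big; apply: eq_bigr => j _; apply: eq_bigr => k _.
by rewrite bilin_cscaler dz_cscale bsym; ring.
Qed.
End ComplexBilinear.

(** The coefficients of a linear relation undergo an invertible triangular substitution, so a
    nonzero relation stays nonzero. *)
Lemma wedge3_shear (s u v : C2) (p q : R) :
  wedge3_eq0 (s + p *: u + q *: v) u v <-> wedge3_eq0 s u v.
Proof.
split=> -[x [y [z [h e]]]].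
  exists x, (y + x * p), (z + x * q); split; last by rewrite -scale_shear.
  by move=> [x0 y0 z0]; apply: h; move: y0 z0; rewrite x0 !mul0r !addr0 => -> ->.
exists x, (y - x * p), (z - x * q); split; last by rewrite scale_shear !subrK.
by move=> [x0 y0 z0]; apply: h; move: y0 z0; rewrite x0 !mul0r !subr0 => -> ->.
Qed.

End ComplexPlane.

(** * From a Hermitian matrix of functions on charts to a Kaehler metric *)

Section BaseGeometry.
Context {R : realType}.
Local Notation C := R[i].
Local Notation C2 := (@C2 R).
Variables (M : complex_surface R) (nabla : connection M) (V : set M).
Variable H : chart M C2 -> M -> 'M[C]_2.

(** The real part loses nothing where [H] is Hermitian ([HdetE]) and makes the denominator of the
    metric a real function. *)
Definition Hdet c x : R := complex.Re (\det (H c x)).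

Definition Hnorm c x k l : C := H c x k l * ((Hdet c x ^+ 2)^-1)%:C%C.

Definition Hmetric : bilinear_field M := fun c x u v =>
  complex.Re (\sum_(k < 2) \sum_(l < 2) Hnorm c x k l * (dz k u * (dz l v)^*)).

Definition trGamma c x k : C := \sum_(l < 2) Gamma nabla c x l l k.

(* [psi] is the (1,0) part of [d log det H]. *)
Definition Hpsi c x u : C :=
  ((dR (fun y => Hdet c (cinv c y)) (cmap c x) u)%:C%C
   - 'i * (dR (fun y => Hdet c (cinv c y)) (cmap c x) (J0 u))%:C%C)
  / (2 * Hdet c x)%:C%C.

Definition Homega c x u : C :=
  - (Hpsi c x u + 3^-1 * \sum_(k < 2) trGamma c x k * dz k u).

Definition Hnabla : connection M := fun c x u v =>
  nabla c x u v + (cscale (Homega c x u) v + cscale (Homega c x v) u).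

Definition Pimx c x u : 'M[C]_2 :=
  \matrix_(s, k) \sum_(m < 2) Pi nabla c x s k m * dz m u.

Hypothesis hnabla : complex_linear_connection setT nabla.
Hypothesis H_herm : forall c x, atlas M c -> (cdom c `&` V) x -> herm2 (H c x).
Hypothesis H_det : forall c x, atlas M c -> (cdom c `&` V) x -> \det (H c x) != 0.
(** The sets [N] also provide the openness of [V] as seen in charts. *)
Hypothesis H_smooth : forall c x, atlas M c -> (cdom c `&` V) x ->
  exists N : set C2, [/\ open N, N (cmap c x), N `<=` cmap c @` (cdom c `&` V) &
    forall n k l, CkC n (fun y => H c (cinv c y) k l) N].
Hypothesis H_diff : forall c x, atlas M c -> (cdom c `&` V) x ->
  exists kappa : 'I_2 -> C, forall u,
  let Y k l := \sum_(s < 2) Pimx c x u s k * H c x s l +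
               (\sum_(s < 2) eps s k * dz s u) * kappa l in
  forall k l, dC (fun y => H c (cinv c y) k l) (cmap c x) u = Y k l + (Y l k)^*.

Lemma chartK c x : atlas M c -> cdom c x -> cinv c (cmap c x) = x.
Proof. by move=> /atlas_chart[_ _ _]; exact. Qed.

Lemma chart_imK c (D : set M) y : atlas M c -> (cmap c @` (cdom c `&` D)) y ->
  [/\ cdom c (cinv c y), D (cinv c y) & cmap c (cinv c y) = y].
Proof. by move=> cM [x [cx Dx] <-]; rewrite chartK. Qed.

Lemma HdetE c x : atlas M c -> (cdom c `&` V) x -> \det (H c x) = (Hdet c x)%:C%C.
Proof.
move=> cM xV; rewrite /Hdet RRe_real// CrealE det2 rmorphB !rmorphM /=.
have h := H_herm cM xV.
by rewrite -!h mulrC [X in _ - X]mulrC; apply/eqP; ring.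
Qed.

Lemma Hdet_neq0 c x : atlas M c -> (cdom c `&` V) x -> Hdet c x != 0.
Proof.
move=> cM xV; apply: contraNneq (H_det cM xV) => e.
by rewrite HdetE// e.
Qed.

Lemma nabla_lin c x : atlas M c -> cdom c x -> forall (r : R) u u' v,
  nabla c x (r *: u + u') v = r *: nabla c x u v + nabla c x u' v /\
  nabla c x v (r *: u + u') = r *: nabla c x v u + nabla c x v u'.
Proof. by move=> cM cx r u u' v; have [[h _ _] _ _] := hnabla; exact: h. Qed.

Lemma nabla_sym c x : atlas M c -> cdom c x -> forall u v,
  nabla c x u v = nabla c x v u.
Proof. by move=> cM cx; have [_ h _] := hnabla; exact: h. Qed.

Lemma nabla_J c x : atlas M c -> cdom c x -> forall u v,
  nabla c x u (J0 v) = J0 (nabla c x u v).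
Proof. by move=> cM cx; have [_ _ h] := hnabla; exact: h. Qed.

(** The absence of torsion and the parallelism of J make [nabla] complex bilinear, so the four terms
    of the definition coincide. *)
Lemma GammaE c x i j k : atlas M c -> cdom c x ->
  Gamma nabla c x i j k = dz i (nabla c x (ex j) (ex k)).
Proof.
move=> cM cx; rewrite /Gamma !ey_J0 !(nabla_J cM cx) [nabla c x (J0 _) _](nabla_sym cM cx).
rewrite !(nabla_J cM cx) !dz_J0.
rewrite [nabla c x (ex k) (ex j)](nabla_sym cM cx).
set w := dz i _; rewrite !mulrA -expr2 sqrCi; field; by [].
Qed.

Lemma Gamma_sym c x i j k : atlas M c -> cdom c x ->
  Gamma nabla c x i j k = Gamma nabla c x i k j.
Proof. by move=> cM cx; rewrite !GammaE// (nabla_sym cM cx). Qed.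

Lemma dz_nabla c x i u v : atlas M c -> cdom c x ->
  dz i (nabla c x u v) = \sum_(j < 2) \sum_(k < 2) Gamma nabla c x i j k * dz j u * dz k v.
Proof.
move=> cM cx.
rewrite (complex_bilinearE (nabla_lin cM cx) (nabla_sym cM cx) (nabla_J cM cx)).
by apply: eq_bigr => j _; apply: eq_bigr => k _; rewrite GammaE.
Qed.

(** The factor one third is [1 / (n + 1)] for [n = 2]: the two correction terms contribute one and
    two copies of the trace of [Gamma]. *)
Lemma tr_Pimx c x u : \tr (Pimx c x u) = 0.
Proof.
rewrite /mxtrace sum2 !mxE !sum2 /Pi !sum2 /=.
by field.
Qed.

Lemma H_has_diff c x : atlas M c -> (cdom c `&` V) x -> forall k l,
  has_diffC (fun y => H c (cinv c y) k l) (cmap c x)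
            (dC (fun y => H c (cinv c y) k l) (cmap c x)).
Proof.
move=> cM xV k l; have [N [oN Nx NV NC]] := H_smooth cM xV.
exact: CkC_has_diff (NC 1%N k l) Nx.
Qed.

(** One matrix [G u] is both the connection form of [Hnabla] and the coefficient in the derivative
    of [Hnorm], which says that the metric is parallel. As [G u] acts on the complex components of
    [v], linearity and J-linearity of [Hnabla] are read off from it too. *)
Lemma Hnorm_diff c x : atlas M c -> (cdom c `&` V) x ->
  exists G : C2 -> 'M[C]_2,
  (forall s u v, dz s (Hnabla c x u v) = \sum_(k < 2) G u s k * dz k v) /\
  forall k l, has_diffC (fun y => Hnorm c (cinv c y) k l) (cmap c x) (fun u =>
    \sum_(s < 2) Hnorm c x s l * G u s k + (\sum_(s < 2) Hnorm c x s k * G u s l)^*).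
Proof.
move=> cM xV; have cx := xV.1.
have [kappa hk] := H_diff cM xV.
pose m := H c x.
have hm := H_herm cM xV.
pose D := Hdet c x.
have D0 : D != 0 := Hdet_neq0 cM xV.
have detD : \det m = D%:C%C := HdetE cM xV.
have DC0 : D%:C%C != 0 :> C by rewrite -detD; exact: H_det.
pose X (w : 'I_2 -> C) :=
    w 0 * (kappa 1 * m 0 0 - kappa 0 * m 0 1) -
    w 1 * (kappa 0 * m 1 1 - kappa 1 * m 1 0).
pose z (u : C2) k := dz k u.
pose Y u k l := \sum_(s < 2) Pimx c x u s k * m s l +
               (\sum_(s < 2) eps s k * z u s) * kappa l.
have det0 : \det m != 0 := H_det cM xV.
have alg u := metric_algebra (z u) kappa det0 (tr_Pimx c x u).
have HD k l : has_diffC (fun y => H c (cinv c y) k l) (cmap c x)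
    (fun u => Y u k l + (Y u l k)^*).
  by apply: has_diffC_eq (H_has_diff cM xV k l) _ => u; rewrite hk.
have mE k l : H c (cinv c (cmap c x)) k l = m k l by rewrite chartK.
(* [metric_algebra] identifies the (1,0) part of the derivative of the determinant as [X]; the full
   derivative is [X] plus its conjugate. *)
have dD : has_diff (fun y => Hdet c (cinv c y) : R^o) (cmap c x)
    (fun u => 2 * complex.Re (X (z u))).
  have := has_diffCD (has_diffCM (HD 0 0) (HD 1 1))
                    (has_diffCN (has_diffCM (HD 0 1) (HD 1 0))).
  move=> [+ _]; rewrite /Hdet; under eq_fun do rewrite -det2.
  move=> h; apply: has_diff_eq h _ => u; rewrite !mE.
  have -> : 2 * complex.Re (X (z u)) = complex.Re (X (z u) + (X (z u))^*).
    by case: (X (z u)) => a b /=; rewrite mulr_natl mulr2n.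
  congr complex.Re; rewrite -[X (z u)](alg u).1 -/m -/(Y u 0 0).
  rewrite -/(Y u 1 1) -/(Y u 0 1) -/(Y u 1 0) !(rmorphB, rmorphD, rmorphM) /= -!hm; ring.
(* [X] is complex-linear in [u], so it is recovered from its real parts at [u] and at [J0 u]. *)
have psiE u : Hpsi c x u = X (z u) / D%:C%C.
  rewrite /Hpsi /dR !(has_diffE _ dD).
  have -> : X (z (J0 u)) = 'i * X (z u) by rewrite /X /z !dz_J0; ring.
  have -> : complex.Re ('i * X (z u)) = - complex.Im (X (z u)).
    by rewrite ReM /= mul0r mul1r sub0r.
  rewrite -[in RHS](complexri (X (z u))) -/D !rmorphM rmorphN /=.
  have -> : (2 : R)%:C%C = 2 :> C by rewrite rmorph_nat.
  by field.
(* These are the symbols of [metric_algebra]. The trace terms subtracted in [Pi] and the terms in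
   [X / D] are together those of [Homega]. *)
pose G u : 'M[C]_2 := \matrix_(s, k) (Pimx c x u s k -
  (X (z u) / D%:C%C * (s == k)%:R + z u s * (X (fun j => (j == k)%:R) / D%:C%C))).
exists G; split => [s u v|k l].
  rewrite /Hnabla dzD dz_nabla// dzD !dz_cscale /Homega !psiE.
  move: s; apply: forall2; rewrite !sum2 !mxE /Pi /trGamma /X !sum2 /= -/(z u 0) -/(z u 1);
  rewrite -/(z v 0) -/(z v 1) !(Gamma_sym _ 1 0 cM cx); field; exact: DC0.
have dD2 : has_diff (fun y => (Hdet c (cinv c y) ^+ 2)^-1 : R^o) (cmap c x)
    (fun u => - 4 * complex.Re (X (z u)) / D ^+ 3).
  have DE : Hdet c (cinv c (cmap c x)) = D by rewrite chartK.
  have := has_diffV _ (has_diffM dD dD); rewrite DE.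
  move=> /(_ (mulf_neq0 D0 D0)) h; apply: has_diff_eq h _ => u.
  by field.
apply: has_diffC_eq (has_diffCM (HD k l) (has_diffC_real dD2)) _ => u.
have PE k' l' : \sum_(s < 2) Hnorm c x s l' * G u s k' =
    Y u k' l' / D%:C%C ^+ 2 - 2 * m k' l' * X (z u) / D%:C%C ^+ 3.
  have := (alg u).2 k' l'; rewrite detD => ->.
  apply: eq_bigr => s _; rewrite /Hnorm !mxE -/m -/D; congr (_ * _).
  by rewrite rmorphV ?unitfE ?expf_neq0// rmorphXn.
rewrite !PE mE chartK// -/D.
have conjD : (D%:C%C : C)^* = D%:C%C by exact: conjc_real.
have -> : (- 4 * complex.Re (X (z u)) / D ^+ 3)%:C%C =
   - 2 * (X (z u) + (X (z u))^*) / D%:C%C ^+ 3 :> C.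
  have ReE : (complex.Re (X (z u)))%:C%C = (X (z u) + (X (z u))^*) / 2 := ReJ_add _.
  rewrite !(rmorphM, rmorphN, fmorphV, rmorphXn) /= ReE rmorph_nat.
  by field.
rewrite fmorphV rmorphXn /= (hm l k).
move: (Y u k l) (Y u l k) (X (z u)) (m k l) => y1 y2 x1 m1.
rewrite !(rmorphB, rmorphM, fmorphV, rmorphXn) /= conjD conjCK rmorph_nat.
by field; exact: DC0.
Qed.

Lemma Hmetric_linear c x (r : R) (u u' v : C2) :
  Hmetric c x (r *: u + u') v = r * Hmetric c x u v + Hmetric c x u' v.
Proof.
rewrite /Hmetric; have ReZ a : r * complex.Re a = complex.Re (r%:C%C * a).
  by case: a => a b /=; rewrite mul0r subr0.
rewrite ReZ -raddfD mulr_sumr -big_split /=; congr complex.Re.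
apply: eq_bigr => k _; rewrite mulr_sumr -big_split /=; apply: eq_bigr => l _.
by rewrite dz_linear; ring.
Qed.

Lemma Hnorm_herm c x k l : atlas M c -> (cdom c `&` V) x ->
  Hnorm c x k l = (Hnorm c x l k)^*.
Proof.
move=> cM xV; rewrite /Hnorm rmorphM /= -(H_herm cM xV) ; congr (_ * _).
exact/esym/conjc_real.
Qed.

Lemma Hmetric_sym c x u v : atlas M c -> (cdom c `&` V) x ->
  Hmetric c x u v = Hmetric c x v u.
Proof.
move=> cM xV; rewrite /Hmetric -[LHS]Re_conj; congr complex.Re.
rewrite rmorph_sum exchange_big /=; apply: eq_bigr => k _.
rewrite rmorph_sum; apply: eq_bigr => l _ /=.
rewrite (Hnorm_herm l k cM xV); move: (Hnorm c x k l) => n.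
by rewrite !rmorphM /= !conjCK; ring.
Qed.

Lemma Hmetric_J c x u v : Hmetric c x (J0 u) (J0 v) = Hmetric c x u v.
Proof.
rewrite /Hmetric; congr complex.Re; apply: eq_bigr => k _; apply: eq_bigr => l _.
rewrite !dz_J0 rmorphM /= conjCi; congr (_ * _).
by rewrite mulrACA mulrN -expr2 sqrCi opprK mul1r.
Qed.

Lemma Hmetric_nondeg c x u : atlas M c -> (cdom c `&` V) x ->
  (forall v, Hmetric c x u v = 0) -> u = 0.
Proof.
move=> cM xV h.
pose w l := \sum_(k < 2) Hnorm c x k l * dz k u.
have w0 l : w l = 0.
  apply/eqP; rewrite -normr_eq0 -sqrf_eq0 normCK; apply/eqP.
  (* Testing against [w l] times the [l]-th basis vector yields [|w l|^2]. *)
  have := h (cscale (w l) (ex l)); rewrite /Hmetric exchange_big /= => e.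
  suff -> : w l * (w l)^* = (complex.Re (w l * (w l)^*))%:C%C.
    have -> // : complex.Re (w l * (w l)^*) = 0.
    rewrite -[RHS]e; congr complex.Re.
    rewrite (bigD1 l)//= [X in _ + X]big1 => [|m /negPf ml].
      rewrite addr0 mulr_suml; apply: eq_bigr => k _.
      by rewrite dz_cscale dz_ex eqxx mulr1 mulrA.
    by apply: big1 => k _; rewrite dz_cscale dz_ex ml mulr0 rmorph0 !mulr0.
  by rewrite RRe_real// -normCK realX ?normr_real.
have d0 := H_det cM xV.
have D0 : ((Hdet c x ^+ 2)^-1)%:C%C != 0 :> C.
  by rewrite -(rmorph0 (real_complex R)) (inj_eq (@complexI _)) invr_eq0 sqrf_eq0
    (Hdet_neq0 cM xV).
have e l : \sum_(k < 2) H c x k l * dz k u = 0.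
  have wE : w l = (\sum_(k < 2) H c x k l * dz k u) * ((Hdet c x ^+ 2)^-1)%:C%C.
    by rewrite mulr_suml; apply: eq_bigr => k _; rewrite /Hnorm mulrAC.
  by move: (w0 l); rewrite wE => /eqP; rewrite mulf_eq0 (negPf D0) orbF => /eqP.
have := e 0; have := e 1; rewrite !sum2 => e1 e0.
apply: dz_inj => k; rewrite dz0; apply: (mulfI d0); rewrite mulr0 det2.
move: k; apply: forall2.
  by transitivity (H c x 1 1 * (H c x 0 0 * dz 0 u + H c x 1 0 * dz 1 u) -
    H c x 1 0 * (H c x 0 1 * dz 0 u + H c x 1 1 * dz 1 u));
    [ring|rewrite e0 e1; ring].
by transitivity (- H c x 0 1 * (H c x 0 0 * dz 0 u + H c x 1 0 * dz 1 u) +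
    H c x 0 0 * (H c x 0 1 * dz 0 u + H c x 1 1 * dz 1 u));
    [ring|rewrite e0 e1; ring].
Qed.

Lemma H_nbhs c x : atlas M c -> (cdom c `&` V) x ->
  exists N : set C2, [/\ open N, N (cmap c x), N `<=` cmap c @` (cdom c `&` V) &
    forall n, Ck n (fun y => Hdet c (cinv c y) : R^o) N /\
      forall k l, CkC n (fun y => Hnorm c (cinv c y) k l) N].
Proof.
move=> cM xV; have [N [oN Nx NV NC]] := H_smooth cM xV; exists N; split => // n.
have hD : Ck n (fun y => Hdet c (cinv c y) : R^o) N.
  have [+ _] := CkCD oN (CkCM oN (NC n 0 0) (NC n 1 1))
    (CkCM oN (@CkC_cst _ _ n (-1) N oN) (CkCM oN (NC n 0 1) (NC n 1 0))).
  by apply: Ck_ext => // y _; rewrite /Hdet det2; congr complex.Re; ring.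
split => // k l; apply: CkCM => //; apply: CkC_real => //.
apply: CkV => //; last by have := CkM oN hD hD.
move=> y Ny; have [cy Vy yE] := chart_imK cM (NV _ Ny).
by rewrite sqrf_eq0 Hdet_neq0.
Qed.

Lemma Hmetric_smooth c u v : atlas M c ->
  smooth_on (fun y => Hmetric c (cinv c y) u v : R^o) (cmap c @` (cdom c `&` V)).
Proof.
move=> cM n; apply: Ck_local => _ [x xV <-].
have [N [oN Nx NV NC]] := H_nbhs cM xV; exists N => //.
suff [] : CkC n (fun y => \sum_(k < 2) \sum_(l < 2)
  Hnorm c (cinv c y) k l * (dz k u * (dz l v)^*)) N by [].
apply: CkC_sum => // k; apply: CkC_sum => // l; apply: CkCM => //.
  exact: (NC n).2.
exact: CkC_cst.
Qed.

Lemma Hnabla_dz c x : atlas M c -> (cdom c `&` V) x ->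
  exists G : C2 -> 'M[C]_2,
  forall s u v, dz s (Hnabla c x u v) = \sum_(k < 2) G u s k * dz k v.
Proof. by move=> cM xV; have [G [h _]] := Hnorm_diff cM xV; exists G. Qed.

Lemma Hnabla_sym c x : atlas M c -> (cdom c `&` V) x -> forall u v,
  Hnabla c x u v = Hnabla c x v u.
Proof.
by move=> cM [cx _] u v; rewrite /Hnabla (nabla_sym cM cx) [X in _ + X]addrC.
Qed.

Lemma Hnabla_linr c x : atlas M c -> (cdom c `&` V) x -> forall (r : R) u u' v,
  Hnabla c x v (r *: u + u') = r *: Hnabla c x v u + Hnabla c x v u'.
Proof.
move=> cM xV r u u' v; have [G h] := Hnabla_dz cM xV; apply: dz_inj => s.
rewrite dz_linear !h mulr_sumr -big_split; apply: eq_bigr => k _ /=.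
by rewrite dz_linear; ring.
Qed.

Lemma Hnabla_J c x : atlas M c -> (cdom c `&` V) x -> forall u v,
  Hnabla c x u (J0 v) = J0 (Hnabla c x u v).
Proof.
move=> cM xV u v; have [G h] := Hnabla_dz cM xV; apply: dz_inj => s.
rewrite dz_J0 !h mulr_sumr; apply: eq_bigr => k _ /=.
by rewrite dz_J0; ring.
Qed.

Lemma Hmetric_compat c x u v w : atlas M c -> (cdom c `&` V) x ->
  dR (fun y => Hmetric c (cinv c y) v w) (cmap c x) u =
  Hmetric c x (Hnabla c x u v) w + Hmetric c x v (Hnabla c x u w).
Proof.
move=> cM xV; have [G [hG hN]] := Hnorm_diff cM xV.
have h := has_diffC_sum (index_enum 'I_2) (fun k => has_diffC_sum (index_enum 'I_2)
  (fun l => has_diffCM (hN k l) (has_diffC_cst (dz k v * (dz l w)^*) (cmap c x)))).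
have [hR _] := h; rewrite /dR (has_diffE _ hR) /Hmetric -raddfD; congr complex.Re.
rewrite !sum2 !hG !sum2 /= (chartK cM xV.1).
have hn k l := Hnorm_herm k l cM xV.
move: (Hnorm c x) hn => n hn.
by rewrite !(rmorphD, rmorphM) /= -!hn; ring.
Qed.

Lemma Homega_Ck c x u : atlas M c -> (cdom c `&` V) x ->
  exists N : set C2, [/\ open N, N (cmap c x), N `<=` cmap c @` (cdom c `&` V) &
    forall n, CkC n (fun y => Homega c (cinv c y) u) N].
Proof.
move=> cM xV; have [N [oN Nx NV NC]] := H_nbhs cM xV; exists N; split => // n.
have yE y : N y -> [/\ cdom c (cinv c y), V (cinv c y) & cmap c (cinv c y) = y].
  by move=> /NV; exact: chart_imK.
have hnab a b : Ck n (fun y => nabla c (cinv c y) a b) N.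
  have [[_ h _] _ _] := hnabla; apply: Ck_sub (h c a b cM n) => y /NV[z [cz _] <-].
  by exists z.
have hGam i j k : CkC n (fun y => Gamma nabla c (cinv c y) i j k) N.
  apply: (@CkC_ext _ _ _ (fun y => dz i (nabla c (cinv c y) (ex j) (ex k)))) => //.
    by move=> y /yE[cy _ _]; rewrite GammaE.
  exact: CkC_dz.
have hD v : CkC n (fun y => (dR (fun y => Hdet c (cinv c y)) y v)%:C%C) N.
  by apply: CkC_real => //; exact: (NC n.+1).1.2.
have hDi : CkC n (fun y => ((2 * Hdet c (cinv c y))^-1)%:C%C) N.
  apply: CkC_real => //; apply: CkV => //.
    by move=> y /yE[cy Vy _]; rewrite mulf_neq0 ?Hdet_neq0.
  by apply: CkM => //; [exact: Ck_cst|exact: (NC n).1].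
have cst a : CkC n (fun=> a) N by exact: CkC_cst.
pose f y := -1 * (((dR (fun y => Hdet c (cinv c y)) y u)%:C%C
   + - 'i * (dR (fun y => Hdet c (cinv c y)) y (J0 u))%:C%C)
   * ((2 * Hdet c (cinv c y))^-1)%:C%C
  + 3^-1 * \sum_(k < 2) trGamma c (cinv c y) k * dz k u).
apply: (@CkC_ext _ _ _ f) => //.
  move=> y /yE[_ _ e]; rewrite /f /Homega /Hpsi e mulN1r; congr (- (_ + _)).
  by rewrite mulNr fmorphV.
apply: CkCM => //; apply: CkCD => //; apply: CkCM => //.
  by apply: CkCD => //; exact: CkCM.
apply: CkC_sum => // k; apply: CkCM => //.
exact: CkC_sum.
Qed.

Lemma Hnabla_smooth c u v : atlas M c ->
  smooth_on (fun y => Hnabla c (cinv c y) u v) (cmap c @` (cdom c `&` V)).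
Proof.
move=> cM n; apply: Ck_local => _ [x xV <-].
have [N [oN Nx NV NC]] := Homega_Ck u cM xV.
have [N' [oN' Nx' NV' NC']] := Homega_Ck v cM xV.
have oNN := openI oN oN'.
exists (N `&` N') => //.
have hnab : Ck n (fun y => nabla c (cinv c y) u v) (N `&` N').
  have [[_ h _] _ _] := hnabla; apply: Ck_sub (h c u v cM n) => y [/NV[z [cz _] <-] _].
  by exists z.
have hs a w : CkC n a (N `&` N') -> Ck n (fun y => cscale (a y) w) (N `&` N').
  by move=> [h1 h2]; apply: CkD => //; apply: Ck_scale => //; exact: Ck_cst.
have sub1 f : CkC n f N -> CkC n f (N `&` N').
  by move=> [h1 h2]; split; [apply: Ck_sub h1|apply: Ck_sub h2] => y [].
have sub2 f : CkC n f N' -> CkC n f (N `&` N').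
  by move=> [h1 h2]; split; [apply: Ck_sub h1|apply: Ck_sub h2] => y [].
apply: CkD => //; apply: CkD => //; apply: hs; [exact: sub1|exact: sub2].
Qed.

(** The fundamental form is parallel for [Hnabla], as the metric and J are; the connection being
    torsion-free, the alternating sum of derivatives cancels in pairs. *)
Lemma Hmetric_closed : closed_fundamental_form V Hmetric.
Proof.
move=> c x cM xV u v w /=.
have gJ a b : Hmetric c x (J0 a) b = - Hmetric c x a (J0 b).
  rewrite /Hmetric -raddfN -sumrN /=; congr complex.Re.
  apply: eq_bigr => k _; rewrite -sumrN; apply: eq_bigr => l _.
  by rewrite !dz_J0 [('i * dz l b)^*]rmorphM /= conjCi; ring.
rewrite !Hmetric_compat// !(Hnabla_J cM xV).
rewrite (Hnabla_sym cM xV v u) (Hnabla_sym cM xV w u) (Hnabla_sym cM xV w v).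
rewrite (gJ (Hnabla c x u w) v) (Hmetric_sym _ (J0 v) cM xV); ring.
Qed.

(** On a velocity [u] the two accelerations differ by [2 Homega(u) u], a real combination of [u] and
    [J0 u], which the wedge product does not see. *)
Lemma Hnabla_equiv : complex_projectively_equivalent V nabla Hnabla.
Proof.
move=> a b gamma _.
have cs c x (s u : C2) : s + Hnabla c x u u =
    (s + nabla c x u u) + (2 * complex.Re (Homega c x u)) *: u +
    (2 * complex.Im (Homega c x u)) *: J0 u.
  apply: dz_inj => k; rewrite /Hnabla !dzD !dzZ dz_J0.
  by rewrite !rmorphM rmorph_nat /=; ring.
split=> h t c tab cM ct /=; have := h t c tab cM ct => /=.
  by rewrite cs => h'; apply: (wedge3_shear _ _ _ _ _).2.
by rewrite cs => /(wedge3_shear _ _ _ _ _).1.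
Qed.

Lemma overlapE c c' : atlas M c ->
  overlap c c' = crange c `&` cinv c @^-1` cdom c'.
Proof.
move=> cM; apply/seteqP; split=> y.
  by move=> [x [cx cx'] <-]; split; [exists x|rewrite /= chartK].
by move=> [[x cx <-]] /=; rewrite chartK// => cx'; exists x.
Qed.

Lemma overlap_open c c' : atlas M c -> atlas M c' -> open (overlap c c').
Proof.
move=> cM cM'; rewrite overlapE//; have [[_ oc] _ ci _] := atlas_chart cM.
by apply: open_on_preimage => //; have [[]] := atlas_chart cM'.
Qed.

Lemma transition_smooth c c' n : atlas M c -> atlas M c' ->
  Ck n (transition c c') (overlap c c').
Proof. by move=> cM cM'; have [+ _] := atlas_compat cM cM'; exact. Qed.

Lemma transition_surj c c' x : atlas M c -> atlas M c' ->
  cdom c x -> cdom c' x -> forall v, exists u, 'd (transition c c') (cmap c x) u = v.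
Proof.
move=> cM cM' cx cx' v; exists ('d (transition c' c) (cmap c' x) v).
have O : overlap c c' (cmap c x) by exists x.
have O' : overlap c' c (cmap c' x) by exists x.
have h := Ck_diff (transition_smooth 1 cM cM') O.
have h' := Ck_diff (transition_smooth 1 cM' cM) O'.
have tE : transition c' c (cmap c' x) = cmap c x by rewrite /transition chartK.
rewrite -tE in h; have hc := has_diff_comp h' h.
have hid : has_diff (fun y => transition c c' (transition c' c y)) (cmap c' x) id.
  apply: near_has_diff (has_diff_id (cmap c' x)).
  have : nbhs (cmap c' x) (overlap c' c).
    by apply: open_nbhs_nbhs; split => //; exact: overlap_open.
  apply: filterS => y [z [cz' cz] <-].
  by rewrite /transition !chartK.
by rewrite -tE -(has_diffE v hc) (has_diffE v hid).
Qed.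

Lemma Hmetric_additive c x u u' v :
  Hmetric c x (u + u') v = Hmetric c x u v + Hmetric c x u' v.
Proof. by have := Hmetric_linear c x 1 u u' v; rewrite scale1r mul1r. Qed.

Lemma Hmetric_quadratic c x u : atlas M c -> (cdom c `&` V) x ->
  (Hmetric c x u u)%:C%C = \sum_(k < 2) \sum_(l < 2)
    H c x k l / \det (H c x) ^+ 2 * (dz k u * (dz l u)^*).
Proof.
move=> cM xV; rewrite (HdetE cM xV) /Hmetric.
have NE k l : Hnorm c x k l = H c x k l / (Hdet c x)%:C%C ^+ 2.
  by rewrite /Hnorm fmorphV rmorphXn.
transitivity (\sum_(k < 2) \sum_(l < 2) Hnorm c x k l * (dz k u * (dz l u)^*)).
  apply: RRe_real; rewrite CrealE; apply/eqP.
  rewrite rmorph_sum exchange_big /=; apply: eq_bigr => k _.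
  rewrite rmorph_sum; apply: eq_bigr => l _ /=.
  rewrite (Hnorm_herm l k cM xV); move: (Hnorm c x k l) => n.
  by rewrite !rmorphM /= !conjCK; ring.
by apply: eq_bigr => k _; apply: eq_bigr => l _; rewrite NE.
Qed.

Lemma Hmetric_polarization c x u v : atlas M c -> (cdom c `&` V) x ->
  Hmetric c x u v =
  (Hmetric c x (u + v) (u + v) - Hmetric c x u u - Hmetric c x v v) / 2.
Proof.
move=> cM xV; rewrite Hmetric_additive !(Hmetric_sym _ (u + v) cM xV).
rewrite !(Hmetric_additive c x u v) (Hmetric_sym v u cM xV).
by field.
Qed.

(** Invariance is asked of the metric and not of [H], which also picks up a power of the Jacobian
    between charts. *)
Hypothesis H_inv : forall c c' x, atlas M c -> atlas M c' ->
  (cdom c `&` cdom c' `&` V) x -> forall u v,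
  Hmetric c' x ('d (transition c c') (cmap c x) u) ('d (transition c c') (cmap c x) v) =
  Hmetric c x u v.

Lemma Hnabla_transition c c' x : atlas M c -> atlas M c' ->
  (cdom c `&` cdom c' `&` V) x -> forall u v,
  let t := transition c c' in let y := cmap c x in
  Hnabla c' x ('d t y u) ('d t y v) =
  'd t y (Hnabla c x u v) - 'd (fun y' => 'd t y' v) y u.
Proof.
move=> cM cM' [[cx cx'] Vx] u0 v0 t y.
have xV : (cdom c `&` V) x by [].
have xV' : (cdom c' `&` V) x by [].
have Oy : overlap c c' y by exists x.
have ht := Ck_diff (transition_smooth 1 cM cM') Oy : has_diff t y ('d t y).
have ht2 v : has_diff (fun y' => 'd t y' v) y ('d (fun y' => 'd t y' v) y).
  have h2 : Ck 1 (fun y' => 'd t y' v) (overlap c c') := (transition_smooth 2 cM cM').2 v.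
  exact: (Ck_diff h2 Oy).
pose d2 u v := 'd (fun y' => 'd t y' v) y u.
have tE : t y = cmap c' x by rewrite /t /y /transition chartK.
pose g' := Hmetric c' x.
(* Parallelism of the metric in [c], rewritten in [c'] by differentiating [g'(dt v, dt w)] along
   [u]; the terms in [d2] come from the variation of the two arguments. *)
have law u v w :
    g' (Hnabla c' x ('d t y u) ('d t y v)) ('d t y w) +
    g' ('d t y v) (Hnabla c' x ('d t y u) ('d t y w)) +
    (g' (d2 u v) ('d t y w) + g' ('d t y v) (d2 u w)) =
    g' ('d t y (Hnabla c x u v)) ('d t y w) + g' ('d t y v) ('d t y (Hnabla c x u w)).
  have [G' [_ hN]] := Hnorm_diff cM' xV'.
  have hN' k l := hN k l; rewrite -tE in hN'.
  have hf := has_diffC_sum (index_enum 'I_2) (fun k => has_diffC_sum (index_enum 'I_2)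
    (fun l => has_diffCM (has_diffC_comp ht (hN' k l))
       (has_diffCM (has_diffC_dz k (ht2 v)) (has_diffC_conj (has_diffC_dz l (ht2 w)))))).
  have hg := has_diffC_sum (index_enum 'I_2) (fun k => has_diffC_sum (index_enum 'I_2)
    (fun l => has_diffCM (hN k l)
       (has_diffC_cst (dz k ('d t y v) * (dz l ('d t y w))^*) (cmap c' x)))).
  have eg := has_diffE ('d t y u) hg.1.
  have := Hmetric_compat ('d t y u) ('d t y v) ('d t y w) cM' xV'; rewrite /dR eg => eg'.
  have hfm : has_diff (fun y' => Hmetric c (cinv c y') v w : R^o) y
      ('d (fun y' => Hmetric c (cinv c y') v w : R^o) y).
    have [N [oN Ny NV NC]] := H_nbhs cM xV.
    have [h _] := Hmetric_smooth v w cM 1.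
    by apply: differentiable_has_diff; apply: h; exists x.
  have hfm' : has_diff (fun y' => Hmetric c (cinv c y') v w : R^o) y
      ('d (fun y' => Hmetric c' (cinv c' (t y')) ('d t y' v) ('d t y' w) : R^o) y).
    apply: near_has_diff; last first.
      by apply: differentiable_has_diff; have [[]] := hf.
    have [N [oN Ny NV NC]] := H_nbhs cM xV.
    have : nbhs y (overlap c c' `&` N).
      by apply: filterI; apply: open_nbhs_nbhs; split => //; exact: overlap_open.
    apply: filterS => _ [[z [cz cz'] <-] /NV /(chart_imK cM)[_ + _]].
    rewrite chartK// => Vz; rewrite /t {1}/transition !chartK//.
    by apply: H_inv.
  have := etrans (has_diffE u hfm') (has_diffE u hf.1).
  have -> : 'd (fun y' : C2 => Hmetric c (cinv c y') v w : R^o) y u =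
    Hmetric c x (Hnabla c x u v) w + Hmetric c x v (Hnabla c x u w).
    exact: Hmetric_compat.
  rewrite -!(H_inv cM cM' (conj (conj cx cx') Vx)) -/t -/y -/g' => ->.
  rewrite -eg' /g' /Hmetric -!raddfD -!big_split /=; congr complex.Re.
  apply: eq_bigr => k _; rewrite -!big_split /=; apply: eq_bigr => l _.
  by rewrite tE chartK// mulr0 add0r /d2; ring.
(* Symmetry of the second derivative is read off the transformation law of [nabla], whose other two
   terms are symmetric because the torsion vanishes. *)
have d2sym u v : d2 u v = d2 v u.
  have [[_ _ h] _ _] := hnabla.
  have hxx : (cdom c `&` cdom c' `&` setT) x by [].
  have e1 := h c c' x cM cM' hxx u v; have e2 := h c c' x cM cM' hxx v u.
  rewrite /= (nabla_sym cM' cx') (nabla_sym cM cx) e2 in e1.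
  by move/addrI/oppr_inj: e1 => /esym.
(* The difference is orthogonal to every vector ['d t y w']; these exhaust the tangent space, and
   the metric is nondegenerate. *)
have S0 : Hnabla c' x ('d t y u0) ('d t y v0) + d2 u0 v0 - 'd t y (Hnabla c x u0 v0) = 0.
  apply: (Hmetric_nondeg cM' xV') => w.
  have [w' <-] := transition_surj cM cM' cx cx' w.
  apply: (metric_connection_unique (N' := fun u v => Hnabla c' x ('d t y u) ('d t y v))
    (N := fun u v => 'd t y (Hnabla c x u v)) (D := 'd t y)) law u0 v0 w' => //.
  - by move=> a b e; exact: Hmetric_additive.
  - by move=> a b; exact: Hmetric_sym.
  - by move=> a b; exact: Hnabla_sym.
  - by move=> a b; rewrite (Hnabla_sym cM xV).
have sub_of_eq0 (a b e : C2) : a + b - e = 0 -> a = e - b.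
  by move=> /subr0_eq <-; rewrite addrK.
exact: sub_of_eq0 S0.
Qed.

Theorem base_geometry : pseudo_kaehler V Hmetric /\ compatible V nabla Hmetric.
Proof.
have aff : affine_connection V Hnabla.
  split=> [c x cM xV r u u' v|c u v cM|].
  - split; last exact: Hnabla_linr.
    by rewrite !(Hnabla_sym cM xV _ v); exact: Hnabla_linr.
  - exact: Hnabla_smooth.
  - exact: Hnabla_transition.
have tor : torsion_free V Hnabla by move=> c x cM xV u v; exact: Hnabla_sym.
split.
  split; last exact: Hmetric_closed.
    split=> [c x cM xV r u u' v|c c' x cM cM' xV u v|c u v cM|c x u cM xV].
    - by split; [exact: Hmetric_linear|exact: Hmetric_sym].
    - exact: H_inv.
    - exact: Hmetric_smooth.
    - exact: Hmetric_nondeg.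
  by move=> c x cM xV u v; exact: Hmetric_J.
exists Hnabla; split; last exact: Hnabla_equiv.
  by split => // c x cM xV u v w; exact: Hmetric_compat.
by split => // c x cM xV u v; exact: Hnabla_J.
Qed.

End BaseGeometry.

(* The coordinates of [stab_model] are locked to keep unification from unfolding them. *)
HB.lock Definition Amx {R : realType} (q : @stab_model R) : 'M[R[i]]_2 :=
  cplx_mx q.1.1 q.1.2.
HB.lock Definition bmx {R : realType} (q : @stab_model R) : 'rV[R[i]]_2 :=
  cplx_mx q.2.1 q.2.2.
HB.lock Definition mkq {R : realType} (A : 'M[R[i]]_2) (b : 'rV[R[i]]_2) : stab_model :=
  ((map_mx (@complex.Re R) A, map_mx (@complex.Im R) A),
   (map_mx (@complex.Re R) b, map_mx (@complex.Im R) b)).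
(* Coordinates of [(stab_mx q)^-1 * stab_mx q'], linear in [q']. *)
HB.lock Definition ltrans {R : realType} (q q' : @stab_model R) : stab_model :=
  mkq (invmx (Amx q) *m Amx q')
      (\det (Amx q) *: (bmx q' - bmx q *m invmx (Amx q) *m Amx q')).

(** * Coordinates on the stabiliser *)

Section Stabiliser.
Context {R : realType}.
Local Notation C := R[i].
Local Notation stab_model := (@stab_model R).

Lemma sum3 (V : nmodType) (F : 'I_3 -> V) :
  \sum_(a < 3) F a = F 0 + \sum_(s < 2) F (sh s).
Proof. by rewrite big_ord_recl. Qed.

Lemma mx3_trace (p : 'M[C]_3) : \tr p = p 0 0 + \sum_(k < 2) p (sh k) (sh k).
Proof. exact: sum3. Qed.

Lemma shE i : sh i = rshift 1 i :> 'I_(1 + 2).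
Proof. exact: val_inj. Qed.

Lemma mx3P (A B : 'M[C]_3) : A 0 0 = B 0 0 -> (forall j, A 0 (sh j) = B 0 (sh j)) ->
  (forall i, A (sh i) 0 = B (sh i) 0) ->
  (forall i j, A (sh i) (sh j) = B (sh i) (sh j)) -> A = B.
Proof.
move=> h00 h0 h1 h; apply/matrixP => i j.
by case: (unliftP ord0 i) => [i' ->|->]; case: (unliftP ord0 j) => [j' ->|->];
  first [exact: h|exact: h1|exact: h0|exact: h00].
Qed.

Implicit Types (q u v w : stab_model).

Lemma Amx_mkq (A : 'M[C]_2) (b : 'rV[C]_2) : Amx (@mkq R A b) = A.
Proof. by apply/matrixP => i j; rewrite Amx.unlock mkq.unlock !mxE /=; case: (A i j). Qed.
Lemma bmx_mkq (A : 'M[C]_2) (b : 'rV[C]_2) : bmx (@mkq R A b) = b.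
Proof. by apply/matrixP => i j; rewrite bmx.unlock mkq.unlock !mxE /=; case: (b i j). Qed.

Lemma stab_model_inj (q q' : stab_model) : Amx q = Amx q' -> bmx q = bmx q' -> q = q'.
Proof.
case: q => [[a1 a2] [b1 b2]]; case: q' => [[a1' a2'] [b1' b2']].
rewrite Amx.unlock bmx.unlock => /matrixP hA /matrixP hb.
have e (m n : nat) (x1 x2 y1 y2 : 'M[R]_(m, n)) :
    cplx_mx x1 x2 =2 cplx_mx y1 y2 -> (x1, x2) = (y1, y2).
  move=> h; congr pair; apply/matrixP => i j; have := h i j; rewrite !mxE => -[] //.
by congr pair; apply: e.
Qed.

Lemma Amx_linear (r : R) u v : Amx (r *: u + v) = r%:C%C *: Amx u + Amx v.
Proof.
rewrite Amx.unlock; apply/matrixP => i j; rewrite !mxE /=; apply/eqP; rewrite eq_complex /=.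
by rewrite !mul0r subr0 addr0 !eqxx.
Qed.
Lemma bmx_linear (r : R) u v : bmx (r *: u + v) = r%:C%C *: bmx u + bmx v.
Proof.
rewrite bmx.unlock; apply/matrixP => i j; rewrite !mxE /=; apply/eqP; rewrite eq_complex /=.
by rewrite !mul0r subr0 addr0 !eqxx.
Qed.

Lemma findim_stab : findim stab_model.
Proof. by do 2! apply: findim_prod; try apply: findim_prod; exact: findim_matrix. Qed.

Lemma stab_domE q : stab_dom q = (\det (Amx q) != 0) :> Prop.
Proof. by rewrite Amx.unlock. Qed.

Lemma stab_mxE q :
  (stab_mx q 0 0 = (\det (Amx q))^-1) *
  (forall j, stab_mx q 0 (sh j) = bmx q 0 j) *
  (forall i, stab_mx q (sh i) 0 = 0) *
  (forall i j, stab_mx q (sh i) (sh j) = Amx q i j).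
Proof.
rewrite Amx.unlock bmx.unlock.
pose A := cplx_mx q.1.1 q.1.2; pose b := cplx_mx q.2.1 q.2.2.
pose d : 'M[C]_1 := ((\det A)^-1)%:M.
do ![split] => [|j|i|i j]; rewrite ?shE.
- transitivity (stab_mx q (lshift 2 (0 : 'I_1)) (lshift 2 (0 : 'I_1))).
    by congr (stab_mx q _ _); exact: val_inj.
  have := @block_mxEul C 1 2 1 2 d b 0 A 0 0.
  by rewrite [X in _ = X]mxE eqxx mulr1n => <-.
- transitivity (stab_mx q (lshift 2 (0 : 'I_1)) (rshift 1 j)).
    by congr (stab_mx q _ _); exact: val_inj.
  exact: (@block_mxEur C 1 2 1 2 d b 0 A 0 j).
- transitivity (stab_mx q (rshift 1 i) (lshift 2 (0 : 'I_1))).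
    by congr (stab_mx q _ _); exact: val_inj.
  have := @block_mxEdl C 1 2 1 2 d b 0 A i 0.
  by rewrite [X in _ = X]mxE => <-.
- exact: (@block_mxEdr C 1 2 1 2 d b 0 A i j).
Qed.

Lemma det_block3 (p : 'M[C]_3) : (forall i, p (sh i) 0 = 0) ->
  \det p = p 0 0 * \det (\matrix_(i < 2, j < 2) p (sh i) (sh j)).
Proof.
move=> p0; rewrite (expand_det_col _ 0) sum3 [X in _ + X]big1 => [|i _]; last first.
  by rewrite p0 mul0r.
rewrite addr0 /cofactor expr0 mul1r; congr (_ * \det _).
by apply/matrixP => i j; rewrite !mxE.
Qed.

Lemma stab_stab_mx q : stab_dom q -> @stab R (stab_mx q).
Proof.
rewrite stab_domE => q0; split.
  rewrite det_block3 ?stab_mxE => [|i]; last by rewrite stab_mxE.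
  rewrite (_ : \matrix_(_, _) _ = Amx q) ?mulVf//.
  by apply/matrixP => i j; rewrite mxE stab_mxE.
exists (\det (Amx q))^-1; rewrite -colE; apply/matrixP => i j.
rewrite [LHS]mxE [RHS]mxE [delta_mx _ _ _ _]mxE ord1 eqxx andbT.
by case: (unliftP ord0 i) => [i' ->|->] /=; rewrite ?mulr1 ?mulr0 stab_mxE.
Qed.

(** Stabilising the line kills the first column below the corner, and determinant one then forces
    the corner entry to be [(det A)^-1]. *)
Lemma stabP p : @stab R p -> exists2 q, stab_dom q & p = stab_mx q.
Proof.
move=> [detp [a pa]].
have p0 i : p (sh i) 0 = 0.
  have := congr1 (fun X : 'cV[C]_3 => X (sh i) 0) pa.
  by rewrite -colE [LHS]mxE => ->; rewrite mxE [delta_mx _ _ _ _]mxE /= mulr0.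
pose A := \matrix_(i < 2, j < 2) p (sh i) (sh j).
pose q := mkq A (\row_j p 0 (sh j)).
have pd : p 0 0 * \det A = 1 by rewrite -det_block3.
have dA : \det A != 0.
  by apply: contra_eq_neq pd => ->; rewrite mulr0 eq_sym oner_eq0.
exists q; first by rewrite stab_domE Amx_mkq.
apply: mx3P => [|j|i|i j]; rewrite stab_mxE ?Amx_mkq ?bmx_mkq ?mxE //.
by rewrite -[LHS](mulfK dA) pd mul1r.
Qed.

Lemma Amx_ltrans q q' : Amx (ltrans q q') = invmx (Amx q) *m Amx q'.
Proof. by rewrite ltrans.unlock Amx_mkq. Qed.

Lemma bmx_ltrans q q' : bmx (ltrans q q') =
  \det (Amx q) *: (bmx q' - bmx q *m invmx (Amx q) *m Amx q').
Proof. by rewrite ltrans.unlock bmx_mkq. Qed.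

Let ltrans_lin q (a : C) u v w :
  Amx w = a *: Amx u + Amx v -> bmx w = a *: bmx u + bmx v ->
  Amx (ltrans q w) = a *: Amx (ltrans q u) + Amx (ltrans q v) /\
  bmx (ltrans q w) = a *: bmx (ltrans q u) + bmx (ltrans q v).
Proof.
move=> eA eb; rewrite !Amx_ltrans !bmx_ltrans eA eb; split.
  by rewrite mulmxDr scalemxAr.
rewrite mulmxDr -scalemxAr.
by rewrite opprD addrACA -scalerBr scalerDr !scalerA mulrC.
Qed.

Lemma ltrans_linear q : linear (ltrans q).
Proof.
move=> r u v; have [eA eb] := ltrans_lin q (Amx_linear r u v) (bmx_linear r u v).
apply: stab_model_inj.
  exact: etrans eA (esym (Amx_linear r (ltrans q u) (ltrans q v))).
exact: etrans eb (esym (bmx_linear r (ltrans q u) (ltrans q v))).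
Qed.

Lemma unitA q : stab_dom q -> Amx q \in unitmx.
Proof. by rewrite stab_domE => q0; rewrite unitmxE unitfE. Qed.

Lemma stab_mx_ltrans q q' : stab_dom q ->
  stab_mx q *m stab_mx (ltrans q q') = stab_mx q'.
Proof.
move=> q0; have uA := unitA q0; rewrite stab_domE in q0.
have AA : Amx q *m (invmx (Amx q) *m Amx q') = Amx q' by rewrite mulKVmx.
apply: mx3P => [|j|i|i j]; rewrite mxE sum3 !stab_mxE ?Amx_ltrans ?bmx_ltrans.
- rewrite big1 => [|s _]; last by rewrite !stab_mxE mulr0.
  by rewrite addr0 det_mulmx det_inv invfM invrK mulrA mulVf ?mul1r.
- under eq_bigr do rewrite !stab_mxE Amx_ltrans.
  have := congr1 (fun X : 'rV[C]_2 => X 0 j) (mulmxA (bmx q) (invmx (Amx q)) (Amx q')).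
  by rewrite mxE => ->; rewrite [X in _ * X]mxE mulKf// !mxE subrK.
- by rewrite big1 ?mul0r ?addr0// => s _; rewrite !stab_mxE mulr0.
- under eq_bigr do rewrite !stab_mxE Amx_ltrans.
  by rewrite mul0r add0r -[in RHS]AA mxE.
Qed.

Lemma stab_dom_ltrans q q' : stab_dom q -> stab_dom q' -> stab_dom (ltrans q q').
Proof.
rewrite !stab_domE => q0 q0'; rewrite Amx_ltrans det_mulmx det_inv.
exact: mulf_neq0 (invr_neq0 q0) q0'.
Qed.

Lemma ltrans_id q : stab_dom q -> ltrans q q = stab1.
Proof.
move=> q0; have uA := unitA q0.
apply: stab_model_inj; rewrite ?Amx_ltrans ?bmx_ltrans.
  rewrite mulVmx// Amx.unlock; apply/matrixP => i j; rewrite !mxE /=.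
  by case: (i == j).
rewrite mulmxKV// subrr scaler0 bmx.unlock; apply/matrixP => i j; rewrite !mxE /=.
by [].
Qed.

Lemma ltrans_surj q w : stab_dom q -> exists w', ltrans q w' = w.
Proof.
move=> q0; have uA := unitA q0; rewrite stab_domE in q0.
exists (mkq (Amx q *m Amx w) ((\det (Amx q))^-1 *: bmx w + bmx q *m Amx w)).
apply: stab_model_inj; rewrite ?Amx_ltrans ?bmx_ltrans ?Amx_mkq ?bmx_mkq ?mulKmx//.
by rewrite mulmxA mulmxKV// addrK scalerA divff// scale1r.
Qed.

Lemma has_diff_ltrans q x : has_diff (ltrans q) x (ltrans q).
Proof. by apply: has_diff_linear; [exact: findim_stab|exact: ltrans_linear]. Qed.

Lemma has_diffC_Amx i j x :
  has_diffC (fun q : stab_model => Amx q i j) x (fun q => Amx q i j).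
Proof.
apply: has_diffC_linear; first exact: findim_stab.
by move=> r u v; rewrite Amx_linear !mxE.
Qed.

Lemma has_diffC_bmx j x :
  has_diffC (fun q : stab_model => bmx q 0 j) x (fun q => bmx q 0 j).
Proof.
apply: has_diffC_linear; first exact: findim_stab.
by move=> r u v; rewrite bmx_linear !mxE.
Qed.

(** The corner entry, the derivative of [(det A)^-1], is left out: where it matters it is recovered
    from the vanishing trace of [theta]. *)
Lemma dstab_mxE w :
  (forall j, dstab_mx w 0 (sh j) = bmx w 0 j) *
  (forall i, dstab_mx w (sh i) 0 = 0) *
  (forall i j, dstab_mx w (sh i) (sh j) = Amx w i j).
Proof.
do ![split] => [j|i|i j]; rewrite /dstab_mx mxE; under eq_fun do rewrite stab_mxE.
- by rewrite (has_diffCE w (has_diffC_bmx j _)).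
- by rewrite (has_diffCE w (has_diffC_cst 0 _)).
- by rewrite (has_diffCE w (has_diffC_Amx i j _)).
Qed.

Lemma stab_dom_open : open (@stab_dom R).
Proof.
rewrite openE => q; rewrite stab_domE => q0.
have h := has_diffCD (has_diffCM (has_diffC_Amx 0 0 q) (has_diffC_Amx 1 1 q))
   (has_diffCN (has_diffCM (has_diffC_Amx 0 1 q) (has_diffC_Amx 1 0 q))).
have nz (z : C) : z != 0 -> complex.Re z != 0 \/ complex.Im z != 0.
  by rewrite eq_complex negb_and => /orP.
have near_nz (f : stab_model -> R^o) : differentiable f q -> f q != 0 ->
    \forall q' \near q, f q' != 0.
  move=> df fq; have cf := differentiable_continuous df.
  exact: (cvgr_neq0 (f q) cf fq).
have [h1 h2] := h.
have hS q' : \det (Amx q') != 0 -> stab_dom q' by rewrite stab_domE.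
have [hq|hq] := nz _ q0.
  have := near_nz _ h1.1; rewrite -det2 => /(_ hq); apply: filterS => q' hq'.
  by apply: hS; apply: contra_neq hq'; rewrite det2 => ->.
have := near_nz _ h2.1; rewrite -det2 => /(_ hq); apply: filterS => q' hq'.
by apply: hS; apply: contra_neq hq'; rewrite det2 => ->.
Qed.

End Stabiliser.

(** * The local parametrisation of the bundle *)

Section BundleMap.
Context {R : realType}.
Local Notation C := R[i].
Local Notation C2 := (@C2 R).
Local Notation R16 := (@R16 R).
Local Notation stab_model := (@stab_model R).
Variables (M : complex_surface R) (B : principal_bundle M).
Variables (c : chart M C2) (s : M -> B).
Hypothesis cM : atlas M c.
Hypothesis s_smooth : smooth_map s (cdom c).
Hypothesis s_section : forall x, cdom c x -> bproj B (s x) = x.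
Implicit Types (e : chart B R16) (p : (C2 * stab_model)%type) (q : stab_model).

Definition Fmap (p : (C2 * stab_model)%type) : B :=
  bact (s (cinv c p.1)) (stab_mx p.2).

Definition Fdom : set (C2 * stab_model)%type := crange c `*` @stab_dom R.

Lemma crange_open : open (crange c).
Proof. by have [[]] := atlas_chart cM. Qed.

Lemma crangeK y : crange c y -> cdom c (cinv c y) /\ cmap c (cinv c y) = y.
Proof. by move=> [x cx <-]; rewrite chartK. Qed.

Lemma crangeI : cmap c @` (cdom c `&` cdom c) = crange c.
Proof. by rewrite setIid. Qed.

Lemma Fdom_open : open Fdom.
Proof.
rewrite openE => p [cp qp]; exists (crange c, @stab_dom R); last by [].
by split; apply: open_nbhs_nbhs; split => //; [exact: crange_open|exact: stab_dom_open].
Qed.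

Lemma section_continuous y : crange c y -> {for y, continuous (fun y => s (cinv c y))}.
Proof. by move=> cy; have [+ _] := s_smooth cM; apply; rewrite crangeI. Qed.

Lemma base_chartK e b : atlas B e -> cdom e b -> cinv e (cmap e b) = b.
Proof. by move=> /atlas_chart[_ _ _]; exact. Qed.

Definition Act e e' (zq : (R16 * stab_model)%type) : R16 :=
  cmap e' (bact (cinv e zq.1) (stab_mx zq.2)).

Lemma Act_smooth n e e' : atlas B e -> atlas B e' ->
  Ck n (Act e e') ((crange e `*` @stab_dom R) `&`
    [set zq | cdom e' (bact (cinv e zq.1) (stab_mx zq.2))]).
Proof. by move=> eB eB'; have [_ h] := act_smooth eB; exact: h. Qed.

Lemma section_fst_continuous p : Fdom p ->
  {for p, continuous (fun p : (C2 * stab_model)%type => s (cinv c p.1))}.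
Proof.
move=> [/= cy _]; apply: (@continuous_comp _ _ _ fst (fun y => s (cinv c y))).
  exact: cvg_fst.
exact: section_continuous.
Qed.

Lemma section_nbhs e : atlas B e ->
  open (Fdom `&` [set p | cdom e (s (cinv c p.1))]).
Proof.
move=> eB; apply: open_on_preimage; first exact: Fdom_open.
  exact: section_fst_continuous.
by have [[]] := atlas_chart eB.
Qed.

Lemma section_lift_smooth n e : atlas B e ->
  Ck n (fun p : (C2 * stab_model)%type => (cmap e (s (cinv c p.1)), p.2))
     (Fdom `&` [set p | cdom e (s (cinv c p.1))]).
Proof.
move=> eB; have oN := section_nbhs eB.
apply: Ck_pair => //.
  have [_ h] := s_smooth cM; have hs := h e eB n.
  apply: (@Ck_comp _ _ _ _ n fst _ _ _ findim_C2 oN _ _ hs).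
    by move=> p [[cy _] sp]; split; [rewrite crangeI|exact: sp].
  by apply: (@Ck_lin _ _ _ n fst) => // z; exact: cvg_fst.
by apply: (@Ck_lin _ _ _ n snd) => // z; exact: cvg_snd.
Qed.

Lemma Fmap_Act e p : atlas B e -> cdom e (s (cinv c p.1)) ->
  bact (cinv e (cmap e (s (cinv c p.1)))) (stab_mx p.2) = Fmap p.
Proof. by move=> eB sp; rewrite base_chartK. Qed.

Lemma Fmap_continuous p : Fdom p -> {for p, continuous Fmap}.
Proof.
move=> Dp; have [e eB esp] := atlas_cover (s (cinv c p.1)).
have oN := section_nbhs eB.
have Np : (Fdom `&` [set p | cdom e (s (cinv c p.1))]) p by split.
have [hc _] := act_smooth eB.
have h1 : {for p, continuous (fun p' : (C2 * stab_model)%type =>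
    bact (cinv e (cmap e (s (cinv c p'.1)))) (stab_mx p'.2))}.
  apply: (@continuous_comp _ _ _
    (fun p' : (C2 * stab_model)%type => (cmap e (s (cinv c p'.1)), p'.2))
    (fun zq : (R16 * stab_model)%type => bact (cinv e zq.1) (stab_mx zq.2))).
    exact: (section_lift_smooth 0 eB).
  by apply: hc; split => /=; [exists (s (cinv c p.1))|exact: Dp.2].
rewrite /prop_for /continuous_at -(Fmap_Act eB esp).
apply: cvg_trans h1; apply: near_eq_cvg.
have : nbhs p (Fdom `&` [set p | cdom e (s (cinv c p.1))]) by exact: open_nbhs_nbhs.
by apply: filterS => p' [_ ep']; exact: Fmap_Act.
Qed.

Definition Fdome e : set (C2 * stab_model)%type := Fdom `&` Fmap @^-1` cdom e.

Lemma Fdome_open e : atlas B e -> open (Fdome e).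
Proof.
move=> eB; apply: open_on_preimage; first exact: Fdom_open.
  exact: Fmap_continuous.
by have [[]] := atlas_chart eB.
Qed.

Definition Fcoord e (p : (C2 * stab_model)%type) : R16 := cmap e (Fmap p).

Lemma findim_R16S : findim (R16 * stab_model)%type.
Proof. by apply: findim_prod; [exact: findim_matrix|exact: findim_stab]. Qed.

(** Locally [F] is the action, read from a chart [e0] around the section to the chart [e], composed
    with the smooth lift of the section. *)
Lemma Fcoord_smooth n e : atlas B e -> Ck n (Fcoord e) (Fdome e).
Proof.
move=> eB; apply: Ck_local => p [Dp ep].
have [e0 eB0 esp] := atlas_cover (s (cinv c p.1)).
pose N := Fdome e `&` (Fdom `&` [set p | cdom e0 (s (cinv c p.1))]).
have oN : open N by apply: openI; [exact: Fdome_open|exact: section_nbhs].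
exists N; first by [].
apply: (@Ck_ext _ _ _ _ (fun p' => Act e0 e (cmap e0 (s (cinv c p'.1)), p'.2))) => //.
  by move=> p' [_ [_ sp']]; rewrite /Act /Fcoord /= Fmap_Act.
apply: (Ck_comp findim_R16S oN _ _ (Act_smooth n eB0 eB)).
  move=> p' [[Dp' ep'] [_ sp']]; split; first split => /=.
  - by exists (s (cinv c p'.1)).
  - exact: Dp'.2.
  - by rewrite /= (base_chartK eB0 sp').
by apply: Ck_sub (section_lift_smooth n eB0) => p' [].
Qed.

Lemma bproj_Fmap p : Fdom p -> bproj B (Fmap p) = cinv c p.1.
Proof.
move=> [/= /crangeK[cx _] q0]; rewrite -[RHS](s_section cx); apply/esym.
by apply/(act_fibre (s (cinv c p.1))); exists (stab_mx p.2) => //; exact: stab_stab_mx.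
Qed.

Lemma Fmap_surj b : cdom c (bproj B b) ->
  exists2 q, stab_dom q & b = Fmap (cmap c (bproj B b), q).
Proof.
move=> cb; have : bproj B (s (bproj B b)) = bproj B b by rewrite s_section.
move=> /(act_fibre _ _)[p /stabP[q q0 ->] bE]; exists q => //.
by rewrite /Fmap /= chartK.
Qed.

(** * The Cartan connection in the parametrisation *)

Section Theta.
Variables (nabla : connection M) (theta : mform1 B).
Hypothesis hth : cartan_connection theta.
Hypothesis hs : adapted_section nabla theta c s.

Lemma theta_linear e b (r : R) u v : atlas B e -> cdom e b ->
  theta e b (r *: u + v) = r%:C%C *: theta e b u + theta e b v.
Proof.
move=> eB eb; apply/matrixP => i j; rewrite !mxE.
by have [h _ _] := theta_form hth i j; exact: h.
Qed.

Lemma theta_horizontal e p u : atlas B e -> Fdome e p ->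
  let t := theta e (Fmap p) ('d (Fcoord e) p (u, 0)) in
  let A := Amx p.2 in
  [/\ forall i j, \sum_(k < 2) A i k * t (sh k) (sh j) =
        dz i u * bmx p.2 0 j + \sum_(k < 2) Pimx nabla c (cinv c p.1) u i k * A k j,
      forall i, \sum_(k < 2) A i k * t (sh k) 0 = (\det A)^-1 * dz i u &
      (\det A)^-1 * t 0 0 + \sum_(k < 2) bmx p.2 0 k * t (sh k) 0 = 0].
Proof.
case: p => y q eB Dp t A.
have cy : crange c y := Dp.1.1; have q0 : stab_dom q := Dp.1.2.
have ep : cdom e (Fmap (y, q)) := Dp.2.
have [cx xy] := crangeK cy.
pose x := cinv c y.
have [e0 eB0 esp] := atlas_cover (s x).
pose P := stab_mx q.
have stP : stab P by exact: stab_stab_mx.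
have hF : has_diff (Fcoord e) (y, q) ('d (Fcoord e) (y, q)).
  exact: (Ck_diff (Fcoord_smooth 1 eB) Dp).
have hF1 : has_diff (fun y' => Fcoord e (y', q)) y (fun u => 'd (Fcoord e) (y, q) (u, 0)).
  exact: (has_diff_comp (has_diff_pair (has_diff_id y) (has_diff_cst q y)) hF).
have hS : has_diff (fun y' => cmap e0 (s (cinv c y'))) y (dmap s c e0 x).
  have [_ h] := s_smooth cM; have h1 : Ck 1 _ _ := h e0 eB0 1%N.
  have := Ck_diff h1 (x := y).
  rewrite /dmap xy; apply; split => //.
  by rewrite crangeI.
have hA : has_diff (fun z => cmap e (bact (cinv e0 z) P)) (cmap e0 (s x))
    (dmap (fun b => bact b P) e0 e (s x)).
  apply: differentiable_has_diff.
  have hAct := Ck_diff (Act_smooth 1 eB0 eB) (x := (cmap e0 (s x), q)).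
  have [|d _] := has_diff_comp (has_diff_pair (has_diff_id (cmap e0 (s x)))
     (has_diff_cst q (cmap e0 (s x)))) (hAct _); last exact: d.
  by split; [split => //=; exists (s x)|rewrite /= base_chartK].
have hc := has_diff_comp hS hA.
have hF2 : has_diff (fun y' => Fcoord e (y', q)) y
    (fun u => dmap (fun b => bact b P) e0 e (s x) (dmap s c e0 x u)).
  apply: near_has_diff hc.
  have : nbhs y (crange c `&` [set y | cdom e0 (s (cinv c y))]).
    apply: open_nbhs_nbhs; split => //; apply: open_on_preimage.
    - exact: crange_open.
    - exact: section_continuous.
    - by have [[]] := atlas_chart eB0.
  by apply: filterS => y' [_ sy']; rewrite /Fcoord /Fmap /= base_chartK.
have tE : t = invmx P *m theta e0 (s x) (dmap s c e0 x u) *m P.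
  rewrite /t -(has_diffE u hF1) (has_diffE u hF2).
  exact: (theta_equivariant hth).
have [_ _ /(_ x e0 u cx eB0 esp)[t00 ti0 tij _]] := hs.
set tau := theta e0 (s x) _ in tE t00 ti0 tij.
have uP : P \in unitmx by rewrite unitmxE stP.1 unitr1.
have PtE : P *m t = tau *m P by rewrite tE -mulmxA mulKVmx.
have ent i j := congr1 (fun X : 'M[C]_3 => X i j) PtE.
split=> [i j|i|].
- have := ent (sh i) (sh j).
  rewrite mxE sum3 [X in _ = X]mxE sum3 !stab_mxE mul0r add0r ti0.
  under eq_bigr do rewrite stab_mxE.
  under [X in _ = _ + X]eq_bigr do rewrite stab_mxE tij.
  by move=> ->; congr (_ + _); apply: eq_bigr => k _; rewrite mxE.
- have := ent (sh i) 0.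
  rewrite mxE sum3 [X in _ = X]mxE sum3 !stab_mxE mul0r add0r ti0.
  under eq_bigr do rewrite stab_mxE.
  rewrite [X in _ = _ + X]big1 => [|k _]; last by rewrite stab_mxE mulr0.
  by rewrite addr0 mulrC.
- have := ent 0 0.
  rewrite mxE sum3 [X in _ = X]mxE sum3 !stab_mxE t00 mul0r add0r.
  under eq_bigr do rewrite stab_mxE.
  by rewrite [X in _ = X]big1 // => k _; rewrite stab_mxE mulr0.
Qed.

(** Since [F (y, q')] is [F (y, q)] acted on by [p^-1 p'], varying [q] produces a fundamental vector
    field, whose value under [theta] is prescribed; [ltrans] is its own differential. *)
Lemma theta_vertical e p w : atlas B e -> Fdome e p ->
  theta e (Fmap p) ('d (Fcoord e) p (0, w)) = dstab_mx (ltrans p.2 w).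
Proof.
case: p => y q eB Dp.
have cy : crange c y := Dp.1.1; have q0 : stab_dom q := Dp.1.2.
have ep : cdom e (Fmap (y, q)) := Dp.2.
have hF : has_diff (Fcoord e) (y, q) ('d (Fcoord e) (y, q)).
  exact: (Ck_diff (Fcoord_smooth 1 eB) Dp).
have hF1 : has_diff (fun q' => Fcoord e (y, q')) q (fun w => 'd (Fcoord e) (y, q) (0, w)).
  exact: (has_diff_comp (has_diff_pair (has_diff_cst y q) (has_diff_id q)) hF).
pose b := Fmap (y, q).
have s1 : stab_dom (@stab1 R) by rewrite -(ltrans_id q0); exact: stab_dom_ltrans.
have bact1 : bact b (stab_mx stab1) = b.
  have e1 : stab_mx q *m stab_mx stab1 = stab_mx q.
    by rewrite -[in RHS](stab_mx_ltrans q q0) ltrans_id.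
  by rewrite /b /Fmap /= actM ?e1//; exact: stab_stab_mx.
have hA : has_diff (fun q' => cmap e (bact b (stab_mx q'))) stab1
    ('d (fun q' => cmap e (bact b (stab_mx q'))) stab1).
  apply: differentiable_has_diff.
  have hAct := Ck_diff (Act_smooth 1 eB eB) (x := (cmap e b, stab1)).
  have [|d _] := has_diff_comp (has_diff_pair (has_diff_cst (cmap e b) stab1)
     (has_diff_id stab1)) (hAct _).
    by split; [split => //=; exists b|rewrite /= base_chartK// bact1].
  by move: d; rewrite /Act /= base_chartK.
have hr := has_diff_ltrans q q.
rewrite -(ltrans_id q0) in hA; have hc := has_diff_comp hr hA.
have hF2 : has_diff (fun q' => Fcoord e (y, q')) q
    (fun w => 'd (fun q' => cmap e (bact b (stab_mx q'))) stab1 (ltrans q w)).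
  rewrite -(ltrans_id q0); apply: near_has_diff hc.
  have : nbhs q (@stab_dom R) by apply: open_nbhs_nbhs; split => //; exact: stab_dom_open.
  apply: filterS => q' q0'; rewrite /Fcoord /b /Fmap /= actM ?stab_mx_ltrans//.
    exact: stab_stab_mx.
  by apply: stab_stab_mx; exact: stab_dom_ltrans.
rewrite -(has_diffE w hF1) (has_diffE w hF2).
exact: (theta_fundamental hth).
Qed.

Lemma theta_add e b u v : atlas B e -> cdom e b ->
  theta e b (u + v) = theta e b u + theta e b v.
Proof.
move=> eB eb; have := theta_linear 1 u v eB eb.
by rewrite scale1r rmorph1 scale1r.
Qed.

Lemma Fcoord_pair e p u w : Fdome e p ->
  'd (Fcoord e) p (u, w) = 'd (Fcoord e) p (u, 0) + 'd (Fcoord e) p (0, w).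
Proof.
move=> Dp; rewrite -linearD; congr ('d _ _ _).
by apply/pair_equal_spec; rewrite /= addr0 add0r.
Qed.

Lemma theta_base e p u w : atlas B e -> Fdome e p -> forall i,
  \sum_(k < 2) Amx p.2 i k * theta e (Fmap p) ('d (Fcoord e) p (u, w)) (sh k) 0 =
  (\det (Amx p.2))^-1 * dz i u.
Proof.
move=> eB Dp i; have [_ h _] := theta_horizontal u eB Dp.
rewrite -h; apply: eq_bigr => k _; congr (_ * _).
rewrite Fcoord_pair// theta_add//; last exact: Dp.2.
by rewrite theta_vertical// mxE !dstab_mxE addr0.
Qed.

(** As [theta] is injective, it suffices to match its values: [u] is fixed by the first column below
    the corner, which vertical vectors leave untouched, then [w] by the other columns; the corner
    follows from the trace. *)
Lemma Fcoord_surj e p v : atlas B e -> Fdome e p ->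
  exists uw, 'd (Fcoord e) p uw = v.
Proof.
move=> eB Dp; have ep : cdom e (Fmap p) := Dp.2.
have q0 : stab_dom p.2 := Dp.1.2.
pose b := Fmap p; pose A := Amx p.2.
have d0 : \det A != 0 by move: q0; rewrite stab_domE.
pose T := theta e b v.
pose u : C2 := \sum_(i < 2) cscale (\det A * \sum_(k < 2) A i k * T (sh k) 0) (ex i).
have uE i : (\det A)^-1 * dz i u = \sum_(k < 2) A i k * T (sh k) 0.
  rewrite /u dz_sum (bigD1 i)//= [X in _ + X]big1 => [|j /negPf ji].
    by rewrite addr0 dz_cscale dz_ex eqxx mulr1 mulKf.
  by rewrite dz_cscale dz_ex eq_sym ji mulr0.
pose t1 := theta e b ('d (Fcoord e) p (u, 0)).
have t10 i : t1 (sh i) 0 = T (sh i) 0.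
  have [_ h _] := theta_horizontal u eB Dp.
  pose x1 : 'cV[C]_2 := \col_k t1 (sh k) 0; pose x2 : 'cV[C]_2 := \col_k T (sh k) 0.
  have e1 : A *m x1 = A *m x2.
    apply/matrixP => i' j; rewrite !mxE.
    under eq_bigr do rewrite mxE; rewrite h uE.
    by apply: eq_bigr => k _; rewrite mxE.
  have := congr1 (mulmx (invmx A)) e1.
  rewrite !mulKmx ?(unitA q0)// => /matrixP/(_ i 0).
  by rewrite !mxE.
pose T' := T - t1.
have [w wE] := ltrans_surj (mkq (\matrix_(i, j) T' (sh i) (sh j)) (\row_j T' 0 (sh j))) q0.
exists (u, w).
pose t2 := theta e b ('d (Fcoord e) p (0, w)).
have t2E : t2 = dstab_mx (ltrans p.2 w) by exact: theta_vertical.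
have tr0 v' : \tr (theta e b v') = 0 by apply: (theta_tr hth).
have offdiag : forall i j, t2 (sh i) (sh j) = T' (sh i) (sh j).
  by move=> i j; rewrite t2E dstab_mxE wE Amx_mkq mxE.
have t2T : t2 = T'.
  apply: mx3P => [|j|i|] //; last 2 first.
  - by rewrite t2E dstab_mxE wE bmx_mkq mxE.
  - by rewrite t2E dstab_mxE /T' !mxE t10 subrr.
  have e2 : t2 0 0 + \sum_(k < 2) t2 (sh k) (sh k) = 0 by rewrite -mx3_trace tr0.
  have e3 : T' 0 0 + \sum_(k < 2) T' (sh k) (sh k) = 0.
    by rewrite -mx3_trace /T' raddfB /= !tr0 subrr.
  rewrite (eq_bigr (fun k => T' (sh k) (sh k))) in e2; last by move=> k _; exact: offdiag.
  exact: addIr (etrans e2 (esym e3)).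
apply/eqP; rewrite -subr_eq0; apply/eqP.
apply: (theta_inj hth eB ep); rewrite Fcoord_pair//.
rewrite -[v in _ - v]scale1r -scaleNr addrC.
rewrite theta_linear// theta_add// -/b -/t1 -/t2 t2T rmorphN1 scaleN1r -/T /T'.
by rewrite [t1 + _]addrC subrK addNr.
Qed.

Lemma Fmap_open p W : Fdom p -> nbhs p W -> nbhs (Fmap p) (Fmap @` W).
Proof.
move=> Dp Wp; have [e eB ep] := atlas_cover (Fmap p).
have Dep : Fdome e p by [].
have [_ ce _ _] := atlas_chart eB.
have Wn : nbhs p (W `&` Fdome e).
  by apply: filterI => //; apply: open_nbhs_nbhs; split => //; exact: Fdome_open.
have := submersion_open (Fdome_open eB) Dep (Fcoord_smooth 1 eB)
  (fun v => Fcoord_surj v eB Dep) Wn.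
move=> /(ce _ ep) h.
have {}h : nbhs (Fmap p) (cmap e @^-1` (Fcoord e @` (W `&` Fdome e))) by exact: h.
have h2 : nbhs (Fmap p) (cdom e).
  by apply: open_nbhs_nbhs; split => //; have [[]] := atlas_chart eB.
apply: filterS (filterI h h2) => b' [[p' [Wp' [_ ep']] bE] eb'].
by exists p' => //; rewrite -(base_chartK eB eb') -bE base_chartK.
Qed.

Lemma dmap_bproj e p uw : atlas B e -> Fdome e p ->
  dmap (bproj B) e c (Fmap p) ('d (Fcoord e) p uw) = uw.1.
Proof.
move=> eB Dp; have ep : cdom e (Fmap p) := Dp.2.
have [cx xy] := crangeK Dp.1.1.
have hF := Ck_diff (Fcoord_smooth 1 eB) Dp.
have [_ hp] := proj_smooth eB.
have h1 : Ck 1 _ _ := hp c cM 1%N.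
have hpi := Ck_diff h1 (x := Fcoord e p).
have pE : bproj B (cinv e (Fcoord e p)) = cinv c p.1.
  by rewrite /Fcoord base_chartK// bproj_Fmap//; exact: Dp.1.
have [|d1 d2] := has_diff_comp hF (hpi _).
  by split; [exists (Fmap p)|rewrite /= pE].
have hfst : has_diff (fun p' => cmap c (bproj B (cinv e (Fcoord e p')))) p fst.
  apply: near_has_diff (has_diff_fst p).
  have : nbhs p (Fdome e) by apply: open_nbhs_nbhs; split => //; exact: Fdome_open.
  apply: filterS => p' [Dp' ep']; rewrite /Fcoord base_chartK// bproj_Fmap//.
  by have [] := crangeK Dp'.1.
by rewrite -(has_diffE uw hfst) d2.
Qed.

(** * Descent of the Hermitian matrix to the base *)

Section PullBack.
Variables (K : 'I_2 -> 'I_2 -> 'I_2 -> B -> C) (W : 'I_2 -> 'I_2 -> 'I_2 -> 'I_2 -> B -> C).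
Variables (U : set B) (h2 : 'I_2 -> 'I_2 -> B -> C) (h1 : 'I_2 -> B -> C) (h0 : B -> R).
Hypothesis U_open : open U.
Hypothesis h2_smooth : forall i j, smooth_fun (h2 i j) U.
Hypothesis h2_herm : forall i j b, U b -> h2 i j b = (h2 j i b)^*.
Hypothesis hsys : linear_system theta K W U h2 h1 h0.

Definition hmx b : 'M[C]_2 := \matrix_(i, j) h2 i j b.

Definition Hpull p : 'M[C]_2 := congr2 (Amx p.2) (hmx (Fmap p)).

Definition FU : set (C2 * stab_model)%type := Fdom `&` Fmap @^-1` U.

Lemma FU_open : open FU.
Proof.
apply: open_on_preimage => //; first exact: Fdom_open.
exact: Fmap_continuous.
Qed.

Lemma FUe_open e : atlas B e -> open (Fdome e `&` FU).
Proof. by move=> eB; apply: openI; [exact: Fdome_open|exact: FU_open]. Qed.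

Lemma hmx_herm b : U b -> herm2 (hmx b).
Proof. by move=> Ub i j; rewrite !mxE h2_herm. Qed.

Lemma h2_Fmap_CkC n e i j : atlas B e ->
  CkC n (fun p => h2 i j (Fmap p)) (Fdome e `&` FU).
Proof.
move=> eB; have oN := FUe_open eB.
apply: (@CkC_ext _ _ _ (fun p => h2 i j (cinv e (Fcoord e p)))) => //.
  by move=> p [[_ ep] _]; rewrite /Fcoord base_chartK.
have hh : CkC n (fun z => h2 i j (cinv e z)) (cmap e @` (cdom e `&` U)).
  by have [a b] := h2_smooth i j eB; split; [exact: a|exact: b].
apply: (@CkC_comp _ _ _ n (Fcoord e) _ _ _ (findim_matrix 1 16) oN _ _ hh).
  by move=> p [[_ ep] [_ Up]]; exists (Fmap p).
by apply: Ck_sub (Fcoord_smooth n eB) => p [].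
Qed.

Lemma h2_Fmap_diff e p i j : atlas B e -> (Fdome e `&` FU) p ->
  has_diffC (fun p => h2 i j (Fmap p)) p
    (fun uw => dfun (h2 i j) e (Fmap p) ('d (Fcoord e) p uw)).
Proof.
move=> eB Np; have [[Dp ep] [_ Up]] := Np.
have hh : CkC 1 (fun z => h2 i j (cinv e z)) (cmap e @` (cdom e `&` U)).
  by have [a b] := h2_smooth i j eB; split; [exact: a|exact: b].
have hz := CkC_has_diff (x := Fcoord e p) hh.
have hF := Ck_diff (Fcoord_smooth 1 eB) Np.1.
have hc := has_diffC_comp hF (hz ltac:(by exists (Fmap p))).
apply: near_has_diffC hc.
have : nbhs p (Fdome e `&` FU) by apply: open_nbhs_nbhs; split => //; exact: FUe_open.
by apply: filterS => p' [[_ ep'] _]; rewrite /Fcoord base_chartK.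
Qed.

Lemma adj2_has_diff i j q0 :
  has_diffC (fun q : stab_model => adj2 (Amx q) i j) q0 (fun q => adj2 (Amx q) i j).
Proof.
apply: has_diffC_linear; first exact: findim_stab.
move=> r u v; rewrite Amx_linear.
by move: i j; apply: forall2; apply: forall2; rewrite !adj2E !mxE; ring.
Qed.

(* The (1,0) part of [d h], from the first equation of the linear system. *)
Definition Xpart b (t : 'M[C]_3) : 'M[C]_2 := \matrix_(i, j)
  (t 0 0 * hmx b i j + (\sum_(k < 2) t (sh k) (sh i) * hmx b k j)
   + (\sum_(k < 2) eps k i * t (sh k) 0) * (h1 j b)^*).

Lemma h2_system e b v i j : atlas B e -> cdom e b -> U b ->
  let X := Xpart b (theta e b v) in
  dfun (h2 i j) e b v = X i j + (X j i)^*.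
Proof.
move=> eB eb Ub X; have [/(_ i j) -> _ _] := hsys v eB eb Ub.
rewrite /X !mxE; move: (theta e b v) => t.
have hh : forall i j, h2 i j b = (h2 j i b)^* by move=> *; exact: h2_herm.
rewrite !sum2 !mxE !(rmorphD, rmorphM) /= !conjCK -!hh.
have -> : 'Re (t 0 0) = (t 0 0 + (t 0 0)^*) / 2 by rewrite [LHS]ReE.
by field.
Qed.

Lemma Hpull_diff e p k l : atlas B e -> (Fdome e `&` FU) p ->
  has_diffC (fun p => Hpull p k l) p (fun uw =>
    let t := theta e (Fmap p) ('d (Fcoord e) p uw) in
    let Z := (adj2 (Amx uw.2))^T *m hmx (Fmap p) *m conjmx (adj2 (Amx p.2)) +
      (adj2 (Amx p.2))^T *m Xpart (Fmap p) t *m conjmx (adj2 (Amx p.2)) in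
    Z k l + (Z l k)^*).
Proof.
move=> eB Np; have [[Dp ep] [_ Up]] := Np.
have hB i j : has_diffC (fun p : (C2 * stab_model)%type => adj2 (Amx p.2) i j) p
    (fun uw => adj2 (Amx uw.2) i j).
  exact: (has_diffC_comp (has_diff_snd p) (adj2_has_diff i j p.2)).
have hc := has_diffC_sum (index_enum 'I_2) (fun j => has_diffCM
  (has_diffC_sum (index_enum 'I_2) (fun i => has_diffCM (hB i k) (h2_Fmap_diff i j eB Np)))
  (has_diffC_conj (hB j l))).
have -> : (fun p => Hpull p k l) = fun p : (C2 * stab_model)%type => \sum_(j < 2)
    (\sum_(i < 2) adj2 (Amx p.2) i k * h2 i j (Fmap p)) * (adj2 (Amx p.2) j l)^*.
  apply/funext => p'; rewrite /Hpull congr2E; apply: eq_bigr => j _; congr (_ * _).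
  by apply: eq_bigr => i _; rewrite mxE.
apply: has_diffC_eq hc _ => uw /=.
rewrite -congr2_deriv; last exact: hmx_herm.
apply: eq_bigr => j _; congr (_ * _ + _ * _).
  by apply: eq_bigr => i _; rewrite mxE.
by apply: eq_bigr => i _; rewrite (h2_system _ _ _ eB ep Up) [hmx _ i j]mxE.
Qed.

(** On a vertical vector the entries [theta^i_0] vanish and the 2 x 2 block is [A^-1 dA], so
    [vertical_algebra] applies. *)
Lemma Hpull_vertical e p w k l : atlas B e -> (Fdome e `&` FU) p ->
  dC (fun p => Hpull p k l) p (0, w) = 0.
Proof.
move=> eB Np; rewrite (has_diffCE _ (Hpull_diff k l eB Np)) /=.
rewrite theta_vertical//; last exact: Np.1.
have q0 : stab_dom p.2 := Np.1.1.2.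
set t := dstab_mx _.
pose T : 'M[C]_2 := \matrix_(i, j) t (sh i) (sh j).
have AT : Amx p.2 *m T = Amx w.
  have -> : T = invmx (Amx p.2) *m Amx w.
    by apply/matrixP => i j; rewrite mxE /t dstab_mxE Amx_ltrans.
  by rewrite mulKVmx ?unitA.
(* This condition supplies the corner entry of [t], which [dstab_mxE] leaves open. *)
have tr0 : \tr t = 0.
  by rewrite /t -(theta_vertical w eB Np.1); apply: (theta_tr hth) => //; exact: Np.1.2.
have ti0 m : t (sh m) 0 = 0 by rewrite /t dstab_mxE.
have XE : Xpart (Fmap p) t = - \tr T *: hmx (Fmap p) + T^T *m hmx (Fmap p).
  clearbody t; have t00 : t 0 0 = - \tr T.
    apply/eqP; rewrite -addr_eq0; apply/eqP; rewrite -[RHS]tr0 mx3_trace; congr (_ + _).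
    by apply: eq_bigr => i _; rewrite mxE.
  apply/matrixP => i j; rewrite !mxE t00 -[RHS]addr0; congr (_ + _ + _).
    by apply: eq_bigr => m _; rewrite !mxE.
  by rewrite big1 ?mul0r// => m _; rewrite ti0 mulr0.
have V := vertical_algebra (hmx (Fmap p)) AT; rewrite -XE in V.
have V0 i j := congr1 (fun Z : 'M[C]_2 => Z i j) V.
by rewrite !V0 !mxE rmorph0 addr0.
Qed.

(** [kappa] is found before [u]: it involves [A], [b], [h] and h_i at the point but not the
    direction, as [metric_algebra] will require in order to read it off the derivative of the
    determinant. *)
Lemma Hpull_horizontal p : FU p -> exists kappa : 'I_2 -> C, forall u,
  let Y k l := \sum_(m < 2) Pimx nabla c (cinv c p.1) u m k * Hpull p m l +
               (\sum_(m < 2) eps m k * dz m u) * kappa l in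
  forall k l, dC (fun p => Hpull p k l) p (u, 0) = Y k l + (Y l k)^*.
Proof.
move=> Fp; have [e eB ep] := atlas_cover (Fmap p).
have Dp : Fdome e p by split => //; exact: Fp.1.
have d0 : \det (Amx p.2) != 0 by move: Fp.1.2; rewrite stab_domE.
have [kappa hk] := horizontal_algebra (hmx (Fmap p)) (fun j => bmx p.2 0 j)
  (fun j => (h1 j (Fmap p))^*) d0.
exists kappa => u Y k l.
rewrite (has_diffCE _ (Hpull_diff k l eB (conj Dp Fp))) /=.
have [h1' h2' h3'] := theta_horizontal u eB Dp.
set t := theta _ _ _ in h1' h2' h3' *.
have ZE k' l' : ((adj2 (Amx (0 : stab_model)))^T *m hmx (Fmap p) *m conjmx (adj2 (Amx p.2)) +
    (adj2 (Amx p.2))^T *m Xpart (Fmap p) t *m conjmx (adj2 (Amx p.2))) k' l' = Y k' l'.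
  (* The map is its own differential at 0, and a differential vanishes on the zero vector. *)
  have A0 : adj2 (Amx (0 : stab_model)) = 0.
    apply/matrixP => i j; rewrite !mxE.
    have := has_diffE 0 (adj2_has_diff i j 0).1.
    have := has_diffE 0 (adj2_has_diff i j 0).2.
    rewrite !linear0; case: (adj2 _ i j) => a b /= <- <-; reflexivity.
  rewrite A0 trmx0 !mul0mx add0r /Y /Hpull.
  have := hk (Pimx nabla c (cinv c p.1) u) (\matrix_(i, j) t (sh i) (sh j))
    (fun i => dz i u) (fun i => t (sh i) 0) (t 0 0) _ h2' h3' k' l'.
  move=> <- //; last first.
    by move=> i j; rewrite -h1'; apply: eq_bigr => m _; rewrite mxE.
  congr ((_ *m _ *m _) k' l'); apply/matrixP => i j; rewrite !mxE.
  by congr (_ + _ + _); apply: eq_bigr => m _; rewrite !mxE.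
by rewrite !ZE.
Qed.

(** The coordinates [q] lie in a vector space, so the mean value theorem applies along a straight
    segment, whose direction is vertical. *)
Lemma Hpull_segment y (q0 q1 : stab_model) :
  (forall t : R, 0 <= t <= 1 -> FU (y, q0 + t *: (q1 - q0))) ->
  Hpull (y, q1) = Hpull (y, q0).
Proof.
move=> hseg; pose gam (t : R^o) : (C2 * stab_model)%type := (y, q0 + t *: (q1 - q0)).
have hd k l (t : R) : 0 <= t <= 1 ->
    has_diffC (fun t' => Hpull (gam t') k l) (t : R^o) (fun=> 0).
  move=> t01; have Fp := hseg t t01.
  have [e eB ep] := atlas_cover (Fmap (gam t)).
  have Dp : Fdome e (gam t) by split => //; exact: Fp.1.
  have hg : has_diff gam (t : R^o) (fun r => (0, r *: (q1 - q0))).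
    exact: has_diff_pair (has_diff_cst y (t : R^o)) (has_diff_line q0 (q1 - q0) t).
  have hH := Hpull_diff k l eB (conj Dp Fp).
  apply: has_diffC_eq (has_diffC_comp hg hH) _ => r.
  rewrite -(has_diffCE (0, r *: (q1 - q0)) hH).
  exact: Hpull_vertical eB (conj Dp Fp).
have g1 : gam 1 = (y, q1) by rewrite /gam scale1r addrC subrK.
have g0 : gam 0 = (y, q0) by rewrite /gam scale0r addr0.
apply/matrixP => k l; rewrite -g1 -g0.
apply/eqP; rewrite eq_complex -subr_eq0 -[X in _ && X]subr_eq0; apply/andP; split; apply/eqP.
  have [|t _ ->//] := @mean_value _ (fun t' => complex.Re (Hpull (gam t') k l)) (fun=> 0).
  by move=> t t01; apply: has_diff_eq (hd k l t t01).1 _ => r; rewrite mulr0.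
have [|t _ ->//] := @mean_value _ (fun t' => complex.Im (Hpull (gam t') k l)) (fun=> 0).
by move=> t t01; apply: has_diff_eq (hd k l t t01).2 _ => r; rewrite mulr0.
Qed.

(** The two lifts differ by a scalar matrix [a], whose corner entry is also the inverse of the
    determinant of its 2 x 2 block: [a = a^-2], so [a^3 = 1] and [|a| = 1]. *)
Lemma Hpull_fibre y (q q' : stab_model) : Fdom (y, q) -> Fdom (y, q') ->
  Fmap (y, q) = Fmap (y, q') -> Hpull (y, q) = Hpull (y, q').
Proof.
move=> [_ /= q0] [_ /= q0'] bE.
pose r := ltrans q q'; have r0 : stab_dom r by exact: stab_dom_ltrans.
have [a ra] : exists a : C, stab_mx r = a%:M.
  apply/(act_free (Fmap (y, q)) (stab_stab_mx r0)).
  rewrite [RHS]bE /Fmap /= actM ?stab_mx_ltrans//; exact: stab_stab_mx.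
have Ar : Amx r = a%:M.
  apply/matrixP => i j; have := congr1 (fun X : 'M[C]_3 => X (sh i) (sh j)) ra.
  by rewrite stab_mxE !mxE => ->; congr (_ *+ _).
have a3 : a ^+ 3 = 1.
  have a20 : a ^+ 2 != 0 by move: r0; rewrite stab_domE Ar det_scalar.
  have := congr1 (fun X : 'M[C]_3 => X 0 0) ra.
  rewrite stab_mxE mxE eqxx mulr1n Ar det_scalar => aE.
  by rewrite exprS -[X in X * _]aE mulVf.
have na : `|a| = 1.
  by apply/eqP; rewrite -(@pexpr_eq1 _ _ 3)// -normrX a3 normr1.
have Aq' : Amx q' = a *: Amx q.
  have := Amx_ltrans q q'; rewrite -/r Ar => e.
  by rewrite -[LHS](mulKVmx (unitA q0)) -e mul_mx_scalar.
by rewrite /Hpull -bE [Amx (y, q').2]Aq' congr2_scale.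
Qed.

Hypothesis U_fibre : forall x : M, connected (U `&` bproj B @^-1` [set x]).

Lemma FU_eq_fst p y : FU p -> bproj B (Fmap p) = cinv c y -> crange c y -> p.1 = y.
Proof.
move=> [Dp _]; rewrite bproj_Fmap// => e cy.
have [_ <-] := crangeK cy; rewrite -e.
by have [] := crangeK Dp.1.
Qed.

(** Openness of [F] turns a ball of coordinates into a neighbourhood in B, and the convexity of the
    ball keeps the segments to its centre inside the domain. *)
Lemma Hpull_locally_constant y (q : stab_model) : FU (y, q) ->
  exists2 O : set B, nbhs (Fmap (y, q)) O & forall b,
    O b -> bproj B b = cinv c y ->
    exists q', [/\ FU (y, q'), b = Fmap (y, q') & Hpull (y, q') = Hpull (y, q)].
Proof.
move=> Fp.
have : nbhs (y, q) FU by apply: open_nbhs_nbhs; split => //; exact: FU_open.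
move=> /nbhs_ballP[r r0 hr].
exists (Fmap @` ball (y, q) r).
  apply: Fmap_open; first exact: Fp.1.
  exact: nbhsx_ballx.
move=> _ [[y' q'] [/= by' bq'] <-] hb.
have F' : FU (y', q') by exact: hr.
have yE : y' = y := FU_eq_fst F' hb Fp.1.1.
rewrite yE in F' hb by' *; exists q'; split => //.
apply: Hpull_segment => t /andP[t0 t1]; apply: hr; split => /=; first exact: ballxx.
move: bq'; rewrite -!ball_normE /= => bq'.
rewrite opprD addrA subrr sub0r normrN normrZ ger0_norm//.
rewrite distrC in bq'; apply: le_lt_trans bq'.
by rewrite ler_piMl.
Qed.

Lemma Hpull_unique y (q q' : stab_model) : FU (y, q) -> FU (y, q') ->
  Hpull (y, q) = Hpull (y, q').
Proof.
move=> Fp Fp'.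
pose A := U `&` bproj B @^-1` [set cinv c y].
(* The part of the fibre where the matrix has its value at [q]. By [loc] below, membership in [S] is
   locally constant on [A], which makes [S] both open and closed in the connected set [A]. *)
pose S := [set b | A b /\ forall q', FU (y, q') -> b = Fmap (y, q') ->
                     Hpull (y, q') = Hpull (y, q)].
have Ab q1 : FU (y, q1) -> A (Fmap (y, q1)).
  by move=> F1; split; [exact: F1.2|rewrite /= bproj_Fmap//; exact: F1.1].
have repr b : A b -> exists2 q1, FU (y, q1) & b = Fmap (y, q1).
  move=> [Ub /= bx]; have cy : crange c y := Fp.1.1; have [cx xy] := crangeK cy.
  have [|q1 q10 bE] := @Fmap_surj b; first by rewrite bx.
  rewrite bx xy in bE; exists q1 => //; split; first by [].
  by rewrite /= -bE.
have wd q1 q2 : FU (y, q1) -> FU (y, q2) -> Fmap (y, q1) = Fmap (y, q2) ->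
    Hpull (y, q1) = Hpull (y, q2).
  by move=> F1 F2; apply: Hpull_fibre; [exact: F1.1|exact: F2.1].
have loc b : A b -> nbhs b [set b' | A b' -> (S b' <-> S b)].
  move=> Ab'; have [q1 F1 bE] := repr b Ab'.
  have [N Nb hN] := Hpull_locally_constant F1.
  rewrite bE; apply: filterS Nb => b' Nb' Ab1.
  have [q2 [F2 b'E H2]] := hN b' Nb' Ab1.2.
  split=> -[_ hS].
    split; first exact: Ab.
    by move=> q3 F3 e3; rewrite -(wd q1 q3)// -H2 (hS q2).
  split=> // q3 F3 e3; rewrite -(wd q2 q3) -?b'E// H2; exact: hS.
have Sq : S (Fmap (y, q)).
  by split=> [|q1 F1 e]; [exact: Ab|exact/esym/wd].
have SA : S = A.
  apply: (@U_fibre (cinv c y) S); first by exists (Fmap (y, q)).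
    exists [set b | A b -> S b]^°; first exact: open_interior.
    apply/seteqP; split=> b.
      move=> Sb; split; first exact: Sb.1.
      by apply: filterS (loc b Sb.1) => b' h Ab'; apply/(h Ab').
    by move=> [Ab' /interior_subset]; exact.
  exists (~` [set b | A b -> ~ S b]^°); first by rewrite closedC; exact: open_interior.
  apply/seteqP; split=> b.
    by move=> Sb; split; [exact: Sb.1|move=> /interior_subset h; exact: (h Sb.1)].
  move=> [Ab' nb]; apply: contrapT => nS; apply: nb.
  by apply: filterS (loc b Ab') => b' h Ab1 Sb'; apply: nS; apply/(h Ab1).
have [_ h] : S (Fmap (y, q')) by rewrite SA; exact: Ab.
by rewrite (h q').
Qed.

Hypothesis h2_nondeg : forall b, U b -> hdet h2 b != 0.

Lemma hdetE b : U b -> hdet h2 b = \det (hmx b).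
Proof.
by move=> Ub; rewrite /hdet det2 !mxE normCK (h2_herm 1 0 Ub).
Qed.

Lemma Hpull_herm p : FU p -> herm2 (Hpull p).
Proof. by move=> [_ Up]; exact/herm2_congr2/hmx_herm. Qed.

Lemma Hpull_det p : FU p -> \det (Hpull p) != 0.
Proof.
move=> [[_ q0] Up]; rewrite det_congr2 mulf_neq0//; last by rewrite -hdetE ?h2_nondeg.
by rewrite expf_neq0// normr_eq0; rewrite stab_domE in q0.
Qed.

Lemma quadratic_form_Fmap e p v : atlas B e -> (Fdome e `&` FU) p ->
  let u := dmap (bproj B) e c (Fmap p) v in
  quadratic_form theta h2 e (Fmap p) v =
  \sum_(k < 2) \sum_(l < 2)
    Hpull p k l / \det (Hpull p) ^+ 2 * (dz k u * (dz l u)^*).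
Proof.
move=> eB Np; have [[Dp ep] [_ Up]] := Np.
have [[u w] <-] := Fcoord_surj v eB Np.1; rewrite (dmap_bproj (u, w) eB Np.1) /=.
have d0 : \det (Amx p.2) != 0 by move: Dp.2; rewrite stab_domE.
have dh0 : \det (hmx (Fmap p)) != 0 by rewrite -hdetE ?h2_nondeg.
rewrite /Hpull -(pullback_algebra d0 (hmx_herm Up) dh0 (theta_base u w eB Np.1)).
rewrite /quadratic_form hdetE//; congr (_ / _).
by apply: eq_bigr => i _; apply: eq_bigr => j _; rewrite mxE.
Qed.

(** With [q] frozen the only varying factor is [h2] along [F], whose regularity is obtained locally
    from charts of B. *)
Lemma Hpull_base_CkC n (q : stab_model) k l :
  CkC n (fun y => Hpull (y, q) k l) [set y | FU (y, q)].
Proof.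
have oN : open [set y | FU (y, q)].
  rewrite openE => y Fy; have : nbhs (y, q) FU.
    by apply: open_nbhs_nbhs; split => //; exact: FU_open.
  have : (fun y' : C2 => (y', q)) @ y --> (y, q).
    exact: differentiable_continuous (has_diff_pair (has_diff_id y) (has_diff_cst q y)).1.
  by move=> h /h.
have hh i j : CkC n (fun y => h2 i j (Fmap (y, q))) [set y | FU (y, q)].
  suff hl : forall y, FU (y, q) -> exists N : set C2, [/\ N y &
      CkC n (fun y => h2 i j (Fmap (y, q))) N].
    by split; apply: Ck_local => y /hl[N [Ny [a b]]]; exists N.
  move=> y Fy; have [e eB ep] := atlas_cover (Fmap (y, q)).
  pose N := [set y | (Fdome e `&` FU) (y, q)].
  have oN' : open N.
    rewrite openE => y' Fy'; have : nbhs (y', q) (Fdome e `&` FU).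
      by apply: open_nbhs_nbhs; split => //; exact: FUe_open.
    have : (fun y' : C2 => (y', q)) @ y' --> (y', q).
      exact: differentiable_continuous (has_diff_pair (has_diff_id y') (has_diff_cst q y')).1.
    by move=> h /h.
  exists N; split; first by split => //; split => //; exact: Fy.1.
  apply: (@CkC_comp _ _ _ n (fun y => (y, q)) _ _ _ (findim_prod findim_C2 findim_stab)
    oN' _ _ (h2_Fmap_CkC n i j eB)) => //.
  apply: Ck_pair => //; last exact: Ck_cst.
  by apply: (@Ck_lin _ _ _ n idfun) => // z; exact: cvg_id.
apply: (@CkC_ext _ _ _ (fun y => \sum_(j < 2)
  (\sum_(i < 2) adj2 (Amx q) i k * h2 i j (Fmap (y, q))) * (adj2 (Amx q) j l)^*)) => //.
  move=> y _; rewrite /Hpull congr2E; apply: eq_bigr => j _; congr (_ * _).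
  by apply: eq_bigr => i _; rewrite mxE.
apply: CkC_sum => // j; apply: CkCM => //; last exact: CkC_cst.
apply: CkC_sum => // i; apply: CkCM => //; exact: CkC_cst.
Qed.

Lemma Hpull_base_diff (y : C2) (q : stab_model) : FU (y, q) ->
  exists kappa : 'I_2 -> C, forall u,
  let Y k l := \sum_(m < 2) Pimx nabla c (cinv c y) u m k * Hpull (y, q) m l +
               (\sum_(m < 2) eps m k * dz m u) * kappa l in
  forall k l, dC (fun y => Hpull (y, q) k l) y u = Y k l + (Y l k)^*.
Proof.
move=> Fp; have [kappa hk] := Hpull_horizontal Fp; exists kappa => u Y k l.
rewrite -(hk u k l); have [e eB ep] := atlas_cover (Fmap (y, q)).
have Dp : Fdome e (y, q) by split => //; exact: Fp.1.
have hH := Hpull_diff k l eB (conj Dp Fp).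
have hc := has_diffC_comp (has_diff_pair (has_diff_id y) (has_diff_cst q y)) hH.
by rewrite (has_diffCE _ hc) (has_diffCE _ hH).
Qed.

End PullBack.
End Theta.
End BundleMap.

(** * Comparison of charts and assembly of the global metric *)

Lemma dmap_transition {R : realType} (M : complex_surface R) (B : principal_bundle M)
    (e : chart B (@R16 R)) (c c' : chart M (@C2 R)) (b : B) v :
  atlas B e -> atlas M c -> atlas M c' -> cdom e b ->
  cdom c (bproj B b) -> cdom c' (bproj B b) ->
  dmap (bproj B) e c' b v =
  'd (transition c c') (cmap c (bproj B b)) (dmap (bproj B) e c b v).
Proof.
move=> eB cM cM' eb cb cb'; have [cont hp] := proj_smooth eB.
have hd (c0 : chart M (@C2 R)) : atlas M c0 -> cdom c0 (bproj B b) ->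
    has_diff (fun z => cmap c0 (bproj B (cinv e z))) (cmap e b)
      (dmap (bproj B) e c0 b).
  move=> c0M cb0; have h1 : Ck 1 _ _ := hp c0 c0M 1%N.
  apply: (Ck_diff h1); split; first by exists b.
  by rewrite /= base_chartK.
have O : overlap c c' (cmap c (bproj B b)) by exists (bproj B b).
have ht := Ck_diff (transition_smooth 1 cM cM') O.
have bE : bproj B b = bproj B (cinv e (cmap e b)) by rewrite base_chartK.
rewrite {1}bE in ht; have hc := has_diff_comp (hd c cM cb) ht.
have h' : has_diff (fun z => cmap c' (bproj B (cinv e z))) (cmap e b)
    (fun v => 'd (transition c c') (cmap c (bproj B b)) (dmap (bproj B) e c b v)).
  apply: near_has_diff hc.
  have : nbhs (cmap e b) (crange e `&` [set z | cdom c (bproj B (cinv e z))]).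
    apply: open_nbhs_nbhs; split.
      apply: (open_on_preimage (f := fun z => bproj B (cinv e z))).
      - by have [[]] := atlas_chart eB.
      - by move=> z [b' eb' <-]; apply: cont; exists b'.
      - by have [[]] := atlas_chart cM.
    by split; [exists b|rewrite /= base_chartK].
  by apply: filterS => z [_ cz]; rewrite /transition chartK.
by rewrite -(has_diffE v h') (has_diffE v (hd c' cM' cb')).
Qed.

Theorem theorem3p2 (R : realType) (M : complex_surface R)
  (nabla : connection M) (hnabla : complex_linear_connection setT nabla)
  (B : principal_bundle M) (theta : mform1 B)
  (hB : cartan_geometry nabla theta)
  (L : 'I_2 -> B -> R[i]) (K : 'I_2 -> 'I_2 -> 'I_2 -> B -> R[i])
  (W : 'I_2 -> 'I_2 -> 'I_2 -> 'I_2 -> B -> R[i])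
  (hcurv : curvature_functions theta L K W)
  (U : set B) (hUopen : open U) (hUconn : connected U)
  (hUfibre : forall x : M, connected (U `&` bproj B @^-1` [set x]))
  (h2 : 'I_2 -> 'I_2 -> B -> R[i]) (h1 : 'I_2 -> B -> R[i]) (h0 : B -> R)
  (h2smooth : forall i j, smooth_fun (h2 i j) U)
  (h1smooth : forall i, smooth_fun (h1 i) U)
  (h0smooth : smooth_fun (fun b => (h0 b)%:C%C) U)
  (h2herm : forall i j b, U b -> h2 i j b = (h2 j i b)^*)
  (hsys : linear_system theta K W U h2 h1 h0)
  (hnondeg : forall b, U b -> hdet h2 b != 0) :
  exists g : bilinear_field M,
    [/\ pseudo_kaehler (bproj B @` U) g,
        compatible (bproj B @` U) nabla g &
        is_pullback U g (quadratic_form theta h2)].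
Proof.
move: hB => [hth hsec].
pose C2 := @Defs.C2 R.
pose V := bproj B @` U.
have [sec hs] : {sec : chart M C2 -> M -> B &
    forall c, atlas M c -> adapted_section nabla theta c (sec c)}.
  apply: (@choice _ _ (fun c s => atlas M c -> adapted_section nabla theta c s)) => c.
  have [cM|ncM] := pselect (atlas M c).
    by have [s hs _] := hsec c cM; exists s.
  (* Outside the atlas any set-theoretic section serves as a default value, since the choice
     function has to be total. *)
  by have [s _] := choice (@proj_surjective _ _ B); exists s.
have sm c (cM : atlas M c) : smooth_map (sec c) (cdom c) by have [] := hs c cM.
have se c (cM : atlas M c) : forall x, cdom c x -> bproj B (sec c x) = x.
  by have [] := hs c cM.
have FUq c b : atlas M c -> U b -> cdom c (bproj B b) ->
    exists2 q, FU c (sec c) U (cmap c (bproj B b), q) &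
      b = Fmap c (sec c) (cmap c (bproj B b), q).
  move=> cM Ub cb; have [q q0 bE] := Fmap_surj cM (se c cM) cb.
  exists q => //; split; last by rewrite /= -bE.
  by split => //; exists (bproj B b).
(* For each chart and point some fibre coordinate landing in [U] is chosen, with no regularity in
   the point; [HE] shows that [H] does not depend on this choice. *)
have [qf hq] : {qf : chart M C2 * M -> stab_model &
    forall cx, atlas M cx.1 -> (cdom cx.1 `&` V) cx.2 ->
      FU cx.1 (sec cx.1) U (cmap cx.1 cx.2, qf cx)}.
  apply: (@choice _ _ (fun cx q => atlas M cx.1 -> (cdom cx.1 `&` V) cx.2 ->
    FU cx.1 (sec cx.1) U (cmap cx.1 cx.2, q))) => -[c x] /=.
  have [[cM [cx [b Ub bx]]]|h] :=
      pselect (atlas M c /\ (cdom c `&` V) x); last first.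
    by exists 0 => cM xV; case: h.
  have cb : cdom c (bproj B b) by rewrite bx.
  by have [q Fq _] := FUq c b cM Ub cb; exists q => _ _; rewrite -bx.
pose H c x := Hpull c (sec c) h2 (cmap c x, qf (c, x)).
have FUV c y q : atlas M c -> FU c (sec c) U (y, q) ->
    (cdom c `&` V) (cinv c y) /\ cmap c (cinv c y) = y.
  move=> cM Fp; have [cy yE] := crangeK cM Fp.1.1; split => //; split => //.
  by exists (Fmap c (sec c) (y, q)); [exact: Fp.2|rewrite (bproj_Fmap cM (se c cM) Fp.1)].
have HE c y q : atlas M c -> FU c (sec c) U (y, q) ->
    H c (cinv c y) = Hpull c (sec c) h2 (y, q).
  move=> cM Fp; have [xV yE] := FUV c y q cM Fp; have := hq (c, cinv c y) cM xV.
  rewrite /H /= yE => Fp'.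
  exact: (Hpull_unique cM (sm c cM) (se c cM) hth (hs c cM) hUopen h2smooth h2herm hsys
    hUfibre Fp' Fp).
have FUx c x : atlas M c -> (cdom c `&` V) x ->
    FU c (sec c) U (cmap c x, qf (c, x)) by move=> cM xV; exact: (hq (c, x)).
have H_herm c x : atlas M c -> (cdom c `&` V) x -> herm2 (H c x).
  by move=> cM xV; exact: Hpull_herm h2herm _ (FUx c x cM xV).
have H_det c x : atlas M c -> (cdom c `&` V) x -> \det (H c x) != 0.
  by move=> cM xV; exact: Hpull_det h2herm hnondeg _ (FUx c x cM xV).
have near_FU c x : atlas M c -> (cdom c `&` V) x ->
    open [set y | FU c (sec c) U (y, qf (c, x))].
  move=> cM xV.
  have := @open_on_preimage _ _ (fun y : C2 => (y, qf (c, x))) setT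
    (FU c (sec c) U) openT _ (FU_open cM (sm c cM) hUopen).
  rewrite setTI; apply=> y _.
  exact: differentiable_continuous
    (has_diff_pair (has_diff_id y) (has_diff_cst (qf (c, x)) y)).1.
have H_smooth c x : atlas M c -> (cdom c `&` V) x ->
    exists N : set C2, [/\ open N, N (cmap c x), N `<=` cmap c @` (cdom c `&` V) &
      forall n k l, CkC n (fun y => H c (cinv c y) k l) N].
  (* The coordinate chosen at [x] is kept fixed nearby: by [HE] the smooth function so obtained is
     [H]. *)
  move=> cM xV; exists [set y | FU c (sec c) U (y, qf (c, x))]; split.
  - exact: near_FU.
  - exact: FUx.
  - by move=> y /(FUV c y _ cM)[yV yE]; exists (cinv c y).
  - move=> n k l; apply: CkC_ext (Hpull_base_CkC cM (sm c cM) hUopen h2smooth n _ k l).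
      exact: near_FU.
    by move=> y Fy; rewrite (HE _ _ _ cM Fy).
have H_diff c x : atlas M c -> (cdom c `&` V) x ->
    exists kappa : 'I_2 -> R[i], forall u,
    let Y k l := \sum_(s < 2) Pimx nabla c x u s k * H c x s l +
                 (\sum_(s < 2) eps s k * dz s u) * kappa l in
    forall k l, dC (fun y => H c (cinv c y) k l) (cmap c x) u = Y k l + (Y l k)^*.
  move=> cM xV; have Fp := FUx c x cM xV.
  have [kappa hk] := Hpull_base_diff cM (sm c cM) hth (hs c cM) hUopen h2smooth h2herm
    hsys Fp.
  exists kappa => u Y k l; have := hk u k l; rewrite (chartK cM xV.1) => <-.
  have hd := CkC_has_diff
    (Hpull_base_CkC cM (sm c cM) hUopen h2smooth 1 (qf (c, x)) k l) Fp.
  apply: (has_diffCE u); apply: near_has_diffC hd.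
  have : nbhs (cmap c x) [set y | FU c (sec c) U (y, qf (c, x))].
    by apply: open_nbhs_nbhs; split => //; exact: near_FU.
  by apply: filterS => y Fy; rewrite (HE _ _ _ cM Fy).
have pull : is_pullback U (Hmetric H) (quadratic_form theta h2).
  move=> e c b v eB cM eb Ub cb /=; set u := dmap _ _ _ _ _.
  have [q Fp bE] := FUq c b cM Ub cb.
  have xV : (cdom c `&` V) (bproj B b) by split => //; exists b.
  rewrite (Hmetric_quadratic H_herm u cM xV).
  have := HE c _ q cM Fp; rewrite (chartK cM cb) => ->.
  have Dp : (Fdome c (sec c) e `&` FU c (sec c) U) (cmap c (bproj B b), q).
    by split => //; split; [exact: Fp.1|rewrite /= -bE].
  have := quadratic_form_Fmap cM (sm c cM) (se c cM) hth (hs c cM) h2herm hnondeg v eB Dp.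
  by rewrite /= -bE.
have H_inv c c' x : atlas M c -> atlas M c' -> (cdom c `&` cdom c' `&` V) x ->
    forall u v,
    Hmetric H c' x ('d (transition c c') (cmap c x) u) ('d (transition c c') (cmap c x) v)
    = Hmetric H c x u v.
  move=> cM cM' [[cx cx'] xV] u v.
  have [b Ub bx] := xV; have [e eB eb] := atlas_cover b.
  (* Each tangent vector lifts to B, where both metrics pull back to the same quadratic form;
     polarisation then gives the bilinear statement. *)
  have quad w : Hmetric H c' x ('d (transition c c') (cmap c x) w)
      ('d (transition c c') (cmap c x) w) = Hmetric H c x w w.
    have cb : cdom c (bproj B b) by rewrite bx.
    have cb' : cdom c' (bproj B b) by rewrite bx.
    have [v' hv'] := proj_submersion eB cM eb cb w.
    have pc := pull e c b v' eB cM eb Ub cb; have pc' := pull e c' b v' eB cM' eb Ub cb'.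
    move: pc'; rewrite pc /= (dmap_transition v' eB cM cM' eb cb cb') hv' bx.
    by move=> /complexI ->.
  rewrite (Hmetric_polarization H_herm _ _ cM' (conj cx' xV)).
  by rewrite -linearD !quad -(Hmetric_polarization H_herm _ _ cM (conj cx xV)).
have [kaehler compat] := base_geometry hnabla H_herm H_det H_smooth H_diff H_inv.
by exists (Hmetric H).
Qed.
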